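(* Let $g$ be a totally positive function of Gaussian type, and let $f \in V^\infty(g)$ be non-zero (not identically zero). Then the zero set $\{f=0\} = \{x\in\mathbb{R} : f(x)=0\}$, counted without multiplicities, satisfies $$D^+_{\mathrm{circ}}(\{f=0\}) \leq 1.$$
   Context: A totally positive function of Gaussian type is a function $g \in L^2(\mathbb{R})$ whose Fourier transform factors as $$\hat g(\xi) = \int_{\mathbb{R}} g(x) e^{-2\pi i x \xi}\,dx = C_0 e^{-\gamma \xi^2} \prod_{\nu=1}^m (1+2\pi i \delta_\nu \xi)^{-1}, \qquad \xi \in \mathbb{R},$$ with $\delta_1,\ldots,\delta_m \in \mathbb{R}$, $C_0,\gamma > 0$, $m \in \mathbb{N}\cup\{0\}$ (the empty product for $m=0$ equals $1$). As usual, $g$ is identified with its continuous representative. The shift-invariant space generated by $g$ within $L^\infty(\mathbb{R})$ is $$V^\infty(g) = \Big\{ f = \sum_{k\in\mathbb{Z}} c_k\, g(\cdot - k) : c \in \ell^\infty(\mathbb{Z}) \Big\},$$ where the coefficients $c_k$ may be complex (so $f$ need not be real-valued). Each $f \in V^\infty(g)$ is continuous (so point values make sense), the defining series converges unconditionally in the weak$^*$ topology of $L^\infty(\mathbb{R})$, and the coefficients $c_k$ are uniquely determined by $f$. The upper average circular density of a set $\Lambda \subseteq \mathbb{R}$ is $$D^+_{\mathrm{circ}}(\Lambda) = \limsup_{r\to\infty} \frac{4}{\pi r^2} \int_0^r \sum_{\lambda \in \Lambda\cap[-t,t]} \sqrt{t^2-\lambda^2}\,\frac{dt}{t} \in [0,\infty],$$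 with the convention that $D^+_{\mathrm{circ}}(\Lambda) = \infty$ if $\Lambda$ is uncountably infinite. *)

(* Defs.v *)
From HB Require Import structures.
From mathcomp Require Import all_boot all_order all_algebra finmap.
From mathcomp Require Import all_classical all_reals all_analysis.
From mathcomp Require Import complex.
From mathcomp.analysis Require Import showcase.summability.

Set Implicit Arguments.
Unset Strict Implicit.
Unset Printing Implicit Defensive.
Import Order.TTheory GRing.Theory Num.Theory.
Import numFieldNormedType.Exports.
Local Open Scope classical_set_scope.
Local Open Scope ring_scope.
Local Open Scope complex_scope.

Definition expi (R : realType) (t : R) : R[i] := cos t +i* sin t.

Definition cRintegral (R : realType) (f : R -> R[i]) : R[i] :=
  (\int[lebesgue_measure]_x complex.Re (f x)) +i*
  (\int[lebesgue_measure]_x complex.Im (f x)).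

(* Functions, not classes modulo almost everywhere equality *)
Definition cLfun (R : realType) (p : \bar R) (f : R -> R[i]) : Prop :=
  [/\ measurable_fun setT (fun x => complex.Re (f x)),
      measurable_fun setT (fun x => complex.Im (f x)) &
      finite_norm lebesgue_measure p (fun x => Normc.normc (f x))].

Definition fourier (R : realType) (g : R -> R[i]) (xi : R) : R[i] :=
  cRintegral (fun x => g x * expi (- (2 * pi * x * xi))).

(* Integrability is needed for the Fourier integral to be meaningful; it loses
   no generality, as every such g decays at least exponentially. *)
Definition tp_gaussian_type (R : realType) (g : R -> R[i]) : Prop :=
  [/\ cLfun 2%:E g, cLfun 1%:E g, continuous (g : R -> R[i]^o) &
      exists (m : nat) (delta : 'I_m -> R) (C0 gamma : R),
        [/\ 0 < C0, 0 < gamma &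
            forall xi : R, fourier g xi =
              (C0 * expR (- (gamma * xi ^+ 2)))%:C *
              \prod_(nu < m) (1 +i* (2 * pi * delta nu * xi))^-1]].

(* The sum over Z converges unconditionally (along the finite subsets of Z) to
   f in the weak* topology of L^oo, the dual of L^1. *)
Definition weak_star_shift_sum (R : realType) (g : R -> R[i]) (c : int -> R[i])
    (f : R -> R[i]) : Prop :=
  forall h : R -> R[i], cLfun 1%:E h ->
    (fun K : {fset int} =>
       cRintegral (fun x => (\sum_(k <- K) c k * g (x - k%:~R)) * h x) : R[i]^o)
      @ totally --> (cRintegral (fun x => f x * h x) : R[i]^o).

(* An element of the space is given by its continuous representative. *)
Definition Vinfty (R : realType) (g f : R -> R[i]) : Prop :=
  [/\ cLfun +oo%E f, continuous (f : R -> R[i]^o) &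
      exists c : int -> R[i],
        (exists M : R, forall k, Normc.normc (c k) <= M) /\
        weak_star_shift_sum g c f].

(* For an uncountable L the value is +oo by convention. *)
Definition upper_circ_density (R : realType) (L : set R) : \bar R :=
  if `[< countable L >] then
    limf_esup (fun r : R =>
      ((4 / (pi * r ^+ 2))%:E *
       \int[lebesgue_measure]_(t in `]0%R, r])
         ((\esum_(l in L `&` `[(- t)%R, t]) (Num.sqrt (t ^+ 2 - l ^+ 2))%:E)
          * (t^-1)%:E))%E)
      (pinfty_nbhs R)
  else +oo%E.

(* Main.v *)
Require Import Defs.
From mathcomp Require Import all_boot all_order all_algebra finmap.
From mathcomp Require Import all_classical all_reals all_analysis.
From mathcomp Require Import complex.
From mathcomp Require Import measurable_realfun ess_sup_inf.
From mathcomp.analysis Require Import showcase.summability.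
From mathcomp Require Import ring lra zify.
Set Implicit Arguments.
Unset Strict Implicit.
Unset Printing Implicit Defensive.
Import Order.TTheory GRing.Theory Num.Theory.
Import numFieldNormedType.Exports.
Local Open Scope classical_set_scope.
Local Open Scope ring_scope.

(** Let [u] be the real or the imaginary part of [f], whichever is not
identically zero. The zeros of [f] are zeros of [u], and [u] can be written as
[u = T_1 ... T_m F] with a Gaussian series
[F x = sum_k c_k exp(- a (x - k)^2)], [a = pi^2 / gamma], with bounded real
coefficients, and with the operators
[T v y = int_0^oo exp(- s) v (y - d s) ds]. Such an operator inverts
[v |-> v + d v'] on bounded functions, so its Fourier multiplier is a factor
[(1 + 2 pi i d xi)^-1]; this is how [g] arises from a Gaussian. The formula for
[u] is [Vinfty_representation]. It is obtained by testing the weak* convergent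
series against narrow heat kernels, for which both sides are computed by
Fubini, and by letting the width of the kernel tend to zero.

Everything then rests on counting the zeros of [F], in the form
[sum_(l in A) (x - `|l|) <= (1 + eta) x^2 + C] for every finite set [A] of zeros
in [[-x, x]] ([quadratic_count]). Writing
[F x = exp(- a x^2) sum_k b_k exp(2 a k x)] with [b_k = c_k exp(- a k^2)], the
real zeros of [F] are the logarithms of the positive zeros of the Laurent series
[B z = sum_k b_k z^k], up to the factor [2 a]. Jensen's formula on the circle
[|z| = exp(2 a x)] bounds [sum 2 a (x - l)] by the logarithm of the mean of [B]
on that circle, which is at most [a x^2] up to a constant because the [c_k] are
bounded, minus the logarithm of a single term of the series. This takes place
entirely on the coefficients ([discrete_jensen]): reflecting a zero across the
circle does not change the modulus of [B] on the circle except for the factor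
[exp(2 a (x - l))], and Parseval turns this into a statement about sums of
squares of coefficients, which is an exact telescoping identity
([flip_energy]). Zeros on the left half-line are handled by the reflection
[x |-> -1 - x].

The operators [T] are harmless for the count: between two zeros of [T v] lies a
zero of [v] ([relax_rolle]), by the argument of Rolle's theorem applied to
[exp(y / d) T v y].

Finally, integrating [sqrt(t^2 - l^2) / t] over [t <= r] gives
[int_0^(pi/2) max(r cos w - `|l|, 0) dw] ([chord_le_sector]). Summing over the
zeros and using the count with [x = r cos w] gives at most
[(1 + eta) r^2 int_0^(pi/2) cos^2 w dw + O(1) = (1 + eta) pi r^2 / 4 + O(1)],
which is exactly the normalization of the circular density. *)

(** * A discrete Jensen inequality *)

Section jensen.
Context {R : realType}.
Implicit Types (b s c : int -> R) (k : int).

Lemma subzSr1 k (i : nat) : k - i.+1%:Z - 1 = k - i.+2%:Z.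
Proof. by lia. Qed.

Lemma addzSr1 k (i : nat) : k + i.+1%:Z - 1 = k + i%:Z.
Proof. by lia. Qed.

(** These are the coefficient sequences of Laurent series [sum_k b_k z^k]
converging on the whole punctured plane. *)
Definition rapid b := forall t : R, exists C : R,
  forall k, `|b k| * expR (t * k%:~R) <= C.

(** Vanishing of the Laurent series [sum_k b_k z^k] at [z = exp tau], expressed
by the factorization of the series by [1 - exp(- tau) z] with a cofactor that
still converges everywhere; no evaluation of the series is involved. *)
Definition rootexp b (tau : R) := exists s : int -> R,
  rapid s /\ forall k, b k = s k - expR (- tau) * s (k - 1).

Lemma rapid_lin b c (x y : R) : rapid b -> rapid c ->
  rapid (fun k => x * b k + y * c k).
Proof.
move=> hb hc t; have [C hC] := hb t; have [D hD] := hc t.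
exists (`|x| * C + `|y| * D) => k.
have /le_trans : `|x * b k + y * c k| * expR (t * k%:~R) <=
  (`|x| * `|b k| + `|y| * `|c k|) * expR (t * k%:~R).
  by rewrite ler_wpM2r ?expR_ge0// -!normrM ler_normD.
apply; rewrite mulrDl -!mulrA lerD// ler_wpM2l//.
Qed.

Lemma rapid_shift b : rapid b -> rapid (fun k => b (k - 1)).
Proof.
move=> hb t; have [C hC] := hb t; exists (C * expR t) => k.
have := hC (k - 1); rewrite intrB mulrBr mulr1 => h.
rewrite -[t * k%:~R](subrK t) expRD mulrA ler_wpM2r ?expR_ge0//.
Qed.

(** The other roots survive when one factor [1 - exp(- tau) z] is replaced by
[1 - beta z]: distinct linear factors divide the cofactor, because
[1 - exp(- tau) z] and [1 - exp(- tau') z] generate the unit ideal. *)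
Lemma rootexp_flip b s (tau tau' beta : R) : tau != tau' -> rapid s ->
  (forall k, b k = s k - expR (- tau) * s (k - 1)) -> rootexp b tau' ->
  rootexp (fun k => s k - beta * s (k - 1)) tau'.
Proof.
move=> tt' rs bs [s' [rs' bs']].
set x := expR (- tau); set y := expR (- tau').
have xy : x - y != 0.
  by rewrite subr_eq0; apply: contra tt' => /eqP /expR_inj /oppr_inj ->.
pose r k := x / (x - y) * s k + - (y / (x - y)) * s' k.
have rr : rapid r by exact: rapid_lin.
have sr k : s k = r k - y * r (k - 1).
  have e : s' k - y * s' (k - 1) = s k - x * s (k - 1) by rewrite -bs' bs.
  apply: (mulfI xy); transitivity (x * (s k - y * s (k - 1)) -
      y * (s' k - y * s' (k - 1))); first by rewrite e; ring.
  by rewrite /r; field.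
exists (fun k => r k - beta * r (k - 1)); split.
  suff -> : (fun k => r k - beta * r (k - 1)) =
      (fun k => 1 * r k + - beta * r (k - 1)).
    exact: rapid_lin (rapid_shift rr).
  by apply/funext => k; rewrite mul1r mulNr.
by move=> k; rewrite -/y !sr; ring.
Qed.

Lemma rapid_cvg0 s k (X : R) : rapid s ->
  (fun n : nat => s (k + n%:Z) * expR (X * (k + n%:Z)%:~R)) @ \oo --> 0.
Proof.
move=> rs; have [C hC] := rs (X + 1).
have g0 : (fun n => C * expR (- k%:~R) * expR (- 1) ^+ n) @ \oo --> 0.
  rewrite -[X in _ --> X](mulr0 (C * expR (- k%:~R))).
  apply: cvgMl_tmp; apply: cvg_expr.
  by rewrite ger0_norm ?expR_ge0// expR_lt1 ltrN10.
apply: norm_cvg0; apply: (squeeze_cvgr _ (cvg_cst 0) g0).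
apply: nearW => n; rewrite normr_ge0/= normrM (ger0_norm (expR_ge0 _)).
have := hC (k + n%:Z); rewrite mulrDl expRD mul1r.
rewrite -expRM_natl => h.
have -> : C * expR (- k%:~R) * expR (n%:R * -1) = C * expR (- (k + n%:Z)%:~R).
  by rewrite -mulrA -expRD intrD -pmulrn; congr (_ * expR _); ring.
by rewrite [expR (- _)]expRN ler_pdivlMr ?expR_gt0// -mulrA.
Qed.

(** Parseval for reflected zeros. On the circle [|z| = exp X] the two factors
[1 - exp(- t) z] and [exp(X - t) (1 - exp(t - 2 X) z)] have the same modulus; with
[alpha = exp(X - t)] and rescaled coefficients [u], the difference of the two sums
of squares telescopes to [(alpha^2 - 1) (u_K^2 - u_0^2)]. Truncating the series
below leaves the boundary term [- u_0^2], whose sign is favourable. *)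
Lemma flip_energy (u : nat -> R) (alpha W : R) : 1 <= alpha ->
  u @ \oo --> 0 ->
  (forall K, \sum_(j < K) (u j.+1 - alpha * u j) ^+ 2 <= W) ->
  forall K, \sum_(j < K) (alpha * u j.+1 - u j) ^+ 2 <= W.
Proof.
move=> a1 u0 hW K0; apply/ler_addgt0Pr => e e0.
have E K : \sum_(j < K) (alpha * u j.+1 - u j) ^+ 2 =
    \sum_(j < K) (u j.+1 - alpha * u j) ^+ 2 +
    (alpha ^+ 2 - 1) * (u K ^+ 2 - u 0%N ^+ 2).
  elim: K => [|K IH]; first by rewrite !big_ord0; ring.
  by rewrite !big_ord_recr /= IH; ring.
have a2 : 0 <= alpha ^+ 2 - 1 by rewrite subr_ge0 expr_ge1 // (le_trans _ a1).
have : (fun n => (alpha ^+ 2 - 1) * (u n * u n)) @ \oo --> (alpha ^+ 2 - 1) * (0 * 0).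
  by apply: cvgMl_tmp; apply: cvgM.
rewrite !mulr0 => /cvgrPdist_le /(_ e e0) [N _ hN].
pose K := (K0 + N)%N.
have : \sum_(j < K0) (alpha * u j.+1 - u j) ^+ 2 <=
       \sum_(j < K) (alpha * u j.+1 - u j) ^+ 2.
  rewrite -!(big_mkord xpredT (fun j => (alpha * u j.+1 - u j) ^+ 2)).
  by rewrite (big_cat_nat (leq0n _) (leq_addr N K0)) /= lerDl sumr_ge0// => *; rewrite sqr_ge0.
move=> /le_trans; apply; rewrite E lerD//.
have := hN K (leq_addl _ _); rewrite sub0r normrN => h.
apply: le_trans h; apply: le_trans (ler_norm _).
by rewrite ler_wpM2l// expr2 lerBlDr lerDl sqr_ge0.
Qed.

(** Geometric inversion of [1 - q S], with [S] the shift. The bound of [v] only has to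
exist: after [n] steps it is multiplied by [2^-n]. *)
Lemma unflip_bound (u v : nat -> R) (q m : R) : 0 <= q <= 1 / 2 ->
  (exists C, forall j, `|v j| <= C) -> (forall j, `|u j| <= m) ->
  (forall j, u j = v j - q * v j.+1) -> forall j, `|v j| <= 2 * m.
Proof.
move=> /andP[q0 q1] [C hC] hm e.
have C0 : 0 <= C by apply: le_trans (hC 0%N).
have h n : forall j, `|v j| <= 2 * m + C * (1 / 2) ^+ n.
  elim: n => [|n IH] j.
    rewrite expr0 mulr1; have := hC j; have := le_trans (normr_ge0 _) (hm j); lra.
  have -> : v j = u j + q * v j.+1 by rewrite e; ring.
  apply: le_trans (ler_normD _ _) _; rewrite normrM (ger0_norm q0) exprS.
  have := hm j; have := IH j.+1; have := normr_ge0 (v j.+1).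
  have : 0 <= (1 / 2 : R) ^+ n by rewrite exprn_ge0// divr_ge0.
  nra.
move=> j; apply/ler_addgt0Pr => e' e0.
have /cvgrPdist_le : (fun n => C * (1 / 2 : R) ^+ n) @ \oo --> C * 0.
  by apply: cvgMl_tmp; apply: cvg_expr; rewrite ger0_norm; lra.
rewrite mulr0 => /(_ e' e0) [N _ /(_ N (leqnn _))].
rewrite sub0r normrN => h2; apply: le_trans (h N j) _.
by rewrite lerD2l; apply: le_trans (ler_norm _) h2.
Qed.

(** Partial sums starting at [kap] suffice, because truncating the series below
works in favour of the estimate in [flip_energy]; only the decay at [+ oo] is then
used. *)
Definition energy_le b (kap : int) (X V : R) := forall K : nat,
  \sum_(j < K) (b (kap + j%:Z) * expR (X * (kap + j%:Z)%:~R)) ^+ 2 <= V ^+ 2.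

(** Each root [t] is reflected in turn across the circle [|z| = exp X]. A
reflection divides the energy by [exp(2 (X - t))]; after the last one the
coefficient of index [kap] alone is bounded by the energy, which gives the
product of the factors [exp(X - t)] on the left. The reflections perturb the
coefficient of index [kap], but only by the coefficients below [kap]: these decay
like [exp(- M j)], so that each reflection costs a factor [1 + 2 exp(- t - M)] in
their bound [m]. *)
Lemma discrete_jensen (taus : seq R) kap (X M : R) b (l m V : R) :
  uniq taus -> (forall t, t \in taus -> t <= X) ->
  (forall t, t \in taus -> expR (- t - M) <= 1 / 2) ->
  (forall t, t \in taus -> rootexp b t) ->
  0 <= V -> energy_le b kap X V -> l <= `|b kap| ->
  (forall j : nat, `|b (kap - j.+1%:Z)| <= m * expR (- (M * j.+1%:R))) ->
  (l + m - m * \prod_(t <- taus) (1 + 2 * expR (- t - M))) * expR (X * kap%:~R)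
    * expR (\sum_(t <- taus) (X - t)) <= V.
Proof.
elim: taus b l m V => [|t ts IH] b l m V.
  move=> _ _ _ _ V0 /(_ 1%N); rewrite big_ord1 => h lb _.
  rewrite !big_nil mulr1 expR0 mulr1 addrK; apply: (@le_trans _ _ (`|b kap| * expR (X * kap%:~R))).
    by rewrite ler_wpM2r// expR_ge0.
  rewrite -(@ler_pXn2r _ 2)// ?nnegrE ?mulr_ge0 ?expR_ge0//.
  by move: h; rewrite addr0 !exprMn real_normK ?num_real.
move=> /= /andP[tts uts] tX tM rt V0 eb lb bb.
have tX0 : t <= X by apply: tX; rewrite mem_head.
have tM0 : expR (- t - M) <= 1 / 2 by apply: tM; rewrite mem_head.
have [s [rs bs]] : rootexp b t by apply: rt; rewrite mem_head.
set q := expR (- t - M) in tM0 *.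
have q0 : 0 <= q by exact: expR_ge0.
set a := expR (- t) in bs *.
(* The factor [1 - beta z] vanishes at the reflection [exp(2 X - t)] of the root. *)
pose beta := expR (t - 2 * X).
have beta0 : 0 <= beta by exact: expR_ge0.
have ba : beta <= a by rewrite ler_expR; lra.
pose H k := s k - beta * s (k - 1).
have HE k : H k = b k + (a - beta) * s (k - 1) by rewrite /H bs; ring.
have m0 : 0 <= m.
  by rewrite -(pmulr_lge0 m (expR_gt0 (- (M * 1%:R)))); apply: le_trans (bb 0%N).
have sb (j : nat) : `|s (kap - j.+1%:Z)| <= 2 * m * expR (- (M * j.+1%:R)).
  pose w (j : nat) := expR (M * j.+1%:R).
  have ww (i : nat) : expR (- (M * i.+1%:R)) = (w i)^-1 by rewrite expRN.
  have w0 (i : nat) : 0 < w i by exact: expR_gt0.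
  suff : forall i : nat, `|s (kap - i.+1%:Z) * w i| <= 2 * m.
    by move=> /(_ j); rewrite normrM (gtr0_norm (w0 j)) ww ler_pdivlMr.
  apply: (@unflip_bound (fun i => b (kap - i.+1%:Z) * w i) _ q m).
  - exact/andP.
  - have [C hC] := rs (- M); exists (C * expR (M * kap%:~R)) => i.
    have := hC (kap - i.+1%:Z); rewrite normrM (gtr0_norm (w0 i)) => h.
    have -> : w i = expR (- M * (kap - i.+1%:Z)%:~R) * expR (M * kap%:~R).
      rewrite -expRD /w; congr expR; rewrite intrB -pmulrn; ring.
    by rewrite mulrA ler_wpM2r// expR_ge0.
  - by move=> i; rewrite normrM (gtr0_norm (w0 i)) -ler_pdivlMr// -ww.
  - move=> i; rewrite bs.
    rewrite subzSr1; have -> : q * (s (kap - i.+2%:Z) * w i.+1) = a * s (kap - i.+2%:Z) * w i.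
      rewrite /q /a /w expRD.
      have -> : expR (M * i.+2%:R) = expR M * expR (M * i.+1%:R) :> R.
        by rewrite -expRD; congr expR; rewrite -[in LHS]natr1; ring.
      by rewrite expRN (expRN M); field; rewrite !gt_eqF ?expR_gt0.
    ring.
have Hs j : `|(a - beta) * s (kap - j.+1%:Z)| <= 2 * q * m * expR (- (M * j%:R)).
  rewrite normrM ger0_norm ?subr_ge0//.
  apply: (@le_trans _ _ (a * (2 * m * expR (- (M * j.+1%:R))))).
    by apply: ler_pM => //; rewrite ?subr_ge0// gerBl.
  rewrite le_eqVlt; apply/orP; left; apply/eqP.
  have -> : expR (- (M * j.+1%:R)) = expR (- M) * expR (- (M * j%:R)) :> R.
    by rewrite -expRD; congr expR; rewrite -natr1; ring.
  rewrite /q expRD -/a; ring.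
have Xt0 : 0 < expR (X - t) by exact: expR_gt0.
rewrite !big_cons -/q expRD.
suff : (l - 2 * q * m + m * (1 + 2 * q) - m * (1 + 2 * q) *
    \prod_(j <- ts) (1 + 2 * expR (- j - M))) * expR (X * kap%:~R) *
    expR (\sum_(j <- ts) (X - j)) <= V / expR (X - t).
  rewrite ler_pdivlMr//; apply: le_trans; rewrite le_eqVlt; apply/orP; left.
  by apply/eqP; ring.
apply: (IH H) => //.
- by move=> t' ht'; apply: tX; rewrite inE ht' orbT.
- by move=> t' ht'; apply: tM; rewrite inE ht' orbT.
- move=> t' ht'; apply: rootexp_flip rs bs _.
    by apply: contraNneq tts => ->.
  by apply: rt; rewrite inE ht' orbT.
- by rewrite divr_ge0// expR_ge0.
- move=> K.
  have hh := @flip_energy (fun i => s (kap + i%:Z - 1) * expR (X * (kap + i%:Z - 1)%:~R))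
    (expR (X - t)) (V ^+ 2) _ _ _ K.
  rewrite expr_div_n ler_pdivlMr ?exprn_gt0// mulr_suml.
  apply: le_trans (hh _ _ _).
  + apply: ler_sum => j _.
    rewrite -exprMn le_eqVlt; apply/orP; left; apply/eqP; congr (_ ^+ 2).
    rewrite addzSr1 intrB mulrBr mulr1 /H mulrBl mulrBl; congr (_ - _); first ring.
    rewrite /beta; have -> : t - 2 * X = t + (- X - X) by ring.
    rewrite !expRD !expRN; field; by rewrite !gt_eqF ?expR_gt0.
  + by rewrite -[leLHS]expR0 ler_expR; lra.
  + have e (n : nat) : kap + n%:Z - 1 = kap - 1 + n%:Z by rewrite addrAC.
    by under eq_fun do rewrite e; exact: rapid_cvg0.
  + move=> K'; have := eb K'; apply: le_trans; apply: ler_sum => j _.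
    rewrite le_eqVlt; apply/orP; left; apply/eqP; congr (_ ^+ 2).
    rewrite addzSr1 intrB mulrBr mulr1 bs mulrBl; congr (_ - _).
    rewrite /a !expRD !expRN; field; by rewrite !gt_eqF ?expR_gt0.
- rewrite HE; apply: le_trans (_ : `|b kap| - `|(a - beta) * s (kap - 1)| <= _).
    by have := Hs 0%N; rewrite mulr0 oppr0 expR0 mulr1; lra.
  by apply: le_trans (lerB_normD _ _) _.
- move=> j; rewrite HE subzSr1.
  by apply: le_trans (ler_normD _ _) _; have := bb j; have := Hs j.+1; lra.
Qed.
End jensen.

(** * Zeros of Gaussian series *)

Section series.
Context {R : realType}.

Lemma expR_geometric (a : R) (j : nat) : expR (- (a * j%:R)) = expR (- a) ^+ j.
Proof. by rewrite -expRM_natl; congr expR; ring. Qed.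

Lemma geometric_expR_le (a : R) n : 0 < a ->
  \sum_(j < n) expR (- (a * j%:R)) <= (1 - expR (- a))^-1.
Proof.
move=> a0; have := @geometric_le_lim R n 1 (expR (- a)) ler01 (expR_gt0 _).
rewrite mul1r ger0_norm ?expR_ge0// expR_lt1 oppr_lt0 => /(_ a0).
apply: le_trans; rewrite seriesEord /=.
by under eq_bigr do rewrite expR_geometric; under [leRHS]eq_bigr do rewrite mul1r.
Qed.

Lemma geometric_dominated_cvg (u : nat -> R) (C a : R) : 0 < a ->
  (forall j : nat, `|u j| <= C * expR (- (a * j%:R))) ->
  exists2 l : R, (fun n => \sum_(j < n) u j) @ \oo --> l &
    `|l| <= C / (1 - expR (- a)).
Proof.
move=> a0 h.
have C0 : 0 <= C by have := h 0%N; rewrite mulr0 oppr0 expR0 mulr1; apply: le_trans.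
have cu : cvgn (series u).
  apply: normed_cvg; apply: (@series_le_cvg _ _ (geometric C (expR (- a)))) => //.
  - by move=> n /=.
  - by move=> n; apply: geometric_ge0 => //; exact: expR_ge0.
  - by move=> n /=; rewrite -expR_geometric.
  - apply: is_cvg_geometric_series.
    by rewrite ger0_norm ?expR_ge0// expR_lt1 oppr_lt0.
move/cvg_ex : cu => [l]; rewrite seriesEord => ul.
exists l => //.
have b n : `|\sum_(j < n) u j| <= C / (1 - expR (- a)).
  apply: le_trans (ler_norm_sum _ _ _) _.
  apply: (@le_trans _ _ (\sum_(j < n) C * expR (- (a * j%:R)))).
    by apply: ler_sum => j _; exact: h.
  by rewrite -mulr_sumr ler_wpM2l// geometric_expR_le.
have cn : (fun n : nat => `|\sum_(j < n) u j|) @ \oo --> `|l| by apply: cvg_norm.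
rewrite -(cvg_lim (@Rhausdorff R) cn).
by apply: limr_le; [exact: (cvgP _ cn)|exact: nearW].
Qed.

(** The symmetric partial sum over [- n <= k < n]. With this indexing the
reflection [k |-> - 1 - k] permutes the terms. *)
Definition window_sum (d : int -> R) (n : nat) : R :=
  \sum_(j < n) (d j%:Z + d (- 1 - j%:Z)).

(** The partial sums from [- oo] up to [k] solve the difference equation and decay
at [- oo]; since the total sum is zero they are also minus the tails, which decay
at [+ oo]. This turns the vanishing of a series at a point into the factorization
[rootexp]. *)
Lemma rapid_primitive (d : int -> R) : rapid d -> window_sum d @ \oo --> 0 ->
  exists sg : int -> R, rapid sg /\ forall k, d k = sg k - sg (k - 1).
Proof.
move=> rd d0.
pose L (k : int) n := \sum_(j < n) d (k - j%:Z).
pose Q (k : int) n := \sum_(j < n) d (k + 1 + j%:Z).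
have hL a : 0 < a -> exists C, forall k, exists2 l : R, L k @ \oo --> l &
    `|l| <= C * expR (a * k%:~R).
  move=> a0; have [C hC] := rd (- a).
  exists (C / (1 - expR (- a))) => k.
  have [j|l hl1 hl2] := @geometric_dominated_cvg (fun j => d (k - j%:Z)) (C * expR (a * k%:~R)) a a0.
    have := hC (k - j%:Z); rewrite -mulrA -expRD.
    rewrite -ler_pdivlMr ?expR_gt0// -expRN => /le_trans; apply.
    by rewrite le_eqVlt; apply/orP; left; apply/eqP; congr (_ * expR _); rewrite intrB -pmulrn; ring.
  by exists l => //; rewrite mulrAC.
have hQ a : 0 < a -> exists C, forall k, exists2 l : R, Q k @ \oo --> l &
    `|l| <= C * expR (- (a * k%:~R)).
  move=> a0; have [C hC] := rd a.
  exists (C * expR (- a) / (1 - expR (- a))) => k.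
  have [j|l hl1 hl2] := @geometric_dominated_cvg (fun j => d (k + 1 + j%:Z))
      (C * expR (- a) * expR (- (a * k%:~R))) a a0.
    have := hC (k + 1 + j%:Z); rewrite -!mulrA -!expRD.
    rewrite -ler_pdivlMr ?expR_gt0// -expRN => /le_trans; apply.
    by rewrite le_eqVlt; apply/orP; left; apply/eqP; congr (_ * expR _); rewrite !intrD -pmulrn; ring.
  by exists l => //; rewrite mulrAC.
have /boolp.choice [sg sgL] : forall k, exists l : R, L k @ \oo --> l.
  by move=> k; have [C /(_ k) [l hl _]] := hL 1 ltr01; exists l.
have /boolp.choice [rho rhoQ] : forall k, exists l : R, Q k @ \oo --> l.
  by move=> k; have [C /(_ k) [l hl _]] := hQ 1 ltr01; exists l.
have usg k l : L k @ \oo --> l -> l = sg k.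
  by move=> h; apply: (@cvg_unique _ (@Rhausdorff R) _ _ _ _ h (sgL k)).
have urho k l : Q k @ \oo --> l -> l = rho k.
  by move=> h; apply: (@cvg_unique _ (@Rhausdorff R) _ _ _ _ h (rhoQ k)).
have dsg k : sg k = d k + sg (k - 1).
  symmetry; apply: usg; rewrite -cvg_shiftS /=.
  have -> : (fun n => L k n.+1) = (fun n => d k + L (k - 1) n).
    apply/funext => n; rewrite /L big_ord_recl subr0; congr (_ + _).
    by apply: eq_bigr => j _; congr d; rewrite lift0; lia.
  by apply: cvgD; [exact: cvg_cst|exact: sgL].
have drho k : rho (k - 1) = d k + rho k.
  symmetry; apply: urho; rewrite -cvg_shiftS /=.
  have -> : (fun n => Q (k - 1) n.+1) = (fun n => d k + Q k n).
    apply/funext => n; rewrite /Q big_ord_recl; congr (_ + _); first by rewrite subrK addr0.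
    by apply: eq_bigr => j _; congr d; rewrite lift0; lia.
  by apply: cvgD; [exact: cvg_cst|exact: rhoQ].
have s0 : sg (- 1) + rho (- 1) = 0.
  have h : (fun n => L (- 1) n + Q (- 1) n) @ \oo --> sg (- 1) + rho (- 1) by apply: cvgD.
  apply: (@cvg_unique _ (@Rhausdorff R) _ _ _ _ h).
  suff -> : (fun n => L (- 1) n + Q (- 1) n) = window_sum d by [].
  by apply/funext => n; rewrite /window_sum big_split addrC /Q /L /=; congr (_ + _).
have s1 k : sg k + rho k = sg (k - 1) + rho (k - 1) by rewrite drho (dsg k); ring.
have sn (n : nat) : sg n%:Z + rho n%:Z = 0.
  elim: n => [|n IH]; first by rewrite s1; exact: s0.
  by rewrite s1; have -> : n.+1%:Z - 1 = n%:Z by lia.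
have sN (n : nat) : sg (- n%:Z) + rho (- n%:Z) = 0.
  elim: n => [|n IH]; first exact: (sn 0%N).
  by rewrite -[RHS]IH [RHS]s1; have -> : - n.+1%:Z = - n%:Z - 1 by lia.
have sz k : sg k = - rho k.
  apply/eqP; rewrite -addr_eq0; apply/eqP.
  by case: (intP k) => [|n|n]; [exact: (sn 0%N)|exact: (sn n.+1)|exact: (sN n.+1)].
exists sg; split; last by move=> k; rewrite dsg addrK.
move=> t; pose a := `|t| + 1.
have a0 : 0 < a by rewrite ltr_wpDl.
have [C hC] := hL a a0; have [D hD] := hQ a a0.
exists (C + D) => k.
have hk1 : `|sg k| * expR (- a * k%:~R) <= C.
  have [l /usg -> h] := hC k.
  by rewrite mulNr expRN ler_pdivrMr ?expR_gt0.
have hk2 : `|sg k| * expR (a * k%:~R) <= D.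
  have [l /urho -> h] := hD k.
  by rewrite sz normrN -[expR (a * _)]invrK -expRN ler_pdivrMr ?expR_gt0.
apply: le_trans (lerD hk1 hk2); rewrite -mulrDr ler_wpM2l//.
have [k0|k0] := leP 0 (k%:~R : R).
- apply: (@le_trans _ _ (expR (a * k%:~R))); last by rewrite lerDr expR_ge0.
  rewrite ler_expR ler_wpM2r// /a; have := ler_norm t; lra.
- apply: (@le_trans _ _ (expR (- a * k%:~R))); last by rewrite lerDl expR_ge0.
  rewrite ler_expR ler_wnM2r ?ltW// /a; have := ler_norm (- t); rewrite normrN; lra.
Qed.

(** For [x >= 0] compare with a geometric series. For [x < 0] start the sum at the
sign change of [x + j]; the terms before it, in reverse order, are again of the
first kind. *)
Lemma gauss_lattice_sum_bound (a : R) : 0 < a ->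
  exists T : R, forall (x : R) (n : nat), \sum_(j < n) expR (- (a * (x + j%:R) ^+ 2)) <= T.
Proof.
move=> a0; pose G : R := (1 - expR (- a))^-1.
have hp (x : R) n : 0 <= x -> \sum_(j < n) expR (- (a * (x + j%:R) ^+ 2)) <= G.
  move=> x0; apply: le_trans (geometric_expR_le n a0); apply: ler_sum => j _.
  rewrite ler_expR lerN2 ler_pM2l//.
  have : (j%:R : R) <= j%:R ^+ 2 by rewrite -natrX ler_nat; case: (val j) => // i; rewrite -mulnn leq_pmulr.
  have : 0 <= (j%:R : R) by []. nra.
exists (G + G) => x n.
have [x0|x0] := leP 0 x.
  apply: le_trans (hp _ _ x0) _; rewrite lerDl.
  by have := hp _ 0%N x0; rewrite big_ord0.
pose N := (Num.truncn (- x)).+1.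
have /andP[N1 N2] : (N.-1%:R <= - x < N%:R) by apply: Num.Theory.truncn_itv; lra.
pose F (j : nat) := expR (- (a * (x + j%:R) ^+ 2)).
apply: (@le_trans _ _ (\sum_(j < N + n) F j)).
  rewrite addnC big_split_ord /= lerDl sumr_ge0// => *; exact: expR_ge0.
rewrite big_split_ord /=; apply: lerD.
  rewrite (reindex_inj rev_ord_inj) /=.
  apply: le_trans (hp 0 N (lexx _)); apply: ler_sum => j _.
  rewrite /F ler_expR lerN2 ler_pM2l// add0r natrB; last by [].
  have : (N%:R : R) = N.-1%:R + 1 by rewrite natr1.
  rewrite -natr1; have : 0 <= (j%:R : R) by []. nra.
apply: le_trans (hp (x + N%:R) n _); last lra.
by apply: ler_sum => j _; rewrite /F natrD addrA.
Qed.
End series.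

Lemma ler_prod_expr (R : realType) (T : eqType) (s : seq T) (F : T -> R) (q : R) :
  (forall t, t \in s -> 0 <= F t <= q) -> \prod_(t <- s) F t <= q ^+ size s.
Proof.
elim: s => [|t s IH] h; first by rewrite big_nil.
rewrite big_cons exprS; have /andP[F0 Fq] := h t (mem_head _ _).
have hs u : u \in s -> 0 <= F u <= q by move=> us; apply: h; rewrite inE us orbT.
by apply: ler_pM => //; [rewrite big_seq prodr_ge0// => u /hs /andP[]|exact: IH].
Qed.

Section crude_arithmetic.
Context {R : realType}.
Implicit Types (a eta M p E F z S x n : R).

(** Only logarithmic growth of [M] in [n] is required by the last two bounds; a
square root of slope [eta] is ample and makes [M^2] affine in [n]. *)
Lemma cutoff_exists a eta : 0 < a -> 0 < eta ->
  exists2 K : R, 0 <= K & forall n, 0 <= n -> exists M : R,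
    [/\ 0 <= M, M ^+ 2 = K + eta * n, 10 * expR (2 * a) * n <= expR (2 * a * M)
       & 2 * expR (2 * a) <= expR (2 * a * M)].
Proof.
move=> a0 eta0; set e2 := expR (2 * a); have e20 : 0 < e2 by exact: expR_gt0.
pose a4 := (a / 2) ^+ 4; have a40 : 0 < a4 by rewrite exprn_gt0// divr_gt0.
pose q1 := 10 * e2 / (a4 * eta); have q10 : 0 < q1.
  by apply: divr_gt0; apply: mulr_gt0.
have q1E : a4 * eta * q1 = 10 * e2 by rewrite /q1; field; rewrite !gt_eqF.
pose q2 := 2 * e2 / a4; have q20 : 0 < q2 by apply: divr_gt0 => //; apply: mulr_gt0.
have q2E : a4 * q2 = 2 * e2 by rewrite /q2; field; rewrite gt_eqF.
pose K := 1 + q1 + q2; have K1 : 1 <= K by rewrite /K; lra.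
exists K => [|n n0]; first exact: le_trans K1.
have en0 : 0 <= eta * n by rewrite mulr_ge0// ltW.
pose M := Num.sqrt (K + eta * n); have M0 : 0 <= M by exact: sqrtr_ge0.
have M2 : M ^+ 2 = K + eta * n by rewrite sqr_sqrtr// addr_ge0// (le_trans ler01).
have M4 : a4 * (K + eta * n) ^+ 2 <= expR (2 * a * M).
  rewrite -M2 -exprM /a4 -exprMn.
  have -> : 2 * a * M = 4%:R * (a / 2 * M) by field.
  have am0 : 0 <= a / 2 * M by rewrite mulr_ge0// divr_ge0// ltW.
  rewrite expRM_natl ler_pXn2r ?nnegrE ?expR_ge0//.
  by have := expR_ge1Dx (a / 2 * M); lra.
exists M; split => //; apply: le_trans M4.
- rewrite -q1E; have -> : a4 * eta * q1 * n = a4 * (q1 * (eta * n)) by ring.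
  rewrite ler_pM2l//; move: (eta * n) en0 => e en0; clear -en0 q10 q20.
  by rewrite /K; nra.
- rewrite -q2E ler_pM2l//; move: (eta * n) en0 => e en0; clear -en0 q10 q20.
  by rewrite /K; nra.
Qed.

(** If [- z] exceeded this bound, then [(- z) (- z - 2 M)] would exceed
[2 M p + E]. *)
Lemma quadratic_index_bound M p E z z0 : 0 <= M -> 0 <= p -> 0 <= E -> z0 <= p ->
  z ^+ 2 + 2 * M * (z - z0) <= E -> - z <= 2 * M + (p + E + 1).
Proof.
move=> M0 p0 E0 zp h; rewrite leNgt; apply/negP => hz.
have h3 : 2 * M * z0 <= 2 * M * p by rewrite ler_wpM2l// mulr_ge0.
have h4 : (2 * M + (p + E + 1)) * (p + E + 1) <= (- z) * (- z - 2 * M).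
  by apply: ler_pM; lra.
have h5 : 0 <= M * (E + 1) by rewrite mulr_ge0//; lra.
have h6 : 0 <= (p + E) * (p + E + 1) by rewrite mulr_ge0//; lra.
have h7 : (2 * M + (p + E + 1)) * (p + E + 1) =
  2 * M * p + 2 * (M * (E + 1)) + (p + E) * (p + E + 1) + (p + E + 1) by ring.
have h8 : (- z) * (- z - 2 * M) = z ^+ 2 + 2 * M * (z - z0) + 2 * M * z0 by ring.
move: h h3 h4; rewrite h7 h8; clear -h5 h6 p0; lra.
Qed.

Lemma crude_bound_arith x M p E F z z0 S : 0 <= x -> 0 <= M -> 0 <= p -> 0 <= E -> 0 <= F ->
  z0 <= p -> - z <= 2 * M + F ->
  S <= x ^+ 2 / 2 - x * z - M * (z - z0) + E / 2 ->
  S <= x ^+ 2 / 2 + ((4 + F + p) * M ^+ 2 + (2 + 2 * F + p + E)) * (1 + x).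
Proof.
move=> x0 M0 p0 E0 F0 zp hz /le_trans; apply.
set st := _ + (2 + _ + _ + _).
have M1 : M <= 1 + M ^+ 2 by have := sqr_ge0 (M - 1); nra.
have stE : (2 * M + F) + M * (2 * M + F + p) + E <= st.
  have : M * (F + p) <= (1 + M ^+ 2) * (F + p) by rewrite ler_wpM2r// addr_ge0.
  rewrite /st; clear -M1 F0 p0; lra.
have h1 : x * (- z) <= x * (2 * M + F) by rewrite ler_wpM2l.
have h2 : M * (- z + z0) <= M * (2 * M + F + p) by rewrite ler_wpM2l// lerD.
have h0 : 0 <= M * (2 * M + F + p) by rewrite mulr_ge0// !addr_ge0// mulr_ge0.
have h3 : x * ((2 * M + F) + M * (2 * M + F + p) + E) <= x * st by rewrite ler_wpM2l.
have h4 : 0 <= x * (M * (2 * M + F + p) + E) by rewrite mulr_ge0// addr_ge0.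
have h5 : 0 <= 2 * M + F by rewrite addr_ge0// mulr_ge0.
clearbody st; clear -h1 h2 h3 h4 h5 stE E0; nra.
Qed.

End crude_arithmetic.

Section gauss_zeros.
Context {R : realType} (a B : R) (c : int -> R).
Context (a0 : 0 < a) (B0 : 0 < B) (cB : forall k, `|c k| <= B).

Let b (k : int) : R := c k * expR (- (a * k%:~R ^+ 2)).

Definition gauss_term (lam : R) (k : int) : R := c k * expR (- (a * (lam - k%:~R) ^+ 2)).

Lemma rapid_gauss : rapid b.
Proof.
move=> t; exists (B * expR (t ^+ 2 / (4 * a))) => k.
rewrite /b normrM (ger0_norm (expR_ge0 _)) -mulrA -expRD ler_pM ?expR_ge0//.
rewrite ler_expR -subr_ge0.
have -> : t ^+ 2 / (4 * a) - (- (a * k%:~R ^+ 2) + t * k%:~R) =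
  (t - 2 * a * k%:~R) ^+ 2 / (4 * a) by field; rewrite gt_eqF.
by rewrite divr_ge0 ?sqr_ge0// mulr_ge0// ltW.
Qed.

(** With [b_k = c_k exp(- a k^2)], the term [c_k exp(- a (lam - k)^2)] is
[exp(- a lam^2) b_k exp(2 a lam k)]. *)
Lemma gauss_root (lam : R) : window_sum (gauss_term lam) @ \oo --> 0 -> rootexp b (2 * a * lam).
Proof.
move=> h; pose d (k : int) := b k * expR (2 * a * lam * k%:~R).
have rd : rapid d.
  move=> t; have [C hC] := rapid_gauss (2 * a * lam + t); exists C => k.
  apply: le_trans (hC k).
  by rewrite /d normrM (ger0_norm (expR_ge0 _)) [in leRHS]mulrDl expRD mulrA.
have d0 : window_sum d @ \oo --> 0.
  have -> : window_sum d = (fun n => expR (a * lam ^+ 2) * window_sum (gauss_term lam) n).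
    apply/funext => n; rewrite /window_sum mulr_sumr; apply: eq_bigr => j _.
    rewrite /d /b /gauss_term mulrDr; congr (_ + _);
      rewrite [RHS]mulrCA -mulrA -!expRD; congr (_ * expR _); ring.
  by rewrite -[X in _ --> X](mulr0 (expR (a * lam ^+ 2))); apply: cvgMl_tmp.
have [sg [rsg dsg]] := rapid_primitive rd d0.
exists (fun k => sg k * expR (- (2 * a * lam * k%:~R))); split.
  move=> t; have [C hC] := rsg (t - 2 * a * lam); exists C => k.
  apply: le_trans (hC k); rewrite normrM (ger0_norm (expR_ge0 _)) -[leLHS]mulrA -expRD.
  by rewrite le_eqVlt; apply/orP; left; apply/eqP; congr (_ * expR _); ring.
move=> k; have -> : b k = d k * expR (- (2 * a * lam * k%:~R)).
  by rewrite /d -mulrA -expRD subrr expR0 mulr1.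
rewrite dsg mulrBl; congr (_ - _); rewrite [RHS]mulrCA -expRD; congr (_ * expR _).
by rewrite intrB; ring.
Qed.

(** Completing the square: [b_k exp(2 a x k) = c_k exp(a x^2) exp(- a (k - x)^2)]. *)
Lemma gauss_energy : exists2 D : R, 0 < D &
  forall (x : R) kap, energy_le b kap (2 * a * x) (D * expR (a * x ^+ 2)).
Proof.
have [T hT] := gauss_lattice_sum_bound (mulr_gt0 (ltr0Sn R 1) a0).
have T0 : 0 <= T by have := hT 0 0%N; rewrite big_ord0.
exists (B * (1 + T)); first by rewrite mulr_gt0// ltr_wpDr.
move=> x kap K.
apply: (@le_trans _ _ (B ^+ 2 * expR (2 * (a * x ^+ 2)) * T)); last first.
  rewrite expRM_natl; set e := expR _ ^+ 2.
  have e0 : 0 <= e by exact: sqr_ge0.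
  rewrite !exprMn -/e; have : 0 <= B ^+ 2 * e by rewrite mulr_ge0 ?sqr_ge0.
  nra.
apply: le_trans (_ : B ^+ 2 * expR (2 * (a * x ^+ 2)) *
   \sum_(j < K) expR (- (2 * a * (kap%:~R - x + j%:R) ^+ 2)) <= _); last first.
  by rewrite ler_wpM2l// mulr_ge0 ?sqr_ge0 ?expR_ge0.
rewrite mulr_sumr; apply: ler_sum => j _.
set k := (kap + j%:Z : int).
have -> : kap%:~R - x + j%:R = k%:~R - x by rewrite /k intrD -pmulrn; ring.
have -> : b k * expR (2 * a * x * k%:~R) =
    c k * expR (- (a * k%:~R ^+ 2) + 2 * a * x * k%:~R) by rewrite expRD mulrA.
rewrite -[leRHS]mulrA -expRD exprMn ler_pM ?sqr_ge0//.
  by rewrite -real_normK ?num_real// ler_pXn2r// nnegrE ltW.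
by rewrite -expRM_natl ler_expR le_eqVlt; apply/orP; left; apply/eqP; ring.
Qed.

(** The factor 2 avoids having to show that the supremum is attained. *)
Lemma almost_max (u : int -> R) (k0 : int) (C : R) : (forall k, u k <= C) ->
  0 < u k0 -> exists kap, forall k, u k <= 2 * u kap.
Proof.
move=> uC u0; pose S := sup (range u).
have hS : has_sup (range u).
  by split; [exists (u k0), k0 | exists C => _ [k _ <-]].
have S0 : 0 < S by apply: lt_le_trans u0 _; apply: sup_upper_bound => //; exists k0.
have [|_ [kap _ <-] h] := @sup_adherent _ (range u) (S / 2) _ hS; first by rewrite divr_gt0.
exists kap => k; have : u k <= S by apply: sup_upper_bound => //; exists k.
rewrite -/S in h; lra.
Qed.

(** The choice of [M] makes the perturbation factors of [discrete_jensen]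
harmless: [size A] of them multiply to at most [5 / 4], so that with [l = `|b kap|]
and [m = 2 l] the coefficient [l + m - m (5 / 4) = l / 2] is left. *)
Lemma gauss_jensen (D M x : R) (kap : int) (A : seq R) :
  (forall k, energy_le b k (2 * a * x) (D * expR (a * x ^+ 2))) -> 0 < D -> uniq A ->
  (forall l, l \in A -> -1 <= l <= x /\ window_sum (gauss_term l) @ \oo --> 0) ->
  10 * expR (2 * a) * (size A)%:R <= expR (2 * a * M) ->
  2 * expR (2 * a) <= expR (2 * a * M) ->
  (forall k, `|b k| <= 2 * `|b kap| * expR (2 * a * M * (k%:~R - kap%:~R))) ->
  expR (2 * a * x * kap%:~R) * (expR (\sum_(l <- A) (2 * a * (x - l))) * (`|b kap| / 2)) <=
    D * expR (a * x ^+ 2).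
Proof.
move=> hD D0 uA hA M5 M6 hk'.
set n : R := (size A)%:R in M5; have n0 : 0 <= n by [].
pose ell := `|b kap|; set e2 := expR (2 * a) in M5 M6; have e20 : 0 < e2 by exact: expR_gt0.
pose y := e2 / expR (2 * a * M); have y0 : 0 < y by rewrite divr_gt0// expR_gt0.
have y12 : y <= 1 / 2 by rewrite ler_pdivrMr ?expR_gt0//; lra.
have yn : 2 * y * n <= 1 / 5.
  by rewrite /y mulrA mulrAC ler_pdivrMr ?expR_gt0//; lra.
have hy l : l \in A -> expR (- (2 * a * l) - 2 * a * M) <= y.
  move=> /hA [/andP[l1 _] _].
  by rewrite /y expRB ler_pM2r ?invr_gt0 ?expR_gt0// ler_expR; have := a0; nra.
have hP : \prod_(l <- A) (1 + 2 * expR (- (2 * a * l) - 2 * a * M)) <= 5 / 4.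
  apply: (@le_trans _ _ (expR (2 * y * n))).
    rewrite /n expRM_natr; apply: ler_prod_expr => l lA.
    have := expR_ge0 (- (2 * a * l) - 2 * a * M); have := hy _ lA.
    have := expR_ge1Dx (2 * y); lra.
  have : 1 - 1 / 5 <= expR (- (2 * y * n)).
    by apply: le_trans (expR_ge1Dx _); lra.
  rewrite expRN => h; rewrite -[leRHS]invrK -[leLHS]invrK lef_pV2 ?posrE ?invr_gt0 ?expR_gt0//.
  by apply: le_trans h; lra.
have := @discrete_jensen _ [seq 2 * a * l | l <- A] kap (2 * a * x) (2 * a * M) b
  ell (2 * ell) (D * expR (a * x ^+ 2)).
rewrite !big_map => /(_ _ _ _ _ _ (hD kap) (lexx _)) h.
apply: le_trans (h _ _ _ _ _ _).
- have -> : \sum_(l <- A) (2 * a * x - 2 * a * l) = \sum_(l <- A) 2 * a * (x - l).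
    by apply: eq_bigr => l _; rewrite mulrBr.
  set e1 := expR (_ * kap%:~R); set e3 := expR (\sum_(_ <- _) _).
  have e10 : 0 <= e1 by exact: expR_ge0.
  have e30 : 0 <= e3 by exact: expR_ge0.
  have -> : e1 * (e3 * (ell / 2)) = ell / 2 * (e1 * e3) by ring.
  rewrite -[leRHS]mulrA ler_wpM2r ?mulr_ge0//.
  have : 0 <= ell by exact: normr_ge0.
  move: hP; set P := \prod_(_ <- _) _; nra.
- rewrite map_inj_uniq// => u v; apply: mulfI; rewrite gt_eqF// mulr_gt0//.
- by move=> _ /mapP[l /hA[/andP[_ lx] _] ->]; rewrite ler_pM2l// mulr_gt0.
- by move=> _ /mapP[l lA ->]; apply: le_trans (hy _ lA) _.
- by move=> _ /mapP[l /hA[_ hl] ->]; exact: gauss_root.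
- by rewrite mulr_ge0 ?expR_ge0// ltW.
- move=> j; have := hk' (kap - j.+1%:Z); congr (_ <= _ * expR _).
  by rewrite intrB -pmulrn; ring.
Qed.

(** Jensen's inequality needs a term of the series at which the truncation
from below is negligible. The index [kap] is an almost maximizer of
[|b_k| exp(- 2 a M k)], with [M] of size [sqrt(size A)] so that the bound on the
perturbation is uniform. Comparing with the fixed nonzero coefficient at [k0]
shows that [kap] is not far to the left of [- 2 M] and that [b_kap] is not too
small, which leads to a loss of order [M^2 (1 + x)]. This crude estimate involves
the number of zeros itself, with an arbitrarily small factor. *)
Lemma gauss_zeros_crude (k0 : int) : c k0 != 0 -> forall eta : R, 0 < eta ->
  exists C : R, forall (x : R) (A : seq R), 0 <= x -> uniq A ->
    (forall l, l \in A -> -1 <= l <= x /\ window_sum (gauss_term l) @ \oo --> 0) ->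
    \sum_(l <- A) (x - l) <= x ^+ 2 / 2 + (C + eta * (size A)%:R) * (1 + x).
Proof.
move=> ck0 eta eta0.
have [D D0 hD] := gauss_energy.
pose be : R := `|b k0|.
have be0 : 0 < be by rewrite normr_gt0 mulf_neq0// gt_eqF// expR_gt0.
(* [Q / a] bounds the constants lost in the two comparisons of exponentials
   below, where [exp y >= y] is used. *)
pose Q : R := 4 * (D + B) / be.
have Q0 : 0 < Q by rewrite divr_gt0// mulr_gt0// addr_gt0.
pose E := Q / a; have E0 : 0 < E by rewrite divr_gt0.
pose p : R := `|k0%:~R|; have p0 : 0 <= p by exact: normr_ge0.
pose F := p + E + 1; have F0 : 0 < F by rewrite /F; lra.
have c0 : 0 < 4 + F + p by rewrite ltr_wpDr// addr_gt0.
pose eta' := eta / (4 + F + p).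
have eta'0 : 0 < eta' by exact: divr_gt0.
have [K K0 cut] := cutoff_exists a0 eta'0.
exists ((4 + F + p) * K + 2 + 2 * F + p + E) => x A x0 uA hA.
set n : R := (size A)%:R; have n0 : 0 <= n by [].
have [M [M0 M2 M5 M6]] := cut n n0.
have [kap hk] : exists kap, forall k, `|b k| * expR (- (2 * a * M) * k%:~R) <=
    2 * (`|b kap| * expR (- (2 * a * M) * kap%:~R)).
  have [C hC] := rapid_gauss (- (2 * a * M)).
  by apply: (almost_max hC (k0 := k0)); rewrite mulr_gt0 ?expR_gt0.
pose ell := `|b kap|.
have hk' k : `|b k| <= 2 * ell * expR (2 * a * M * (k%:~R - kap%:~R)).
  have := hk k; rewrite -ler_pdivlMr ?expR_gt0// => /le_trans; apply.
  by rewrite -expRN -!mulrA -expRD le_eqVlt; apply/orP; left; apply/eqP; rewrite /ell; congr (_ * (_ * expR _)); ring.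
have ellB : ell <= B * expR (- (a * kap%:~R ^+ 2)).
  by rewrite /ell /b normrM (ger0_norm (expR_ge0 _)) ler_wpM2r ?expR_ge0.
have exp_le (y u v : R) : 0 < v -> expR y * v <= u -> y <= u / v.
  by move=> v0; rewrite -ler_pdivlMr// => /(le_trans _); apply; have := expR_ge1Dx y; lra.
have kb : a * kap%:~R ^+ 2 + 2 * a * M * (kap%:~R - k0%:~R) <= Q.
  apply: le_trans (exp_le _ (2 * B) be be0 _) _.
    rewrite expRD; have := hk' k0; rewrite -/be.
    set y := 2 * a * M * _ => h1.
    have -> : 2 * a * M * (kap%:~R - k0%:~R) = - y by rewrite /y; ring.
    rewrite expRN; have y0 : 0 < expR y by exact: expR_gt0.
    move: ellB; rewrite expRN ler_pdivlMr ?expR_gt0// => h2.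
    have h3 : be / expR y <= 2 * ell by rewrite ler_pdivrMr.
    have := expR_gt0 (a * kap%:~R ^+ 2); set z := expR _ in h2 *.
    nra.
  rewrite /Q ler_pM2r ?invr_gt0//.
  by have := B0; have := D0; lra.
have hJ := gauss_jensen (hD x) D0 uA hA M5 M6 hk'.
have kk : - kap%:~R <= 2 * M + F.
  have h : kap%:~R ^+ 2 + 2 * M * (kap%:~R - k0%:~R) <= E.
    rewrite /E ler_pdivlMr//; apply: le_trans kb.
    by rewrite le_eqVlt; apply/orP; left; apply/eqP; ring.
  by apply: quadratic_index_bound (M0) (p0) (ltW E0) (ler_norm _) h.
pose S := \sum_(l <- A) (x - l).
have hS : S <= x ^+ 2 / 2 - x * kap%:~R - M * (kap%:~R - k0%:~R) + E / 2.
  have ellb : be <= 2 * ell * expR (2 * a * M * (k0%:~R - kap%:~R)) by exact: hk'.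
  have : 2 * a * x * kap%:~R + 2 * a * S + 2 * a * M * (kap%:~R - k0%:~R)
     - a * x ^+ 2 <= Q.
    apply: le_trans (exp_le _ (4 * D) be be0 _) _; last first.
      by rewrite /Q ler_pM2r ?invr_gt0//; have := B0; lra.
    move: hJ; rewrite -mulr_sumr -/S.
    rewrite expRD expRN !expRD.
    have -> : 2 * a * M * (kap%:~R - k0%:~R) = - (2 * a * M * (k0%:~R - kap%:~R)) by ring.
    rewrite expRN.
    set e1 := expR (2 * a * x * _); set e3 := expR (2 * a * S).
    set e4 := expR (a * x ^+ 2); set e5 := expR (2 * a * M * _) in ellb *.
    have [p1 p3 p4 p5] : [/\ 0 < e1, 0 < e3, 0 < e4 & 0 < e5] by split; exact: expR_gt0.
    move=> hJ; rewrite mulrAC ler_pdivrMr//.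
    apply: (@le_trans _ _ (e1 * e3 / e5 * (2 * ell * e5))).
      by rewrite ler_wpM2l// !mulr_ge0// ?invr_ge0 ltW.
    have -> : e1 * e3 / e5 * (2 * ell * e5) = 4 * (e1 * (e3 * (ell / 2))).
      by field; rewrite gt_eqF.
    by rewrite -mulrA ler_pM2l.
  rewrite /E => h; have h2 : (2 * a) * S <= (2 * a) * (x ^+ 2 / 2 - x * kap%:~R - M * (kap%:~R - k0%:~R) + Q / a / 2).
    have -> : (2 * a) * (x ^+ 2 / 2 - x * kap%:~R - M * (kap%:~R - k0%:~R) + Q / a / 2) =
      a * x ^+ 2 - 2 * a * x * kap%:~R - 2 * a * M * (kap%:~R - k0%:~R) + Q.
      by field; rewrite gt_eqF.
    by lra.
  by rewrite ler_pM2l ?mulr_gt0 in h2.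
have -> : (4 + F + p) * K + 2 + 2 * F + p + E + eta * n =
    (4 + F + p) * M ^+ 2 + (2 + 2 * F + p + E).
  by rewrite M2 /eta'; field; rewrite gt_eqF.
exact: (crude_bound_arith x0 M0 p0 (ltW E0) (ltW F0) (ler_norm _) kk hS).
Qed.
End gauss_zeros.

(** * Integration on the line *)

Section Rintegral_tools.
Context d (T : measurableType d) (R : realType) (mu : {measure set T -> \bar R}).

Lemma Rintegral_dominated_cvg (D : set T) (f_ : nat -> T -> R) (f G : T -> R) :
  measurable D -> (forall n, measurable_fun D (f_ n)) ->
  (forall x, D x -> f_ ^~ x @ \oo --> f x) ->
  mu.-integrable D (EFin \o G) -> (forall n x, D x -> `|f_ n x| <= G x) ->
  \int[mu]_(x in D) f_ n x @[n --> \oo] --> \int[mu]_(x in D) f x.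
Proof.
move=> mD mf ff iG fG.
have mf' n : measurable_fun D (fun x => (f_ n x)%:E) by exact/measurable_EFinP.
have ff' x : D x -> (fun n => (f_ n x)%:E) @ \oo --> (f x)%:E.
  by move=> Dx; apply: cvg_EFin; [exact: nearW|exact: ff].
have fG' n x : D x -> (`|(f_ n x)%:E| <= (EFin \o G) x)%E.
  by move=> Dx; rewrite /= lee_fin fG.
have mf0 : measurable_fun D (EFin \o f) by apply: (emeasurable_fun_cvg _ _ mf' ff').
have [fi _ h] := @dominated_convergence _ _ _ mu D mD (fun n x => (f_ n x)%:E)
  (EFin \o f) (EFin \o G) mf' mf0 (aeW _ ff') iG
  (aeW _ (fun x n Dx => fG' n x Dx)).
have fE : (\int[mu]_(x in D) (f x)%:E = (\int[mu]_(x in D) f x)%:E)%E.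
  by rewrite /Rintegral fineK//; exact: integrable_fin_num.
by move: h; rewrite /= fE => /fine_cvgP[_].
Qed.

Lemma integrable_bounded_mul (D : set T) (f h : T -> R) (B : R) : measurable D ->
  mu.-integrable D (EFin \o f) -> measurable_fun D h ->
  (forall x, D x -> `|h x| <= B) -> mu.-integrable D (EFin \o (fun x => f x * h x)).
Proof.
move=> mD fi mh hB; have B0 : 0 <= `|B| by [].
apply: (@le_integrable _ _ _ mu D mD _ (fun x => (`|B|)%:E * (f x)%:E)%E).
- apply/measurable_EFinP/measurable_funM => //.
  by apply/measurable_EFinP; exact: measurable_int fi.
- move=> x Dx; rewrite /= lee_fin !normrM mulrC normr_id ler_wpM2r//.
  by apply: le_trans (hB x Dx) (ler_norm _).
- exact: (integrableZl mD).
Qed.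

Lemma Rintegral_bound (D : set T) (f h : T -> R) (B : R) : measurable D ->
  mu.-integrable D (EFin \o f) -> (forall x, D x -> 0 <= f x) -> measurable_fun D h ->
  (forall x, D x -> `|h x| <= B) ->
  `|\int[mu]_(x in D) (f x * h x)| <= B * \int[mu]_(x in D) f x.
Proof.
move=> mD fi f0 mh hB.
have fhi := integrable_bounded_mul mD fi mh hB.
apply: le_trans (le_normr_Rintegral mD fhi) _.
rewrite -RintegralZl//; apply: le_Rintegral => //.
- exact: integrable_norm.
- exact: (integrableZl mD B fi).
- by move=> x Dx; rewrite normrM (ger0_norm (f0 _ Dx)) mulrC ler_wpM2r ?f0 ?hB.
Qed.

End Rintegral_tools.

Section lebesgue.
Context {R : realType}.
Notation mu := (@lebesgue_measure R).

Lemma continuous_funrpos (q : R -> R) : continuous q -> continuous (q^\+)%R.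
Proof.
move=> cq x; apply: (@continuous_max _ _ q (cst 0)); [exact: cq|exact: cst_continuous].
Qed.

Lemma ge0_integral_ray_shift (q : R -> R) (d : R) : continuous q ->
  (forall x, 0 <= q x) ->
  (\int[mu]_(x in `[d, +oo[) (q x)%:E = \int[mu]_(x in `[0%R, +oo[) (q (x + d))%:E)%E.
Proof.
move=> cq q0.
have := @increasing_ge0_integration_by_substitutiony R (fun x => x + d) q 0.
rewrite add0r => h.
have D1 : (fun x : R => x + d)^`()%classic = cst 1.
  apply/funext => x; rewrite derive1E deriveD// derive_id derive_cst addr0//.
rewrite h.
- by apply: eq_integral => x _; rewrite D1 /= mulr1.
- by move=> x y _ _; rewrite ltrD2r.
- by rewrite D1 => x _; exact: cst_continuous.
- by rewrite D1; exact: is_cvg_cst.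
- by rewrite D1; exact: is_cvg_cst.
- split; first by move=> x _; exact: derivableD.
  by apply: cvg_at_right_filter; apply: cvgD => //; exact: cvg_cst.
- exact: cvg_addrr.
- by apply: continuous_subspaceT.
- by move=> x _; exact: q0.
Qed.

Lemma integral_ray_shift (q : R -> R) (d : R) : continuous q ->
  \int[mu]_(x in `[d, +oo[) (q x) = \int[mu]_(x in `[0, +oo[) (q (x + d)).
Proof.
move=> cq; rewrite /Rintegral; congr fine.
have cN : continuous (\- q) by move=> x; apply: cvgN; exact: cq.
rewrite integralE [RHS]integralE; congr (_ - _)%E.
  rewrite (funerpos q) (funerpos (fun x => q (x + d))).
  exact: (ge0_integral_ray_shift d (continuous_funrpos cq) (@funrpos_ge0 _ _ q)).
rewrite (funerneg q) (funerneg (fun x => q (x + d))) -!funrposN.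
exact: (ge0_integral_ray_shift d (continuous_funrpos cN) (@funrpos_ge0 _ _ (\- q)%R)).
Qed.

Lemma is_derive_affine (s d x : R) : is_derive x 1 (fun x : R => s * x + d) s.
Proof. by apply: is_derive_eq; rewrite /GRing.scale /= mulr1 addr0. Qed.

Lemma is_derive_continuous (f f' : R -> R) :
  (forall x : R, is_derive x 1 f (f' x)) -> continuous f.
Proof.
move=> h x; apply: differentiable_continuous; apply/derivable1_diffP.
by have [] := h x.
Qed.

Lemma continuous_affine (q : R -> R) (s d : R) : continuous q ->
  continuous (fun x => q (s * x + d)).
Proof.
move=> cq x; apply: (continuous_comp (f := fun x : R => s * x + d)); last exact: cq.
exact: (is_derive_continuous (is_derive_affine s d)).
Qed.

Lemma ge0_integral_affine (q : R -> R) (s d : R) : 0 < s -> continuous q ->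
  (forall x, 0 <= q x) ->
  (\int[mu]_x (q x)%:E = \int[mu]_x (q (s * x + d) * s)%:E)%E.
Proof.
move=> s0 cq q0.
have D1 : (fun x : R => s * x + d)^`()%classic = cst s.
  by apply/funext => x; rewrite derive1E; have [_ ->] := is_derive_affine s d x.
rewrite (@increasing_ge0_integration_by_substitutionT R (fun x => s * x + d) q).
- by apply: eq_integral => x _; rewrite D1.
- by move=> x y; rewrite ltrD2r ltr_pM2l.
- by rewrite D1 => x; exact: cst_continuous.
- by rewrite D1; exact: is_cvg_cst.
- by rewrite D1; exact: is_cvg_cst.
- by move=> x; have [] := is_derive_affine s d x.
- apply: (cvg_comp (fun x => s * x) (fun y => y + d)); last exact: cvg_addrr_Ny.
  exact: gt0_cvgMrNy.
- apply: (cvg_comp (fun x => s * x) (fun y => y + d)); last exact: cvg_addrr.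
  exact: gt0_cvgMry.
- exact: cq.
- exact: q0.
Qed.

Lemma integral_affine (q : R -> R) (s d : R) : 0 < s -> continuous q ->
  (\int[mu]_x (q x)%:E = \int[mu]_x (q (s * x + d) * s)%:E)%E.
Proof.
move=> s0 cq.
have cN : continuous (\- q) by move=> x; apply: cvgN; exact: cq.
have e (r : R -> R) x : r^\+ (s * x + d) * s = (fun x => r (s * x + d) * s)^\+ x.
  by rewrite /funrpos maxr_pMl ?mul0r// ltW.
rewrite integralE [RHS]integralE; congr (_ - _)%E.
  rewrite (funerpos q) (funerpos (fun x => q (s * x + d) * s)).
  rewrite (ge0_integral_affine d s0 (continuous_funrpos cq) (@funrpos_ge0 _ _ q)).
  by apply: eq_integral => x _; rewrite e.
rewrite (funerneg q) (funerneg (fun x => q (s * x + d) * s)) -!funrposN.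
rewrite (ge0_integral_affine d s0 (continuous_funrpos cN) (@funrpos_ge0 _ _ (\- q)%R)).
apply: eq_integral => x _; rewrite (e (\- q)) /=; congr (_^\+ _)%:E.
by apply/funext => z; rewrite mulNr.
Qed.

Lemma integrable_affine (q : R -> R) (s d : R) : 0 < s -> continuous q ->
  mu.-integrable setT (EFin \o q) -> mu.-integrable setT (EFin \o (fun x => q (s * x + d))).
Proof.
move=> s0 cq /integrableP[_ iq]; apply/integrableP; split.
  apply/measurable_EFinP; apply: continuous_measurable_fun.
  exact: continuous_affine.
have cn : continuous (Num.norm \o q) by move=> x; apply: cvg_norm; exact: cq.
have := integral_affine d s0 cn; rewrite /= => e.
rewrite (_ : integral _ _ _ = (s^-1)%:E * \int[mu]_x (`|q x|)%:E)%E.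
  by rewrite lte_mul_pinfty// lee_fin invr_ge0 ltW.
rewrite e -ge0_integralZl//.
- by apply: eq_integral => x _ /=; rewrite -EFinM mulrCA mulVf ?mulr1// gt_eqF.
- apply/measurable_EFinP; apply: continuous_measurable_fun.
  have := @continuous_affine (fun x => `|q x| * s) s d; apply => x.
  by apply: cvgM; [exact: cn|exact: cvg_cst].
- by move=> x _; rewrite lee_fin mulr_ge0// ltW.
- by rewrite lee_fin invr_ge0 ltW.
Qed.
End lebesgue.

(** * The relaxation operator *)

Section relax.
Context {R : realType}.
Notation mu := (@lebesgue_measure R).
Notation ray := (`[(0:R), +oo[%classic).

Lemma exp_pdfE : (fun s : R => expR (- s)) \_ ray = exponential_pdf 1.
Proof.
by rewrite /exponential_pdf; apply/funext => x; rewrite /patch; case: ifP => // _; rewrite mul1r mulN1r.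
Qed.

Lemma integrable_exp : mu.-integrable ray (EFin \o (fun s => expR (- s))).
Proof.
apply/integrable_mkcond => //; rewrite restrict_EFin exp_pdfE.
exact: integrable_exponential_pdf.
Qed.

Lemma Rintegral_exp : \int[mu]_(s in ray) expR (- s) = 1.
Proof. by rewrite Rintegral_mkcond exp_pdfE /Rintegral integral_exponential_pdf. Qed.

Definition cts_bounded (v : R -> R) (B : R) := continuous v /\ forall x, `|v x| <= B.

(** On bounded functions this inverts [v |-> v + del v'] ([relax_ode]), hence the
Fourier multiplier [(1 + 2 pi i del xi)^-1]; a negative [del] integrates over the
other side, and [del = 0] gives the identity. *)
Definition relax (del : R) (v : R -> R) (y : R) :=
  \int[mu]_(s in ray) (expR (- s) * v (y - del * s)).

Lemma continuous_backshift (v : R -> R) (y del : R) : continuous v ->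
  continuous (fun s => v (y - del * s)).
Proof.
move=> cv.
have -> : (fun s => v (y - del * s)) = (fun s => v (- del * s + y)).
  by apply/funext => s; rewrite mulNr addrC.
exact: continuous_affine.
Qed.

Lemma measurable_backshift D (v : R -> R) (y del : R) : continuous v ->
  measurable_fun D (fun s => v (y - del * s)).
Proof.
move=> cv; apply: measurable_funTS; apply: continuous_measurable_fun.
exact: continuous_backshift.
Qed.

Lemma continuous_kernel (v : R -> R) (y del : R) : continuous v ->
  continuous (fun s => expR (- s) * v (y - del * s)).
Proof.
move=> cv s; apply: cvgM; last exact: continuous_backshift.
apply: continuous_comp; last exact: continuous_expR.
by apply: cvgN; exact: cvg_id.
Qed.

Lemma relax_integrable del v B y : cts_bounded v B ->
  mu.-integrable ray (EFin \o (fun s => expR (- s) * v (y - del * s))).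
Proof.
move=> [cv vB]; apply: (@integrable_bounded_mul _ _ _ _ _ _ _ B) => //.
- exact: integrable_exp.
- exact: measurable_backshift.
Qed.

Lemma relax_bound del v B y : cts_bounded v B -> `|relax del v y| <= B.
Proof.
move=> bv; have [cv vB] := bv; rewrite -[B]mulr1 -Rintegral_exp; apply: Rintegral_bound => //.
- exact: integrable_exp.
- exact: measurable_backshift.
Qed.

Lemma relax_dominated del (v_ : nat -> R -> R) v B y :
  (forall n, cts_bounded (v_ n) B) -> (forall x, v_ ^~ x @ \oo --> v x) ->
  (fun n => relax del (v_ n) y) @ \oo --> relax del v y.
Proof.
move=> vB vv; have B0 : 0 <= B by apply: le_trans ((vB 0%N).2 0).
apply: (@Rintegral_dominated_cvg _ _ R mu ray
  (fun n s => expR (- s) * v_ n (y - del * s)) (fun s => expR (- s) * v (y - del * s))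
  (fun s => expR (- s) * B)) => //.
- move=> n; apply: measurable_funTS; apply: continuous_measurable_fun.
  by apply: continuous_kernel; exact: (vB n).1.
- by move=> x _; apply: cvgM; [exact: cvg_cst|exact: vv].
- by apply: (@integrable_bounded_mul _ _ _ _ _ _ (fun=> B) B) => //; [exact: integrable_exp|move=> x _; rewrite ger0_norm].
- by move=> n x _; rewrite normrM ger0_norm ?expR_ge0// ler_wpM2l ?expR_ge0//; exact: (vB n).2.
Qed.

Lemma relax_continuous del v B : cts_bounded v B -> continuous (relax del v).
Proof.
move=> bv y; have B0 : 0 <= B by apply: le_trans (bv.2 0).
apply/(@cvg_nbhsP _ R^o) => w wy.
apply: (@Rintegral_dominated_cvg _ _ R mu ray
  (fun n s => expR (- s) * v (w n - del * s)) (fun s => expR (- s) * v (y - del * s))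
  (fun s => expR (- s) * B)) => //.
- move=> n; apply: measurable_funTS; apply: continuous_measurable_fun.
  by apply: continuous_kernel; exact: bv.1.
- move=> x _; apply: cvgM; first exact: cvg_cst.
  apply: (cvg_comp (fun n => w n - del * x) v); last exact: bv.1.
  by apply: cvgB => //; exact: cvg_cst.
- apply: (@integrable_bounded_mul _ _ _ _ _ _ (fun=> B) B) => //.
    exact: integrable_exp.
  by move=> x _; rewrite ger0_norm.
- move=> n x _; rewrite normrM ger0_norm ?expR_ge0// ler_wpM2l ?expR_ge0//.
  exact: bv.2.
Qed.

Lemma relax_cts_bounded del v B : cts_bounded v B -> cts_bounded (relax del v) B.
Proof. by move=> bv; split; [exact: relax_continuous bv|move=> x; exact: relax_bound]. Qed.

Lemma relax_lin del (v w : R -> R) B B' (a b : R) y : cts_bounded v B -> cts_bounded w B' ->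
  relax del (fun x => a * v x + b * w x) y = a * relax del v y + b * relax del w y.
Proof.
move=> bv bw; rewrite /relax.
rewrite -RintegralZl//; last exact: relax_integrable bv.
rewrite -RintegralZl//; last exact: relax_integrable bw.
rewrite -RintegralD//.
- by apply: eq_Rintegral => s _; ring.
- exact: (integrableZl _ _ (relax_integrable del y bv)).
- exact: (integrableZl _ _ (relax_integrable del y bw)).
Qed.

Lemma relax0 v : relax 0 v = v.
Proof.
apply/funext => y; rewrite /relax.
under eq_Rintegral do rewrite mul0r subr0.
by rewrite RintegralZr// ?Rintegral_exp ?mul1r//; exact: integrable_exp.
Qed.

(** Split the integral at [d] and use [exp(- (s + d)) = exp(- s) exp(- d)]. What
matters for the zeros is that the weight on the segment from [y] to [y - del d] is
positive. *)
Lemma relax_flow del v B y d : cts_bounded v B -> 0 <= d ->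
  relax del v y = \int[mu]_(s in `[0, d]) (expR (- s) * v (y - del * s)) +
    expR (- d) * relax del v (y - del * d).
Proof.
move=> bv d0; have iv := relax_integrable del y bv.
have := @Rintegral_itvB R _ (BLeft 0) +oo%O d iv.
rewrite !bnd_simp => /(_ d0 isT) h.
rewrite /relax -[LHS](subrK (\int[mu]_(s in `[0, d]) (expR (- s) * v (y - del * s)))).
rewrite h addrC; congr (_ + _).
rewrite Rintegral_itv_obnd_cbnd; last first.
  apply: integrableS iv => //.
  by apply: subset_itvr; rewrite bnd_simp.
rewrite (integral_ray_shift d (@continuous_kernel v y del bv.1)).
rewrite -RintegralZl//; last exact: relax_integrable bv.
apply: eq_Rintegral => s _; rewrite opprD expRD.
have -> : y - del * (s + d) = y - del * d - del * s by ring.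
ring.
Qed.

Lemma continuous_no_zero_sign (v : R -> R) (x y : R) : continuous v ->
  (forall z, x < z < y -> v z != 0) ->
  (forall z, x < z < y -> 0 < v z) \/ (forall z, x < z < y -> v z < 0).
Proof.
move=> cv nz; have [xy|yx] := ltP x y; last first.
  by left => z /andP[xz zy]; have := lt_trans xz zy; rewrite ltNge yx.
pose m := (x + y) / 2; have mxy : x < m < y by rewrite /m; apply/andP; split; lra.
have ivt z w : x < z < y -> x < w < y -> v z < 0 -> 0 < v w -> False.
  move=> /andP[xz zy] /andP[xw wy] vz vw.
  have [zw|wz] := leP z w.
    have [|c] := @IVT R v z w 0 zw (continuous_subspaceT cv).
      by rewrite ge_min le_max (ltW vz) (ltW vw) orbT.
    rewrite in_itv/= => /andP[zc cw] vc.
    have /nz : x < c < y by rewrite (lt_le_trans xz zc) (le_lt_trans cw wy).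
    by rewrite vc eqxx.
  have [|c] := @IVT R v w z 0 (ltW wz) (continuous_subspaceT cv).
    by rewrite ge_min le_max (ltW vz) (ltW vw) orbT.
  rewrite in_itv/= => /andP[wc cz] vc.
  have /nz : x < c < y by rewrite (lt_le_trans xw wc) (le_lt_trans cz zy).
  by rewrite vc eqxx.
have := nz m mxy; rewrite neq_lt => /orP[vm|vm]; [right|left] => z xzy.
  by have := nz z xzy; rewrite neq_lt => /orP[//|vz]; have := ivt m z mxy xzy vm vz.
by have := nz z xzy; rewrite neq_lt => /orP[vz|//]; have := ivt z m xzy mxy vz vm.
Qed.

Lemma Rintegral_pos (q : R -> R) (d : R) : 0 < d -> continuous q ->
  (forall s, 0 < s < d -> 0 < q s) -> \int[mu]_(s in `[0, d]) q s != 0.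
Proof.
move=> d0 cq q0; apply/negP => /eqP h.
pose F x := \int[mu]_(t in `[0, x]) q t.
have iq e : mu.-integrable `[0, e] (EFin \o q).
  apply: continuous_compact_integrable; first exact: segment_compact.
  exact: continuous_subspaceT.
have dF (x : R) : 0 < x -> is_derive x 1 F (q x).
  move=> x0; have x1 : x < x + 1 by rewrite ltrDl.
  have [dx ex] := @continuous_FTC1_closed R q 0 x (x + 1) x1 (iq _) x0 (cq x).
  by apply: DeriveDef; [exact: dx|rewrite -derive1E; exact: ex].
have cF : {within `[0, d], continuous F}.
  by apply: parameterized_integral_continuous; [exact: ltW|exact: iq].
have [|c] := @MVT R F q 0 d d0 _ cF.
  by move=> x; rewrite in_itv/= => /andP[x0 _]; exact: dF.
rewrite in_itv/= => c0d; rewrite /F h set_itv1 Rintegral_set1 subr0 => /esym/eqP.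
by rewrite mulf_eq0 subr0 (gt_eqF d0) orbF gt_eqF ?q0.
Qed.

(** Between two zeros of [relax del v] the flow formula reduces to a weighted
integral of [v] over the segment joining them, so [v] changes sign or vanishes
there. *)
Lemma relax_rolle del v B (x y : R) : cts_bounded v B -> del != 0 -> x < y ->
  relax del v x = 0 -> relax del v y = 0 -> exists2 z, x < z < y & v z = 0.
Proof.
move=> bv del0 xy vx vy; apply: contrapT => nz.
have cv := bv.1.
have nz' z : x < z < y -> v z != 0.
  by move=> h; apply/eqP => vz; apply: nz; exists z.
pose d := (y - x) / `|del|; have d0 : 0 < d by rewrite divr_gt0 ?subr_gt0 ?normr_gt0.
have key p : relax del v p = 0 -> relax del v (p - del * d) = 0 ->
    (forall s, 0 < s < d -> x < p - del * s < y) -> False.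
  move=> h1 h2 hs.
  have /esym := relax_flow del p bv (ltW d0); rewrite h1 h2 mulr0 addr0.
  have ck := @continuous_kernel v p del cv.
  have [pos|neg] := continuous_no_zero_sign cv nz'.
    apply/eqP/Rintegral_pos => // s /hs /pos.
    by move=> ?; rewrite mulr_gt0// expR_gt0.
  move=> /eqP; apply/negP.
  have -> : \int[mu]_(s in `[0, d]) (expR (- s) * v (p - del * s)) =
     - \int[mu]_(s in `[0, d]) (- (expR (- s) * v (p - del * s))).
    rewrite -[RHS]mulN1r -RintegralZl//.
      by apply: eq_Rintegral => s _; rewrite mulN1r opprK.
    apply: continuous_compact_integrable; first exact: segment_compact.
    by apply: continuous_subspaceT => s; apply: cvgN; exact: ck.
  rewrite oppr_eq0; apply: Rintegral_pos => //.
    by move=> s; apply: cvgN; exact: ck.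
  by move=> s /hs /neg ?; rewrite -mulrN mulr_gt0 ?expR_gt0// oppr_gt0.
have [del_pos|del_neg] := ltP 0 del.
- apply: (key y vy).
    suff -> : y - del * d = x by [].
    by rewrite /d gtr0_norm//; field; rewrite gt_eqF.
  move=> s /andP[s0 sd].
  have : del * s < y - x by move: sd; rewrite /d gtr0_norm// ltr_pdivlMr// mulrC.
  have : 0 < del * s by rewrite mulr_gt0.
  by move=> ? ?; apply/andP; split; lra.
- have del_lt0 : del < 0 by rewrite lt_neqAle del0.
  apply: (key x vx).
    suff -> : x - del * d = y by [].
    by rewrite /d ltr0_norm//; field; rewrite lt_eqF.
  move=> s /andP[s0 sd].
  have : - del * s < y - x by move: sd; rewrite /d ltr0_norm// ltr_pdivlMr ?oppr_gt0// mulrC.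
  have : 0 < - del * s by rewrite mulr_gt0// oppr_gt0.
  by move=> ? ?; apply/andP; split; lra.
Qed.

(** Uniqueness of the bounded solution of [p + del p' = v]: the difference with
any solution is multiplied by [exp d] when moving by [- del d]. *)
Lemma relax_ode del (p v : R -> R) B B' y : cts_bounded v B -> (forall x, `|p x| <= B') ->
  (forall x : R, exists2 p' : R, is_derive x 1 p p' & p x + del * p' = v x) ->
  relax del v y = p y.
Proof.
move=> bv pB hp; have cv := bv.1.
pose P s := - (expR (- s) * p (y - del * s)).
have dP (s : R) : is_derive s 1 P (expR (- s) * v (y - del * s)).
  have [p' dp <-] := hp (y - del * s).
  have d1 : is_derive s 1 (fun s : R => y - del * s) (- del).
    by apply: is_derive_eq; rewrite /GRing.scale /=; ring.
  have d2 : is_derive s 1 (fun s => p (y - del * s)) (p' * - del) by exact: is_derive1_comp.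
  by apply: is_derive_eq; rewrite /GRing.scale /=; ring.
have cP : continuous P := is_derive_continuous dP.
have FTC d : 0 < d -> \int[mu]_(s in `[0, d]) (expR (- s) * v (y - del * s)) =
    p y - expR (- d) * p (y - del * d).
  move=> d0; rewrite /Rintegral (@continuous_FTC2 R _ P 0 d d0).
  - by rewrite /= /P oppr0 expR0 mulr0 subr0 mul1r; ring.
  - by apply: continuous_subspaceT; exact: continuous_kernel.
  - split.
    + by move=> s _; have [] := dP s.
    + by apply: cvg_at_right_filter; exact: cP.
    + by apply: cvg_at_left_filter; exact: cP.
  - by move=> s _; rewrite derive1E; have [_ ->] := dP s.
have B0 : 0 <= B by apply: le_trans (bv.2 0).
have B'0 : 0 <= B' by apply: le_trans (pB 0).
apply/eqP; rewrite -subr_eq0 -normr_le0; apply/ler_addgt0Pr => e e0; rewrite add0r.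
pose d := (B + B') / e + 1.
have d0 : 0 < d by rewrite ltr_wpDl// divr_ge0 ?addr_ge0// ltW.
rewrite (relax_flow del y bv (ltW d0)) FTC//.
set q := y - del * d.
have -> : p y - expR (- d) * p q + expR (- d) * relax del v q - p y =
  expR (- d) * (relax del v q - p q) by ring.
rewrite normrM ger0_norm ?expR_ge0// expRN mulrC ler_pdivrMr ?expR_gt0//.
apply: (@le_trans _ _ (B + B')).
  apply: le_trans (ler_normB _ _) _; apply: lerD; [exact: relax_bound|exact: pB].
apply: (@le_trans _ _ (e * d)).
  by rewrite /d mulrDr mulr1 mulrC divfK ?gt_eqF// lerDl ltW.
by rewrite ler_pM2l//; have := expR_ge1Dx d; lra.
Qed.
End relax.

(** * The Fourier transform of a Gaussian *)

Section fourier_gauss.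
Context {R : realType}.
Notation mu := (@lebesgue_measure R).

Lemma gauss_integral (sg : R) : 0 < sg ->
  mu.-integrable setT (EFin \o (fun x => expR (- (sg * x ^+ 2)))) /\
  \int[mu]_x expR (- (sg * x ^+ 2)) = Num.sqrt (pi / sg).
Proof.
move=> sg0; pose s := Num.sqrt (2 * sg)^-1.
have s2 : s ^+ 2 = (2 * sg)^-1 by rewrite sqr_sqrtr// invr_ge0 mulr_ge0// ltW.
have s0 : s != 0 by rewrite gt_eqF// sqrtr_gt0 invr_gt0 mulr_gt0.
pose p := Num.sqrt (pi / sg).
have p0 : 0 < p by rewrite sqrtr_gt0 divr_gt0// pi_gt0.
have E : (fun x => expR (- (sg * x ^+ 2))) = (fun x => p * normal_pdf 0 s x).
  apply/funext => x; rewrite /normal_pdf (negbTE s0) /normal_peak /normal_fun s2.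
  have -> : (2 * sg)^-1 * pi *+ 2 = pi / sg.
    by rewrite -mulr_natr; field; rewrite gt_eqF.
  rewrite -/p mulVKf ?gt_eqF//; congr expR.
  by rewrite subr0 -mulr_natr; field; rewrite gt_eqF.
have iN := @integrable_normal_pdf R 0 s.
rewrite E; split; first exact: (integrableZl _ _ iN).
by rewrite RintegralZl// /Rintegral integral_normal_pdf mulr1.
Qed.

Lemma Rintegral_derive0 (P q : R -> R) :
  (forall x : R, is_derive x 1 P (q x)) -> continuous q ->
  mu.-integrable setT (EFin \o q) ->
  (fun n : nat => P n%:R) @ \oo --> 0 -> (fun n : nat => P (- n%:R)) @ \oo --> 0 ->
  \int[mu]_x q x = 0.
Proof.
move=> dP cq iq P0 PN0.
have cP : continuous P := is_derive_continuous dP.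
pose D n : set R := `[- (n.+1%:R), n.+1%:R]%classic.
have h1 : \int[mu]_x (q \_ (D n)) x @[n --> \oo] --> \int[mu]_x q x.
  apply: (@Rintegral_dominated_cvg _ _ R mu setT (fun n => q \_ (D n)) q (fun x => `|q x|)) => //.
  - move=> n; have mDn : measurable (D n) by exact: measurable_itv.
    apply: (measurable_restrictT _ mDn).1; apply: measurable_funTS; exact: continuous_measurable_fun.
  - move=> x _; apply: cvg_near_cst; near=> n.
    rewrite patchE mem_set// /D /= in_itv/= -ler_norml.
    near: n; exists (Num.truncn `|x|) => // n /= hn.
    by rewrite ltW// (lt_le_trans (truncnS_gt _))// ler_nat ltnS.
  - exact: integrable_norm.
  - by move=> n x _; rewrite patchE; case: ifP => //; rewrite normr0.
apply: (@cvg_unique _ (@Rhausdorff R) _ _ _ _ h1).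
have -> : (fun n => \int[mu]_x (q \_ (D n)) x) = (fun n : nat => P n.+1%:R - P (- n.+1%:R)).
  apply/funext => n; rewrite -Rintegral_mkcond /Rintegral.
  rewrite (@continuous_FTC2 R q P (- n.+1%:R) n.+1%:R)//.
  - by rewrite gtrN.
  - exact: continuous_subspaceT.
  - split.
    + by move=> s _; have [] := dP s.
    + by apply: cvg_at_right_filter; exact: cP.
    + by apply: cvg_at_left_filter; exact: cP.
  - by move=> s _; rewrite derive1E; have [_ ->] := dP s.
have h2 : (fun n : nat => P n.+1%:R - P (- n.+1%:R)) @ \oo --> (0 - 0 : R).
  apply: cvgB; first by move: P0; rewrite -(cvg_shiftS (fun n : nat => P n%:R)).
  by move: PN0; rewrite -(cvg_shiftS (fun n : nat => P (- n%:R))).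
by rewrite subr0 in h2.
Unshelve. all: by end_near. Qed.

Lemma gauss_moment (sg : R) : 0 < sg ->
  mu.-integrable setT (EFin \o (fun x => `|x| * expR (- (sg * x ^+ 2)))).
Proof.
move=> sg0; have sg2 : 0 < sg / 2 by rewrite divr_gt0.
pose D := 1 + 2 / sg; have D0 : 0 < D by rewrite ltr_pwDl// divr_ge0// ltW.
apply: (@le_integrable _ _ _ mu setT measurableT _ (fun x => D%:E * (expR (- (sg / 2 * x ^+ 2)))%:E)%E).
- apply/measurable_EFinP/measurable_funM => //; apply: continuous_measurable_fun.
  by apply: (@is_derive_continuous _ _ (fun x => expR (- (sg * x ^+ 2)) * (- (sg * (2 * x))))) => x; apply: is_derive_eq; rewrite /GRing.scale /=; ring.
- move=> x _; rewrite /= lee_fin normrM normr_id [leRHS]ger0_norm ?mulr_ge0 ?expR_ge0 ?(ltW D0)// ger0_norm ?expR_ge0//.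
  have -> : - (sg * x ^+ 2) = - (sg / 2 * x ^+ 2) - (sg / 2 * x ^+ 2) by field.
  rewrite expRD mulrA ler_wpM2r ?expR_ge0// expRN ler_pdivrMr ?expR_gt0//.
  apply: (@le_trans _ _ (D * (1 + sg / 2 * x ^+ 2))); last by rewrite ler_pM2l// expR_ge1Dx.
  have -> : D * (1 + sg / 2 * x ^+ 2) = 1 + x ^+ 2 + 2 / sg + sg / 2 * x ^+ 2.
    by rewrite /D; field; rewrite gt_eqF.
  have : 0 <= 2 / sg by rewrite divr_ge0// ltW.
  have : 0 <= sg / 2 * x ^+ 2 by rewrite mulr_ge0 ?sqr_ge0 ?(ltW sg2).
  have : `|x| <= 1 + x ^+ 2 by rewrite -real_normK ?num_real//; have := normr_ge0 x; nra.
  by lra.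
- by apply: (integrableZl _ _ (gauss_integral sg2).1).
Qed.

Lemma gauss_vanish (sg : R) (e : R -> R) : 0 < sg -> (forall x, `|e x| <= 1) ->
  forall u : nat -> R, (forall n, u n ^+ 2 = n%:R ^+ 2) ->
  (fun n => expR (- (sg * u n ^+ 2)) * e (u n)) @ \oo --> 0.
Proof.
move=> sg0 e1 u un.
have g0 : (fun n => expR (- sg) ^+ n) @ \oo --> 0.
  by apply: cvg_expr; rewrite ger0_norm ?expR_ge0// expR_lt1 oppr_lt0.
apply: norm_cvg0; apply: (squeeze_cvgr _ (cvg_cst 0) g0).
apply: nearW => n; rewrite normr_ge0/= normrM (ger0_norm (expR_ge0 _)) un.
apply: (@le_trans _ _ (expR (- (sg * n%:R ^+ 2)) * 1)); first by rewrite ler_wpM2l// expR_ge0.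
rewrite mulr1 -expRM_natl ler_expR mulrN lerN2 mulrC ler_pM2l//.
by rewrite -natrX ler_nat; case: n => // n; rewrite -mulnn leq_pmulr.
Qed.

Lemma is_derive_gauss (sg x : R) : is_derive x 1 (fun x => expR (- (sg * x ^+ 2)))
  (expR (- (sg * x ^+ 2)) * (- (sg * (2 * x)))).
Proof. by apply: is_derive_eq; rewrite /GRing.scale /=; ring. Qed.

Lemma is_derive_gauss_freq (sg w x : R) :
  is_derive w 1 (fun w => expR (- (sg * x ^+ 2)) * cos (w * x))
    (- x * sin (w * x) * expR (- (sg * x ^+ 2))).
Proof. by apply: is_derive_eq; rewrite /GRing.scale /=; ring. Qed.

Lemma is_derive_gauss_sin (sg w x : R) :
  is_derive x 1 (fun x => expR (- (sg * x ^+ 2)) * sin (w * x))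
    (2 * sg * (- x * sin (w * x) * expR (- (sg * x ^+ 2))) +
     w * (expR (- (sg * x ^+ 2)) * cos (w * x))).
Proof. by apply: is_derive_eq; rewrite /GRing.scale /=; ring. Qed.

Lemma is_derive_gauss_moment (sg w x : R) :
  is_derive x 1 (fun x => - x * sin (w * x) * expR (- (sg * x ^+ 2)))
    (- (sin (w * x) * expR (- (sg * x ^+ 2)) +
      x * w * cos (w * x) * expR (- (sg * x ^+ 2)) -
      x * sin (w * x) * (2 * sg * x) * expR (- (sg * x ^+ 2)))).
Proof. by apply: is_derive_eq; rewrite /GRing.scale /=; ring. Qed.

Lemma continuous_cos_freq (w : R) : continuous (fun x : R => cos (w * x)).
Proof.
apply: (@is_derive_continuous _ _ (fun x => - sin (w * x) * w)) => x.
by apply: is_derive_eq; rewrite /GRing.scale /= mulr1.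
Qed.

(** As a function of the frequency [w], the integral satisfies
[I' = - w / (2 sg) I]: differentiate under the integral sign, then integrate by
parts in the form of a vanishing integral of a derivative. *)
Lemma gauss_fourier (sg w0 : R) : 0 < sg ->
  \int[mu]_x (expR (- (sg * x ^+ 2)) * cos (w0 * x)) =
  Num.sqrt (pi / sg) * expR (- (w0 ^+ 2 / (4 * sg))).
Proof.
move=> sg0.
pose f (w x : R) := expR (- (sg * x ^+ 2)) * cos (w * x).
pose I w := \int[mu]_x f w x.
have [ig gE] := gauss_integral sg0.
have cE : continuous (fun x : R => expR (- (sg * x ^+ 2))) := is_derive_continuous (is_derive_gauss sg).
have intf w' : mu.-integrable setT (EFin \o f w').
  apply: (@integrable_bounded_mul _ _ _ _ _ _ _ 1) => //.
  - apply: measurable_funTS; apply: continuous_measurable_fun.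
    exact: continuous_cos_freq.
  - by move=> x _; rewrite ler_norml cos_geN1 cos_le1.
pose G (x : R) := `|x| * expR (- (sg * x ^+ 2)).
have iG := gauss_moment sg0.
have d1E w' x : partial1of2 f w' x = - x * sin (w' * x) * expR (- (sg * x ^+ 2)).
  by rewrite partial1of2E; have [_ ->] := is_derive_gauss_freq sg w' x.
have Gub w' x : `|partial1of2 f w' x| <= G x.
  rewrite d1E /G !normrM normrN (ger0_norm (expR_ge0 _)) ler_wpM2r ?expR_ge0//.
  by rewrite ler_piMr// ler_norml sin_geN1 sin_le1.
have dI (w' : R) : is_derive w' 1 I (- (w' / (2 * sg)) * I w').
  have Ia : (`](w' - 1), (w' + 1)[%classic : set R) w'.
    by rewrite /= in_itv/= ltrBlDr ltrDl ltr01.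
  have der x y : (`](w' - 1), (w' + 1)[%classic : set R) x -> [set: R] y -> derivable (f ^~ y) x 1.
    by move=> _ _; have [] := is_derive_gauss_freq sg x y.
  have dU := @derivable_under_integral R _ _ mu f setT measurableT w' _ _ Ia
    (fun x _ => intf x) der G (fun x => mulr_ge0 (normr_ge0 x) (expR_ge0 _)) iG (fun x y _ _ => Gub x y).
  have eU := @differentiation_under_integral R _ _ mu f setT measurableT w' _ _ Ia
    (fun x _ => intf x) der G (fun x => mulr_ge0 (normr_ge0 x) (expR_ge0 _)) iG (fun x y _ _ => Gub x y).
  apply: DeriveDef => //; rewrite -derive1E eU.
  pose s (x : R) := - x * sin (w' * x) * expR (- (sg * x ^+ 2)).
  have cs : continuous s := is_derive_continuous (is_derive_gauss_moment sg w').
  have cf : continuous (f w').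
    move=> x; apply: cvgM; first exact: cE.
    exact: continuous_cos_freq.
  have its : mu.-integrable setT (EFin \o s).
    apply: (le_integrable measurableT _ _ iG).
      by apply/measurable_EFinP; exact: continuous_measurable_fun.
    move=> x _; rewrite /= lee_fin /s -d1E; apply: le_trans (Gub _ _) _; exact: ler_norm.
  have z : \int[mu]_x (2 * sg * s x + w' * f w' x) = 0.
    apply: (Rintegral_derive0 (is_derive_gauss_sin sg w')).
    - by move=> x; apply: cvgD; apply: cvgMl_tmp; [exact: cs|exact: cf].
    - exact: (integrableD measurableT (integrableZl measurableT (2 * sg) its) (integrableZl measurableT w' (intf w'))).
    - by apply: (@gauss_vanish sg (fun x => sin (w' * x))) => // x; rewrite ler_norml sin_geN1 sin_le1.
    - apply: (@gauss_vanish sg (fun x => sin (w' * x)) _ _ (fun n => - n%:R)) => //.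
        by move=> x; rewrite ler_norml sin_geN1 sin_le1.
      by move=> n; rewrite sqrrN.
  move: z; rewrite RintegralD//; last 2 first.
  - exact: (integrableZl measurableT (2 * sg) its).
  - exact: (integrableZl measurableT w' (intf w')).
  rewrite !RintegralZl// => z.
  rewrite (_ : \int[mu]_(y in setT) _ = \int[mu]_x s x); last by apply: eq_Rintegral => x _; rewrite /s -d1E.
  apply: (mulfI (_ : 2 * sg != 0)); first by rewrite mulf_neq0// gt_eqF.
  have -> : 2 * sg * (- (w' / (2 * sg)) * I w') = - (w' * I w').
    by field; rewrite gt_eqF.
  by apply/eqP; rewrite -addr_eq0 z.
have dP (w : R) : is_derive w 1 (fun w => I w * expR (w ^+ 2 / (4 * sg))) 0.
  apply: is_derive_eq; rewrite /GRing.scale /=; field; by rewrite gt_eqF.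
have := is_derive_0_is_cst w0 0 dP; rewrite /= expr0n/= mul0r expR0 mulr1 => h.
rewrite -/(f w0) -/(I w0) expRN -[LHS](mulfK (lt0r_neq0 (expR_gt0 (w0 ^+ 2 / (4 * sg))))) h -gE.
by congr (_ / _); apply: eq_Rintegral => x _; rewrite /f mul0r cos0 mulr1.
Qed.
End fourier_gauss.

(** * Superpositions of waves *)

Section fubini.
Context {R : realType}.
Notation mu := (@lebesgue_measure R).
Notation T := (measurableTypeR R).

Lemma Fubini_kernel (a b : R -> R) (k : R -> R -> R) (B : R) :
  mu.-integrable setT (EFin \o a) -> mu.-integrable setT (EFin \o b) ->
  measurable_fun [set: T * T] (fun z : T * T => k z.1 z.2) ->
  (forall x y, `|k x y| <= B) ->
  \int[mu]_x (a x * \int[mu]_y (b y * k x y)) =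
  \int[mu]_y (b y * \int[mu]_x (a x * k x y)).
Proof.
move=> ia ib mk kB; have B0 : 0 <= B by apply: le_trans (kB 0 0).
have ma : measurable_fun [set: T] a by apply/measurable_EFinP; exact: measurable_int ia.
have mb : measurable_fun [set: T] b by apply/measurable_EFinP; exact: measurable_int ib.
have mk1 (x : T) : measurable_fun [set: T] (k x).
  exact: (measurableT_comp mk (measurable_pair1 x)).
have mk2 (y : T) : measurable_fun [set: T] (fun x => k x y).
  exact: (measurableT_comp mk (measurable_pair2 y)).
pose F (z : T * T) : \bar R := (a z.1 * b z.2 * k z.1 z.2)%:E.
have mF : measurable_fun [set: T * T] F.
  apply/measurable_EFinP; apply: measurable_funM => //; apply: measurable_funM.
    exact: (measurableT_comp ma).
  exact: (measurableT_comp mb).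
have iby x : mu.-integrable setT (EFin \o (fun y => b y * k x y)).
  exact: (@integrable_bounded_mul _ _ _ mu setT b (k x) B).
have iax y : mu.-integrable setT (EFin \o (fun x => a x * k x y)).
  exact: (@integrable_bounded_mul _ _ _ mu setT a (k ^~ y) B).
have iF : (mu \x mu)%E.-integrable setT F.
  apply/integrable12ltyP => //.
  pose Nb := \int[mu]_y `|b y|; pose G x := (B * Nb) * `|a x|.
  have ina : mu.-integrable setT (EFin \o (Num.norm \o a)) by exact: integrable_norm.
  have inb : mu.-integrable setT (EFin \o (Num.norm \o b)) by exact: integrable_norm.
  have iG : mu.-integrable setT (EFin \o G) by exact: (integrableZl measurableT (B * Nb) ina).
  have Nb0 : 0 <= Nb by exact: Rintegral_ge0.
  apply: (@le_lt_trans _ _ (\int[mu]_x (G x)%:E)%E); last first.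
    have := integrable_fin_num measurableT iG; rewrite ge0_fin_numE//.
    by apply: integral_ge0 => x _; rewrite lee_fin !mulr_ge0.
  apply: ge0_le_integral => //.
  - by move=> x _; apply: integral_ge0.
  - apply: (measurable_fun_fubini_tonelli_F (m2 := mu) (abse \o F)) => //=.
    exact: measurableT_comp.
  - by apply: measurable_int iG.
  - move=> x _; apply: (@le_trans _ _ (\int[mu]_y (B * `|a x| * `|b y|)%:E)%E).
      apply: ge0_le_integral => //.
      + apply: measurableT_comp => //; exact: (measurableT_comp mF (measurable_pair1 x)).
      + by apply/measurable_EFinP; apply: measurable_funM => //; exact: measurableT_comp.
      + move=> y _; rewrite /F /= lee_fin !normrM mulrC.
        rewrite -mulrA ler_wpM2r ?mulr_ge0//.
    have ii : mu.-integrable setT (EFin \o (fun y => B * `|a x| * `|b y|)) by exact: (integrableZl measurableT _ inb).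
    rewrite -[leLHS]fineK; last exact: integrable_fin_num.
    rewrite -/(Rintegral mu setT (fun y => B * `|a x| * `|b y|)) RintegralZl//.
    by rewrite lee_fin /G -/Nb mulrAC.
have e1 (x : R) : (\int[mu]_y F (x, y) = (a x * \int[mu]_y (b y * k x y))%:E)%E.
  have ii : mu.-integrable setT (EFin \o (fun y => a x * (b y * k x y))).
    exact: (integrableZl measurableT (a x) (iby x)).
  rewrite -RintegralZl// /Rintegral fineK; last exact: integrable_fin_num.
  by apply: eq_integral => y _; rewrite /F /= mulrA.
have e2 (y : R) : (\int[mu]_x F (x, y) = (b y * \int[mu]_x (a x * k x y))%:E)%E.
  have ii : mu.-integrable setT (EFin \o (fun x => b y * (a x * k x y))).
    exact: (integrableZl measurableT (b y) (iax y)).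
  rewrite -RintegralZl// /Rintegral fineK; last exact: integrable_fin_num.
  by apply: eq_integral => x _; rewrite /F /=; congr (_%:E); ring.
have := Fubini iF.
under eq_integral do rewrite e1.
under [in X in _ = X -> _]eq_integral do rewrite e2.
by rewrite /Rintegral => ->.
Qed.
End fubini.

Section multiplier.
Context {R : realType}.
Notation mu := (@lebesgue_measure R).
Notation T := (measurableTypeR R).

(** Real and imaginary part of the product over [s] of
[(1 + 2 pi i del xi)^-1]. *)
Fixpoint tp_factor (s : seq R) (xi : R) : R * R :=
  if s is del :: s' then
    let x := 2 * pi * del * xi in
    (((tp_factor s' xi).1 + x * (tp_factor s' xi).2) / (1 + x ^+ 2),
     ((tp_factor s' xi).2 - x * (tp_factor s' xi).1) / (1 + x ^+ 2))
  else (1, 0).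

Lemma onex2_gt0 (x : R) : 0 < 1 + x ^+ 2.
Proof. by rewrite ltr_pwDl// sqr_ge0. Qed.

Lemma tp_factor_norm s xi : (tp_factor s xi).1 ^+ 2 + (tp_factor s xi).2 ^+ 2 <= 1.
Proof.
elim: s => [|del s IH] /=; first by rewrite expr1n expr0n addr0.
set x := 2 * pi * del * xi; set U := (tp_factor s xi).1 in IH *; set V := (tp_factor s xi).2 in IH *.
have x0 := onex2_gt0 x.
have -> : ((U + x * V) / (1 + x ^+ 2)) ^+ 2 + ((V - x * U) / (1 + x ^+ 2)) ^+ 2 =
  (U ^+ 2 + V ^+ 2) / (1 + x ^+ 2) by field; rewrite gt_eqF.
by rewrite ler_pdivrMr// mul1r (le_trans IH)// lerDl sqr_ge0.
Qed.

Lemma tp_factor_bound s xi : `|(tp_factor s xi).1| <= 1 /\ `|(tp_factor s xi).2| <= 1.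
Proof.
have := tp_factor_norm s xi; set U := (tp_factor s xi).1; set V := (tp_factor s xi).2 => h.
by rewrite !ler_norml; split; nra.
Qed.

Lemma tp_factor_parity s xi : tp_factor s (- xi) = ((tp_factor s xi).1, - (tp_factor s xi).2).
Proof.
elim: s => [|del s IH] /=; first by rewrite oppr0.
rewrite IH /=; set x := 2 * pi * del * xi.
have -> : 2 * pi * del * - xi = - x by rewrite /x; ring.
have x0 : 1 + x ^+ 2 != 0 by rewrite gt_eqF// onex2_gt0.
by congr (_, _); rewrite sqrrN; field.
Qed.

Lemma tp_factor_measurable s : measurable_fun [set: T] (fun xi => (tp_factor s xi).1) /\
  measurable_fun [set: T] (fun xi => (tp_factor s xi).2).
Proof.
elim: s => [|del s [IH1 IH2]] /=; first by split; exact: measurable_cst.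
have mx : measurable_fun [set: T] (fun xi => 2 * pi * del * xi) by exact: measurable_funM.
have mi : measurable_fun [set: T] (fun xi : R => (1 + (2 * pi * del * xi) ^+ 2)^-1).
  apply: continuous_measurable_fun => x; apply: cvgV; first by rewrite gt_eqF// onex2_gt0.
  pose h := fun x : R => 1 + (2 * pi * del * x) ^+ 2.
  suff : continuous h by exact.
  apply: (@is_derive_continuous _ h (fun x => 2 * (2 * pi * del * x) * (2 * pi * del))) => {}x.
  by apply: is_derive_eq; rewrite /GRing.scale /=; ring.
split; apply: measurable_funM => //.
  by apply: measurable_funD => //; exact: measurable_funM.
by apply: measurable_funB => //; exact: measurable_funM.
Qed.

(** Real part of [exp(2 pi i xi z)] times the product encoded by [tp_factor]. *)
Definition wave (s : seq R) (xi z : R) :=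
  cos (2 * pi * xi * z) * (tp_factor s xi).1 - sin (2 * pi * xi * z) * (tp_factor s xi).2.

Lemma wave_bound s xi z : `|wave s xi z| <= 2.
Proof.
have [h1 h2] := tp_factor_bound s xi.
apply: le_trans (ler_normB _ _) _; rewrite !normrM.
have c1 : `|cos (2 * pi * xi * z)| <= 1 by rewrite ler_norml cos_geN1 cos_le1.
have s1 : `|sin (2 * pi * xi * z)| <= 1 by rewrite ler_norml sin_geN1 sin_le1.
apply: (@le_trans _ _ (1 * 1 + 1 * 1)); last by rewrite !mulr1.
by apply: lerD; apply: ler_pM.
Qed.

Lemma wave_derive s xi (z : R) : is_derive z 1 (wave s xi)
  (- (2 * pi * xi) * (sin (2 * pi * xi * z) * (tp_factor s xi).1 + cos (2 * pi * xi * z) * (tp_factor s xi).2)).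
Proof. by apply: is_derive_eq; rewrite /GRing.scale /=; ring. Qed.

Lemma wave_cts_bounded s xi : cts_bounded (wave s xi) 2.
Proof. by split; [exact: is_derive_continuous (wave_derive s xi)|exact: wave_bound]. Qed.

(** The complex wave is an eigenfunction of the relaxation; its real part is
checked on the differential equation of [relax_ode]. *)
Lemma relax_wave del s xi y : relax del (wave s xi) y = wave (del :: s) xi y.
Proof.
apply: (@relax_ode R del (wave (del :: s) xi) (wave s xi) 2 2 y (wave_cts_bounded s xi)) => [z|z]; first exact: wave_bound.
exists (- (2 * pi * xi) * (sin (2 * pi * xi * z) * (tp_factor (del :: s) xi).1 + cos (2 * pi * xi * z) * (tp_factor (del :: s) xi).2)).
  exact: wave_derive.
rewrite /wave /=; set x := 2 * pi * del * xi.
have x0 : 1 + x ^+ 2 != 0 by rewrite gt_eqF// onex2_gt0.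
have -> : del * (- (2 * pi * xi) * (sin (2 * pi * xi * z) * (((tp_factor s xi).1 + x * (tp_factor s xi).2) / (1 + x ^+ 2)) +
    cos (2 * pi * xi * z) * (((tp_factor s xi).2 - x * (tp_factor s xi).1) / (1 + x ^+ 2)))) =
  - x * (sin (2 * pi * xi * z) * (((tp_factor s xi).1 + x * (tp_factor s xi).2) / (1 + x ^+ 2)) +
    cos (2 * pi * xi * z) * (((tp_factor s xi).2 - x * (tp_factor s xi).1) / (1 + x ^+ 2))).
  by rewrite /x; ring.
by field.
Qed.

Lemma relaxE del v y : relax del v y = \int[mu]_s (exponential_pdf 1 s * v (y - del * s)).
Proof.
rewrite /relax Rintegral_mkcond; apply: eq_Rintegral => s _.
by rewrite -exp_pdfE !patchE; case: ifP => // _; rewrite mul0r.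
Qed.

(** The inverse Fourier transform of a Gaussian times the product of the
factors. *)
Definition packet (s : seq R) (sg y : R) :=
  \int[mu]_xi (expR (- (sg * xi ^+ 2)) * wave s xi y).

Lemma relax_packet del s sg : 0 < sg -> relax del (packet s sg) = packet (del :: s) sg.
Proof.
move=> sg0; apply/funext => y; rewrite relaxE.
rewrite (@Fubini_kernel R _ _ (fun x xi => wave s xi (y - del * x)) 2).
- apply: eq_Rintegral => xi _; congr (_ * _).
  by rewrite -relaxE relax_wave.
- exact: integrable_exponential_pdf.
- exact: (gauss_integral sg0).1.
- have [m1 m2] := tp_factor_measurable s.
  have mz : measurable_fun [set: T * T] (fun z : T * T => 2 * pi * z.2 * (y - del * z.1)).
    apply: measurable_funM; first by apply: measurable_funM => //; exact: measurable_snd.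
    by apply: measurable_funB => //; apply: measurable_funM => //; exact: measurable_fst.
  apply: measurable_funB; apply: measurable_funM.
  + apply: (measurableT_comp _ mz); apply: continuous_measurable_fun; exact: continuous_cos.
  + exact: (measurableT_comp m1 measurable_snd).
  + apply: (measurableT_comp _ mz); apply: continuous_measurable_fun; exact: continuous_sin.
  + exact: (measurableT_comp m2 measurable_snd).
- by move=> x xi; exact: wave_bound.
Qed.

Definition relaxs (s : seq R) (v : R -> R) := foldr relax v s.

(** The probability density with Fourier transform [exp(- sg xi^2)]. *)
Definition heat (sg z : R) := Num.sqrt (pi / sg) * expR (- (pi ^+ 2 / sg * z ^+ 2)).

(** Each relaxation passes under the integral over the frequencies, and without
factors the packet is the Fourier transform of a Gaussian. *)
Lemma packetE s sg : 0 < sg -> packet s sg = relaxs s (heat sg).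
Proof.
move=> sg0; elim: s => [|del s IH]; last by rewrite /= -IH relax_packet.
apply/funext => y; rewrite /packet /wave /= /heat.
transitivity (\int[mu]_xi (expR (- (sg * xi ^+ 2)) * cos (2 * pi * y * xi))).
  by apply: eq_Rintegral => xi _; rewrite mulr1 mulr0 subr0; congr (_ * cos _); ring.
rewrite gauss_fourier//; congr (_ * expR _); field; by rewrite gt_eqF.
Qed.
End multiplier.

(** * Regularity of Gaussian series *)

Section gauss_series.
Context {R : realType}.
Implicit Types (c : int -> R).

Definition gauss_series c (p x : R) := limn (window_sum (gauss_term p c x)).

Lemma ler_window_sum (u v : int -> R) n : (forall k, u k <= v k) -> window_sum u n <= window_sum v n.
Proof. by move=> uv; apply: ler_sum => j _; rewrite lerD. Qed.

Lemma window_sumD (u v : int -> R) n : window_sum (fun k => u k + v k) n = window_sum u n + window_sum v n.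
Proof. by rewrite /window_sum -big_split /=; apply: eq_bigr => j _; ring. Qed.

Lemma window_sumZ (x : R) (u : int -> R) n : window_sum (fun k => x * u k) n = x * window_sum u n.
Proof. by rewrite /window_sum mulr_sumr; apply: eq_bigr => j _; ring. Qed.

Lemma window_sum_norm (u : int -> R) n : `|window_sum u n| <= window_sum (fun k => `|u k|) n.
Proof.
apply: le_trans (ler_norm_sum _ _ _) _; apply: ler_sum => j _; exact: ler_normD.
Qed.

Lemma window_sum_gauss_bound (p : R) : 0 < p -> exists2 T : R, 0 < T &
  forall x n, window_sum (fun k => expR (- (p * (x - k%:~R) ^+ 2))) n <= T.
Proof.
move=> p0; have [T hT] := gauss_lattice_sum_bound p0.
have T0 : 0 <= T by have := hT 0 0%N; rewrite big_ord0.
exists (T + T + 1); first by rewrite ltr_wpDl// addr_ge0.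
move=> x n; rewrite /window_sum big_split /=.
have := hT (- x) n; have := hT (x + 1) n.
under [in X in _ -> X -> _]eq_bigr do rewrite -sqrrN opprD opprK.
have -> : \sum_(i < n) expR (- (p * (x - (-1 - i%:Z)%:~R) ^+ 2)) =
   \sum_(j < n) expR (- (p * (x + 1 + j%:R) ^+ 2)).
  by apply: eq_bigr => j _; rewrite intrB -pmulrn; congr expR; ring.
have -> : \sum_(i < n) expR (- (p * (x - (i%:Z)%:~R) ^+ 2)) =
   \sum_(j < n) expR (- (p * (x - j%:R) ^+ 2)).
  by apply: eq_bigr => j _; rewrite -pmulrn.
lra.
Qed.

Lemma gauss_series_cvg c (B p x : R) : 0 < p -> (forall k, `|c k| <= B) ->
  window_sum (gauss_term p c x) @ \oo --> gauss_series c p x.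
Proof.
move=> p0 cB; have B0 : 0 <= B by apply: le_trans (cB 0).
have [j|l hl _] := @geometric_dominated_cvg R (fun j => gauss_term p c x j%:Z + gauss_term p c x (- 1 - j%:Z))
    (B * expR (p * (x + 1 / 4)) + B * expR (p * (1 / 4 - x - 1))) p p0.
  have h (k : int) (z : R) : p * (x - k%:~R) ^+ 2 >= p * j%:R - p * z ->
      `|gauss_term p c x k| <= B * expR (p * z) * expR (- (p * j%:R)).
    move=> h; rewrite /gauss_term normrM (ger0_norm (expR_ge0 _)) -mulrA -expRD ler_pM ?expR_ge0//.
    by rewrite ler_expR; lra.
  apply: le_trans (ler_normD _ _) _; rewrite mulrDl lerD// h//.
    rewrite -mulrBr ler_pM2l// -pmulrn.
    have := sqr_ge0 (j%:R - x - 1 / 2); nra.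
  rewrite -mulrBr ler_pM2l// intrB -pmulrn.
  have := sqr_ge0 (j%:R + x + 1 / 2); nra.
rewrite /gauss_series; have hl' : window_sum (gauss_term p c x) @ \oo --> l by [].
by rewrite (cvg_lim (@Rhausdorff R) hl').
Qed.

Lemma window_sum_lim_dist (u v : int -> R) (l l' E : R) : window_sum u @ \oo --> l -> window_sum v @ \oo --> l' ->
  (forall n, window_sum (fun k => `|u k - v k|) n <= E) -> `|l - l'| <= E.
Proof.
move=> ul vl h.
have cn : (fun n => `|window_sum u n - window_sum v n|) @ \oo --> `|l - l'|.
  by apply: cvg_norm; exact: cvgB.
rewrite -(cvg_lim (@Rhausdorff R) cn).
apply: limr_le; first exact: (cvgP _ cn).
apply: nearW => n; apply: le_trans (h n).
have -> : window_sum u n - window_sum v n = window_sum (fun k => u k - v k) n.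
  by rewrite window_sumD; congr (_ + _); rewrite -mulN1r -window_sumZ; apply: eq_bigr => j _; rewrite !mulN1r.
exact: window_sum_norm.
Qed.

Lemma gauss_series_bound c (B p : R) : 0 < p -> (forall k, `|c k| <= B) ->
  exists T, forall x, `|gauss_series c p x| <= T.
Proof.
move=> p0 cB; have B0 : 0 <= B by apply: le_trans (cB 0).
have [T T0 hT] := window_sum_gauss_bound p0.
exists (B * T) => x; rewrite -[gauss_series _ _ _]subr0.
have z0 : window_sum (fun=> 0 : R) @ \oo --> (0 : R).
  have -> : window_sum (fun=> 0 : R) = fun=> 0.
    by apply/funext => n; rewrite /window_sum big1// => i _; rewrite addr0.
  exact: cvg_cst.
apply: (window_sum_lim_dist (gauss_series_cvg (x := x) p0 cB) z0) => n.
apply: le_trans (_ : B * window_sum (fun k => expR (- (p * (x - k%:~R) ^+ 2))) n <= _).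
  rewrite -window_sumZ; apply: ler_window_sum => k.
  by rewrite subr0 /gauss_term normrM (ger0_norm (expR_ge0 _)) ler_wpM2r ?expR_ge0.
by rewrite ler_wpM2l.
Qed.

Lemma expRN_dist (A A' : R) : `|expR (- A) - expR (- A')| <= `|A - A'| * (expR (- A) + expR (- A')).
Proof.
wlog h : A A' / A <= A'.
  move=> H; have [/H//|/ltW/H] := leP A A'.
  by rewrite distrC (distrC A') [expR (- A') + _]addrC.
rewrite ger0_norm ?subr_ge0 ?ler_expR ?lerN2// distrC ger0_norm ?subr_ge0//.
have E : expR (- A') = expR (- A) * expR (A - A') by rewrite -expRD; congr expR; ring.
have h1 : expR (- A) * (1 + (A - A')) <= expR (- A').
  by rewrite E ler_wpM2l ?expR_ge0// expR_ge1Dx.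
have h2 : 0 <= (A' - A) * expR (- A') by rewrite mulr_ge0 ?expR_ge0// subr_ge0.
by move: h1 h2; set e := expR (- A); set e' := expR (- A'); lra.
Qed.

Lemma sqr_gauss (q z : R) : 0 < q -> z ^+ 2 * expR (- (q * z ^+ 2)) <= (2 / q) * expR (- (q / 2 * z ^+ 2)).
Proof.
move=> q0; have -> : - (q * z ^+ 2) = - (q / 2 * z ^+ 2) - (q / 2 * z ^+ 2) by field.
rewrite expRD mulrA ler_wpM2r ?expR_ge0// expRN ler_pdivrMr ?expR_gt0//.
have := expR_ge1Dx (q / 2 * z ^+ 2) => h.
apply: (@le_trans _ _ (2 / q * (q / 2 * z ^+ 2))); last first.
  by rewrite ler_pM2l ?divr_gt0//; lra.
by rewrite le_eqVlt; apply/orP; left; apply/eqP; field; rewrite gt_eqF.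
Qed.

(** Uniformity in [x] lets the width of the Gaussians vary under the relaxation
operators, which are contractions for the supremum norm. *)
Lemma gauss_series_lipschitz_width c (B q : R) : 0 < q -> (forall k, `|c k| <= B) ->
  exists L, forall p x, q / 2 <= p -> `|gauss_series c p x - gauss_series c q x| <= L * `|p - q|.
Proof.
move=> q0 cB; have B0 : 0 <= B by apply: le_trans (cB 0).
have q2 : 0 < q / 2 by rewrite divr_gt0.
have [T T0 hT] := window_sum_gauss_bound (divr_gt0 q2 (ltr0Sn R 1)).
pose C := 2 * (2 / (q / 2)); have C0 : 0 <= C by rewrite !mulr_ge0// ltW// invr_gt0.
exists (B * C * T) => p x qp.
have p0 : 0 < p by exact: lt_le_trans qp.
apply: (window_sum_lim_dist (gauss_series_cvg (x := x) p0 cB) (gauss_series_cvg (x := x) q0 cB)) => n.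
apply: le_trans (_ : `|p - q| * (B * C) *
   window_sum (fun k => expR (- (q / 2 / 2 * (x - k%:~R) ^+ 2))) n <= _); last first.
  have -> : B * C * T * `|p - q| = `|p - q| * (B * C) * T by ring.
  by rewrite ler_wpM2l ?hT// mulr_ge0// mulr_ge0.
rewrite -window_sumZ; apply: ler_window_sum => k; rewrite /gauss_term -mulrBr normrM.
set z := x - k%:~R; set e := expR (- (q / 2 / 2 * _)).
have -> : `|p - q| * (B * C) * e = B * (`|p - q| * (C * e)) by ring.
apply: ler_pM => //.
apply: le_trans (expRN_dist _ _) _; rewrite -mulrBl normrM (ger0_norm (sqr_ge0 z)).
have h1 : expR (- (p * z ^+ 2)) <= expR (- (q / 2 * z ^+ 2)).
  by rewrite ler_expR lerN2 ler_wpM2r ?sqr_ge0.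
have h2 : expR (- (q * z ^+ 2)) <= expR (- (q / 2 * z ^+ 2)).
  by rewrite ler_expR lerN2 ler_wpM2r ?sqr_ge0//; lra.
have h3 := sqr_gauss z q2; rewrite -/e in h3.
rewrite -[leLHS]mulrA ler_wpM2l//.
apply: (@le_trans _ _ (2 * (z ^+ 2 * expR (- (q / 2 * z ^+ 2))))).
  by rewrite [leRHS]mulrCA ler_wpM2l ?sqr_ge0//; lra.
by rewrite /C -[leRHS]mulrA ler_pM2l.
Qed.

Lemma gauss_series_continuous c (B p : R) : 0 < p -> (forall k, `|c k| <= B) -> continuous (gauss_series c p).
Proof.
move=> p0 cB; have B0 : 0 <= B by apply: le_trans (cB 0).
have p2 : 0 < p / 2 by rewrite divr_gt0.
have [T T0 hT] := window_sum_gauss_bound p2.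
pose C := 2 + 2 / p; have C0 : 0 < C by rewrite ltr_wpDr// divr_ge0// ltW.
pose L := B * (p * C) * (T + T).
have BpC0 : 0 <= B * (p * C) by apply: mulr_ge0 => //; apply: mulr_ge0; exact: ltW.
have L0 : 0 <= L by apply: mulr_ge0 => //; apply: addr_ge0; exact: ltW.
have lip (x y : R) : `|x - y| <= 1 -> `|gauss_series c p x - gauss_series c p y| <= L * `|x - y|.
  move=> xy1; apply: (window_sum_lim_dist (gauss_series_cvg (x := x) p0 cB) (gauss_series_cvg (x := y) p0 cB)) => n.
  apply: le_trans (_ : `|x - y| * (B * (p * C)) *
     window_sum (fun k => expR (- (p / 2 * (x - k%:~R) ^+ 2)) + expR (- (p / 2 * (y - k%:~R) ^+ 2))) n <= _); last first.
    have -> : L * `|x - y| = `|x - y| * (B * (p * C)) * (T + T) by rewrite /L; ring.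
    by rewrite window_sumD ler_wpM2l ?lerD ?hT// mulr_ge0.
  rewrite -window_sumZ; apply: ler_window_sum => k; rewrite /gauss_term -mulrBr normrM.
  set u := x - k%:~R; set v := y - k%:~R.
  set e := expR (- (p / 2 * u ^+ 2)); set e' := expR (- (p / 2 * v ^+ 2)).
  have -> : `|x - y| * (B * (p * C)) * (e + e') = B * (`|x - y| * (p * C) * (e + e')) by ring.
  apply: ler_pM => //.
  apply: le_trans (expRN_dist _ _) _.
  have uv : x - y = u - v by rewrite /u /v; ring.
  rewrite uv in xy1 *.
  have half (w : R) : (2 * `|w| + 1) * expR (- (p * w ^+ 2)) <= C * expR (- (p / 2 * w ^+ 2)).
    have -> : - (p * w ^+ 2) = - (p / 2 * w ^+ 2) - (p / 2 * w ^+ 2) by field.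
    rewrite expRD mulrA ler_wpM2r ?expR_ge0// expRN ler_pdivrMr ?expR_gt0//.
    apply: (@le_trans _ _ (C * (1 + p / 2 * w ^+ 2))); last by rewrite ler_pM2l// expR_ge1Dx.
    have -> : C * (1 + p / 2 * w ^+ 2) = 2 + w ^+ 2 + 2 / p + p * w ^+ 2.
      by rewrite /C; field; rewrite gt_eqF.
    have : 0 <= 2 / p by rewrite divr_ge0// ltW.
    have : 0 <= p * w ^+ 2 by rewrite mulr_ge0 ?sqr_ge0// ltW.
    rewrite -[w ^+ 2]real_normK ?num_real//; have := sqr_ge0 (`|w| - 1); nra.
  have := half u; have := half v; rewrite -/e -/e'.
  rewrite -mulrBr normrM (gtr0_norm p0) subr_sqr normrM.
  set E := expR (- (p * u ^+ 2)); set E' := expR (- (p * v ^+ 2)) => h1 h2.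
  have E0 : 0 <= E by exact: expR_ge0.
  have E'0 : 0 <= E' by exact: expR_ge0.
  have g1 : `|u + v| <= 2 * `|u| + 1.
    have -> : u + v = 2 * u - (u - v) by ring.
    apply: le_trans (ler_normB _ _) _; rewrite normrM (ger0_norm (_ : 0 <= 2))// lerD//.
  have g2 : `|u + v| <= 2 * `|v| + 1.
    have -> : u + v = 2 * v + (u - v) by ring.
    apply: le_trans (ler_normD _ _) _; rewrite normrM (ger0_norm (_ : 0 <= 2))// lerD//.
  have -> : p * (`|u - v| * `|u + v|) * (E + E') = p * `|u - v| * (`|u + v| * E + `|u + v| * E') by ring.
  have -> : `|u - v| * (p * C) * (e + e') = p * `|u - v| * (C * e + C * e') by ring.
  rewrite ler_wpM2l ?mulr_ge0 ?(ltW p0)// lerD//.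
    by apply: le_trans h2; rewrite ler_wpM2r.
  by apply: le_trans h1; rewrite ler_wpM2r.
move=> x; apply/cvgrPdist_le => e e0; near=> y.
apply: le_trans (lip _ _ _) _; first by near: y; apply: cvgr_dist_le.
have : `|x - y| <= e / (L + 1) by near: y; apply: cvgr_dist_le => //; rewrite divr_gt0// ltr_wpDl.
rewrite ler_pdivlMr ?ltr_wpDl//; have := normr_ge0 (x - y); nra.
Unshelve. all: by end_near. Qed.

End gauss_series.

(** * Functions of the space as relaxed Gaussian series *)

Section relaxs_of_heat_averages.
Context {R : realType}.
Notation mu := (@lebesgue_measure R).

Lemma relaxs_cts_bounded s v B : cts_bounded v B -> cts_bounded (relaxs s v : R -> R) B.
Proof. by move=> bv; elim: s => [//|d s IH]; exact: relax_cts_bounded. Qed.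

Lemma relaxs_dominated s (v_ : nat -> R -> R) v B y :
  (forall n, cts_bounded (v_ n) B) -> (forall x, v_ ^~ x @ \oo --> v x) ->
  (fun n => relaxs s (v_ n) y) @ \oo --> relaxs s v y.
Proof.
move=> bv vv; elim: s y => [|d s IH] y /=; first exact: vv.
by apply: (@relax_dominated _ d (fun n => relaxs s (v_ n)) _ B) => // n; exact: relaxs_cts_bounded.
Qed.

Lemma relaxs_lin s (v w : R -> R) B B' (a b : R) y : cts_bounded v B -> cts_bounded w B' ->
  relaxs s (fun x => a * v x + b * w x) y = a * relaxs s v y + b * relaxs s w y.
Proof.
move=> bv bw; elim: s y => [//|d s IH] y /=.
have -> : relaxs s (fun x => a * v x + b * w x) =
    (fun x => a * relaxs s v x + b * relaxs s w x) by exact/funext.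
exact: (relax_lin d a b y (relaxs_cts_bounded s bv) (relaxs_cts_bounded s bw)).
Qed.

Lemma relaxs_scale s (v : R -> R) B (a : R) y : cts_bounded v B ->
  relaxs s (fun x => a * v x) y = a * relaxs s v y.
Proof.
move=> bv; have := relaxs_lin s a 0 y bv bv; rewrite mul0r addr0 => <-.
by congr (relaxs s _ y); apply/funext => x; rewrite mul0r addr0.
Qed.

Lemma relaxs_shift s (v : R -> R) (k y : R) :
  relaxs s (fun x => v (x - k)) y = relaxs s v (y - k).
Proof.
elim: s y => [//|d s IH] y /=.
have -> : relaxs s (fun x => v (x - k)) = (fun x => relaxs s v (x - k)) by exact/funext.
by apply: eq_Rintegral => z _; congr (_ * relaxs s v _); ring.
Qed.

Lemma cts_bounded_dist (v w : R -> R) B B' E : cts_bounded v B -> cts_bounded w B' ->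
  (forall x, `|v x - w x| <= E) -> cts_bounded (fun x => v x - w x) E.
Proof. by move=> [cv _] [cw _] h; split => // x; apply: cvgB; [exact: cv|exact: cw]. Qed.

Lemma relaxs_lip s (v w : R -> R) B B' E y : cts_bounded v B -> cts_bounded w B' ->
  (forall x, `|v x - w x| <= E) -> `|relaxs s v y - relaxs s w y| <= E.
Proof.
move=> bv bw h; have bd := cts_bounded_dist bv bw h.
have := relaxs_lin s 1 (-1) y bv bw; rewrite mul1r mulN1r => <-.
have -> : (fun x => 1 * v x + -1 * w x) = (fun x => v x - w x).
  by apply/funext => x; rewrite mul1r mulN1r.
exact: (relaxs_cts_bounded s bd).2.
Qed.

Lemma cts_bounded_lin (v w : R -> R) B B' a b : cts_bounded v B -> cts_bounded w B' ->
  cts_bounded (fun x => a * v x + b * w x) (`|a| * B + `|b| * B').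
Proof.
move=> [cv hv] [cw hw]; split => x.
  by apply: cvgD; apply: cvgMl_tmp; [exact: cv|exact: cw].
by apply: le_trans (ler_normD _ _) _; rewrite !normrM lerD// ler_wpM2l.
Qed.

Lemma cts_bounded_shift (v : R -> R) B k : cts_bounded v B -> cts_bounded (fun x => v (x - k)) B.
Proof.
move=> [cv hv]; split => // x.
apply: (continuous_comp (f := fun x : R => x - k)); last exact: cv.
by apply: cvgB; [exact: cvg_id|exact: cvg_cst].
Qed.

Lemma cts_bounded_window_sum (v : R -> R) B (c : int -> R) n : cts_bounded v B ->
  exists B', cts_bounded (fun x => window_sum (fun k => c k * v (x - k%:~R)) n) B'.
Proof.
move=> bv; elim: n => [|n [B' IH]].
  exists 0; split => x; last by rewrite /window_sum big_ord0 normr0.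
  have -> : (fun x => window_sum (fun k => c k * v (x - k%:~R)) 0) = fun=> 0.
    by apply/funext => z; rewrite /window_sum big_ord0.
  exact: cvg_cst.
have h := cts_bounded_lin 1 1 IH (cts_bounded_lin (c n%:Z) (c (-1 - n%:Z)) (cts_bounded_shift (n%:Z)%:~R bv) (cts_bounded_shift (-1 - n%:Z)%:~R bv)).
eexists; move: h; congr (cts_bounded _ _).
by apply/funext => x; rewrite /window_sum big_ord_recr /= !mul1r.
Qed.

Lemma relaxs_window_sum s (v : R -> R) B (c : int -> R) n y : cts_bounded v B ->
  relaxs s (fun x => window_sum (fun k => c k * v (x - k%:~R)) n) y =
  window_sum (fun k => c k * relaxs s v (y - k%:~R)) n.
Proof.
move=> bv; elim: n => [|n IH].
  rewrite /window_sum big_ord0.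
  have -> : (fun x => \sum_(j < 0) (c j * v (x - j%:~R) + c (-1 - j%:Z) * v (x - (-1 - j%:Z)%:~R)))
      = (fun x => 0 * v x) by apply/funext => x; rewrite big_ord0 mul0r.
  by rewrite (relaxs_scale s 0 y bv) mul0r.
have [B' bw] := cts_bounded_window_sum c n bv.
have b1 := cts_bounded_shift (n%:Z)%:~R bv; have b2 := cts_bounded_shift (-1 - n%:Z)%:~R bv.
have b3 := cts_bounded_lin (c n%:Z) (c (-1 - n%:Z)) b1 b2.
have -> : (fun x => window_sum (fun k => c k * v (x - k%:~R)) n.+1) =
  (fun x => 1 * window_sum (fun k => c k * v (x - k%:~R)) n +
   1 * (c n%:Z * v (x - (n%:Z)%:~R) + c (-1 - n%:Z) * v (x - (-1 - n%:Z)%:~R))).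
  by apply/funext => x; rewrite /window_sum big_ord_recr /= !mul1r.
rewrite (relaxs_lin s 1 1 y bw b3) (relaxs_lin s _ _ y b1 b2) !relaxs_shift IH !mul1r.
by rewrite [RHS]/window_sum big_ord_recr.
Qed.

Lemma heat_ge0 (sg z : R) : 0 <= heat sg z.
Proof. by rewrite mulr_ge0 ?expR_ge0// sqrtr_ge0. Qed.

Lemma heat_continuous (sg : R) : continuous (heat sg).
Proof.
apply: (@is_derive_continuous _ _ (fun z => Num.sqrt (pi / sg) * (expR (- (pi ^+ 2 / sg * z ^+ 2)) * - (pi ^+ 2 / sg * (2 * z))))) => z.
by apply: is_derive_eq; rewrite /GRing.scale /=; ring.
Qed.

Lemma heat_cts_bounded (sg : R) : 0 < sg -> cts_bounded (heat sg) (Num.sqrt (pi / sg)).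
Proof.
move=> sg0; split; first exact: heat_continuous.
move=> x; rewrite ger0_norm ?heat_ge0// ler_piMr ?sqrtr_ge0//.
rewrite -[leRHS]expR0 ler_expR oppr_le0 mulr_ge0 ?sqr_ge0//.
by rewrite divr_ge0 ?sqr_ge0// ltW.
Qed.

Lemma heat_integral (sg : R) : 0 < sg ->
  mu.-integrable setT (EFin \o heat sg) /\ \int[mu]_x heat sg x = 1.
Proof.
move=> sg0; have pi0 := pi_gt0 R.
have [i e] := gauss_integral (divr_gt0 (exprn_gt0 2 pi0) sg0).
split; first exact: (integrableZl measurableT (Num.sqrt (pi / sg)) i).
rewrite /heat RintegralZl// e -sqrtrM ?divr_ge0 ?(ltW pi0) ?(ltW sg0)//.
rewrite (_ : _ * _ = 1) ?sqrtr1//; move: (pi : R) pi0 => p p0; field.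
by rewrite !gt_eqF.
Qed.

Lemma heat_scale (sg s z : R) : 0 < sg -> 0 < s ->
  heat (sg * s ^+ 2) (s * z) * s = heat sg z.
Proof.
move=> sg0 s0; rewrite /heat mulrAC; congr (_ * expR _); last by field; rewrite !gt_eqF.
have -> : pi / (sg * s ^+ 2) = pi / sg * s ^- 2 by field; rewrite !gt_eqF.
rewrite sqrtrM ?divr_ge0 ?pi_ge0 ?(ltW sg0)// -exprVn sqrtr_sqr ger0_norm ?invr_ge0 ?(ltW s0)//.
by rewrite -mulrA mulVf ?mulr1// gt_eqF.
Qed.

(** Rescaling moves the width of the kernel into the argument of [v], where dominated
convergence applies. *)
Lemma heat_approx (v : R -> R) B y : cts_bounded v B ->
  (fun n : nat => \int[mu]_x (v x * heat (n.+1%:R^-1 ^+ 2) (x - y))) @ \oo --> v y.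
Proof.
move=> [cv vB].
have e n : \int[mu]_x (v x * heat (n.+1%:R^-1 ^+ 2) (x - y)) =
    \int[mu]_x (heat 1 x * v (n.+1%:R^-1 * x + y)).
  have s0 : 0 < n.+1%:R^-1 :> R by rewrite invr_gt0.
  rewrite /Rintegral (@integral_affine R (fun x => v x * heat (n.+1%:R^-1 ^+ 2) (x - y)) n.+1%:R^-1 y s0).
    congr fine; apply: eq_integral => x _; congr (_%:E).
    by rewrite addrK -(heat_scale x ltr01 s0) mul1r; ring.
  move=> x; apply: cvgM; first exact: cv.
  have := cts_bounded_shift y (heat_cts_bounded (exprn_gt0 2 s0)); move=> [+ _]; exact.
under eq_fun do rewrite e.
have [ih h1] := heat_integral ltr01.
have <- : \int[mu]_x (heat 1 x * v y) = v y by rewrite RintegralZr// h1 mul1r.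
apply: (@Rintegral_dominated_cvg _ _ R mu setT (fun n x => heat 1 x * v (n.+1%:R^-1 * x + y))
  (fun x => heat 1 x * v y) (fun x => heat 1 x * B)) => //.
- move=> n; apply: measurable_funM; apply: continuous_measurable_fun; first exact: heat_continuous.
  exact: continuous_affine.
- move=> x _; apply: cvgMl_tmp.
  apply: (cvg_comp (fun n : nat => n.+1%:R^-1 * x + y) v); last exact: cv.
  have h : (fun n : nat => n.+1%:R^-1 * x + y) @ \oo --> (0 * x + y).
    by apply: cvgD; [apply: cvgMr_tmp; exact: cvg_harmonic|exact: cvg_cst].
  by rewrite mul0r add0r in h.
- have B0 : 0 <= B by apply: le_trans (vB 0).
  by apply: (@integrable_bounded_mul _ _ _ mu setT (heat 1) (fun=> B) B) => // x _; rewrite ger0_norm.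
- by move=> n x _; rewrite normrM (ger0_norm (heat_ge0 _ _)) ler_wpM2l// heat_ge0.
Qed.

(** If all averages of [u] against heat kernels of width [eps] are the
expected superpositions of packets with parameter [gam + eps], then these averages
are relaxed Gaussian series of parameter [gam + eps]. Both sides converge as
[eps] tends to 0, the left one to [u y]. *)
Lemma relaxs_of_heat_averages (u : R -> R) (Bu B C0 gam : R) (c : int -> R) (ds : seq R) :
  cts_bounded u Bu -> (forall k, `|c k| <= B) -> 0 < gam ->
  (forall (eps : R) y, 0 < eps ->
    window_sum (fun k => c k * (C0 * packet ds (gam + eps) (y - k%:~R))) @ \oo -->
    \int[mu]_x (u x * heat eps (x - y))) ->
  forall y, u y = relaxs ds (fun x => C0 * Num.sqrt (pi / gam) * gauss_series c (pi ^+ 2 / gam) x) y.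
Proof.
move=> bu cB gam0 hyp y; have B0 : 0 <= B by apply: le_trans (cB 0).
have pi0 := pi_gt0 R.
pose q := pi ^+ 2 / gam; have q0 : 0 < q by rewrite divr_gt0// exprn_gt0.
pose V sg x := C0 * Num.sqrt (pi / sg) * gauss_series c (pi ^+ 2 / sg) x.
have bV sg : 0 < sg -> exists B', cts_bounded (V sg) B'.
  move=> sg0; have p0 : 0 < pi ^+ 2 / sg by rewrite divr_gt0// exprn_gt0.
  have [T hT] := gauss_series_bound p0 cB.
  exists (`|C0 * Num.sqrt (pi / sg)| * T); split.
    by move=> x; apply: cvgMl_tmp; exact: gauss_series_continuous.
  by move=> x; rewrite normrM ler_wpM2l.
have key eps : 0 < eps -> \int[mu]_x (u x * heat eps (x - y)) = relaxs ds (V (gam + eps)) y.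
  move=> e0; have sg0 : 0 < gam + eps by rewrite addr_gt0.
  have := hyp eps y e0; rewrite packetE//.
  set sg := gam + eps in sg0 *; have p0 : 0 < pi ^+ 2 / sg by rewrite divr_gt0// exprn_gt0.
  pose W n x := C0 * Num.sqrt (pi / sg) * window_sum (gauss_term (pi ^+ 2 / sg) c x) n.
  have WE n : W n = (fun x => window_sum (fun k => (C0 * c k) * heat sg (x - k%:~R)) n).
    apply/funext => x; rewrite /W -window_sumZ; apply: eq_bigr => j _.
    by rewrite /gauss_term /heat; ring.
  have [T T0 hT] := window_sum_gauss_bound p0.
  have bW n : cts_bounded (W n) (`|C0 * Num.sqrt (pi / sg)| * (B * T)).
    split.
      by rewrite WE; have [B' []] := cts_bounded_window_sum (fun k => C0 * c k) n (heat_cts_bounded sg0).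
    move=> x; rewrite /W normrM ler_wpM2l//; apply: le_trans (window_sum_norm _ _) _.
    apply: le_trans (_ : B * window_sum (fun k => expR (- (pi ^+ 2 / sg * (x - k%:~R) ^+ 2))) n <= _).
      rewrite -window_sumZ; apply: ler_window_sum => k.
      by rewrite /gauss_term normrM (ger0_norm (expR_ge0 _)) ler_wpM2r ?expR_ge0.
    by rewrite ler_wpM2l.
  have WV x : W ^~ x @ \oo --> V sg x by apply: cvgMl_tmp; exact: gauss_series_cvg p0 cB.
  have h2 := relaxs_dominated (s := ds) (y := y) bW WV.
  have e : (fun n => relaxs ds (W n) y) =
      window_sum (fun k => c k * (C0 * relaxs ds (heat sg) (y - k%:~R))).
    apply/funext => n; rewrite WE (relaxs_window_sum ds _ n y (heat_cts_bounded sg0)).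
    by apply: eq_bigr => j _; ring.
  rewrite e in h2 => h1.
  exact: (@cvg_unique _ (@Rhausdorff R) _ _ _ _ h1 h2).
pose s2 n : R := n.+1%:R^-1 ^+ 2.
have s20 n : 0 < s2 n by rewrite exprn_gt0// invr_gt0.
have h1 : (fun n => relaxs ds (V (gam + s2 n)) y) @ \oo --> u y.
  by under eq_fun do rewrite -key//; exact: heat_approx bu.
have s2cvg : s2 @ \oo --> (0 : R).
  have h : harmonic @ \oo --> (0 : R) by exact: cvg_harmonic.
  have h2 : (fun n => harmonic n * harmonic n) @ \oo --> (0 * 0 : R) by exact: cvgM.
  by rewrite mulr0 in h2.
have sgcvg : (fun n => gam + s2 n) @ \oo --> gam.
  have h : (fun n => gam + s2 n) @ \oo --> gam + 0 by apply: cvgD => //; exact: cvg_cst.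
  by rewrite addr0 in h.
have icvg : (fun n => (gam + s2 n)^-1) @ \oo --> gam^-1 by apply: cvgV => //; rewrite gt_eqF.
have [L hL] := gauss_series_lipschitz_width q0 cB.
have [T hT] := gauss_series_bound q0 cB.
pose E n := `|C0| * (Num.sqrt (pi / (gam + s2 n)) * (L * `|pi ^+ 2 / (gam + s2 n) - q|) +
   `|Num.sqrt (pi / (gam + s2 n)) - Num.sqrt (pi / gam)| * T).
have Ecvg : E @ \oo --> (0 : R).
  have c1 : (fun n => Num.sqrt (pi / (gam + s2 n))) @ \oo --> Num.sqrt (pi / gam).
    apply: (cvg_comp (fun n => pi / (gam + s2 n)) Num.sqrt); last exact: sqrt_continuous.
    exact: cvgMl_tmp.
  have c2 : (fun n => pi ^+ 2 / (gam + s2 n)) @ \oo --> q by exact: cvgMl_tmp.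
  have z : `|C0| * (Num.sqrt (pi / gam) * (L * `|q - q|) + `|Num.sqrt (pi / gam) - Num.sqrt (pi / gam)| * T) = 0.
    by rewrite !subrr normr0; ring.
  rewrite -z; apply: cvgMl_tmp; apply: cvgD.
    apply: cvgM => //; apply: cvgMl_tmp; apply: cvg_norm; apply: cvgB => //; exact: cvg_cst.
  apply: cvgMr_tmp; apply: cvg_norm; apply: cvgB => //; exact: cvg_cst.
have [BV bVg] := bV gam gam0.
have h2 : (fun n => relaxs ds (V (gam + s2 n)) y) @ \oo --> relaxs ds (V gam) y.
  apply/cvgrPdist_le => e e0.
  have : \forall n \near \oo, `|E n| <= e.
    by move/cvgrPdist_le : Ecvg => /(_ e e0); apply: filterS => n; rewrite sub0r normrN.
  have : \forall n \near \oo, gam + s2 n <= 2 * gam.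
    have /cvgrPdist_le /(_ gam gam0) := s2cvg; apply: filterS => n; rewrite sub0r normrN.
    by move=> /(le_trans (ler_norm _)); lra.
  apply: filterS2 => n hn /(le_trans (ler_norm _)); apply: le_trans.
  have sg0 : 0 < gam + s2 n by rewrite addr_gt0.
  have [B' bVn] := bV _ sg0.
  rewrite distrC; apply: (relaxs_lip ds y bVn bVg) => x.
  rewrite /V /E; have -> : C0 * Num.sqrt (pi / (gam + s2 n)) * gauss_series c (pi ^+ 2 / (gam + s2 n)) x -
      C0 * Num.sqrt (pi / gam) * gauss_series c (pi ^+ 2 / gam) x =
    C0 * (Num.sqrt (pi / (gam + s2 n)) * (gauss_series c (pi ^+ 2 / (gam + s2 n)) x - gauss_series c q x) +
     (Num.sqrt (pi / (gam + s2 n)) - Num.sqrt (pi / gam)) * gauss_series c q x) by rewrite /q; ring.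
  rewrite normrM ler_wpM2l//; apply: le_trans (ler_normD _ _) _; rewrite !normrM.
  apply: lerD; last by rewrite ler_wpM2l.
  rewrite (ger0_norm (sqrtr_ge0 _)) ler_wpM2l ?sqrtr_ge0//; apply: hL.
  rewrite /q -mulrA ler_wpM2l ?sqr_ge0//.
  rewrite -invfM lef_pV2 ?posrE// ?mulr_gt0//; lra.
exact: (@cvg_unique _ (@Rhausdorff R) _ _ _ _ h1 h2).
Qed.
End relaxs_of_heat_averages.

Section complex_side.
Context {R : realType}.
Notation mu := (@lebesgue_measure R).
Local Open Scope complex_scope.
Implicit Types (z : R[i]).
Local Notation Re := (@complex.Re R).
Local Notation Im := (@complex.Im R).

Lemma Re_scaler z (p : R) : Re (z * p%:C) = Re z * p.
Proof. by case: z => a b /=; rewrite mulr0 subr0. Qed.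

Lemma Im_scaler z (p : R) : Im (z * p%:C) = Im z * p.
Proof. by case: z => a b /=; rewrite mulr0 add0r. Qed.

Lemma Re_mul z w : Re (z * w) = Re z * Re w - Im z * Im w.
Proof. by case: z => a b; case: w. Qed.

Lemma Im_mul z w : Im (z * w) = Re z * Im w + Im z * Re w.
Proof. by case: z => a b; case: w. Qed.

Lemma Re_add z w : Re (z + w) = Re z + Re w.
Proof. by case: z => a b; case: w. Qed.

Lemma Im_add z w : Im (z + w) = Im z + Im w.
Proof. by case: z => a b; case: w. Qed.

Lemma Re_sub z w : Re (z - w) = Re z - Re w.
Proof. by case: z => a b; case: w. Qed.

Lemma Im_sub z w : Im (z - w) = Im z - Im w.
Proof. by case: z => a b; case: w. Qed.

Lemma normc_Re z : `|Re z| <= Normc.normc z.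
Proof. by case: z => a b /=; rewrite -sqrtr_sqr ler_wsqrtr// lerDl sqr_ge0. Qed.

Lemma normc_Im z : `|Im z| <= Normc.normc z.
Proof. by case: z => a b /=; rewrite -sqrtr_sqr ler_wsqrtr// lerDr sqr_ge0. Qed.

Lemma cvg_ReIm (T : Type) (F : set_system T) {FF : Filter F} (f : T -> R[i]) (l : R[i]) :
  (f : T -> R[i]^o) @ F --> (l : R[i]^o) ->
  (fun t => Re (f t)) @ F --> Re l /\ (fun t => Im (f t)) @ F --> Im l.
Proof.
move=> /cvgrPdist_lt h; split; apply/cvgrPdist_lt => e e0.
  have e0' : 0 < e%:C :> R[i] by rewrite ltcR.
  have := h _ e0'; apply: filterS => t.
  by rewrite -Re_sub normc_def ltcR => /(le_lt_trans _); apply; rewrite -sqrtr_sqr ler_wsqrtr// lerDl sqr_ge0.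
have e0' : 0 < e%:C :> R[i] by rewrite ltcR.
have := h _ e0'; apply: filterS => t.
by rewrite -Im_sub normc_def ltcR => /(le_lt_trans _); apply; rewrite -sqrtr_sqr ler_wsqrtr// lerDr sqr_ge0.
Qed.

Lemma continuous_ReIm (f : R -> R[i]) : continuous (f : R -> R[i]^o) ->
  continuous (fun x => Re (f x)) /\ continuous (fun x => Im (f x)).
Proof. by move=> cf; split => x; have [h1 h2] := cvg_ReIm (cf x). Qed.

Lemma measurable_normc (f : R -> R[i]) :
  measurable_fun setT (fun x => Re (f x)) -> measurable_fun setT (fun x => Im (f x)) ->
  measurable_fun setT (fun x => Normc.normc (f x)).
Proof.
move=> m1 m2.
have -> : (fun x => Normc.normc (f x)) = (fun x => Num.sqrt ((Re (f x)) ^+ 2 + (Im (f x)) ^+ 2)).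
  by apply/funext => x; case: (f x).
have ms : measurable_fun setT (fun x : R => Num.sqrt x).
  by apply: continuous_measurable_fun; exact: sqrt_continuous.
apply: (measurableT_comp ms); apply: measurable_funD; exact: measurable_funX.
Qed.

Lemma cLfun1_integrable (f : R -> R[i]) : cLfun 1%:E f ->
  mu.-integrable setT (EFin \o (fun x => Re (f x))) /\
  mu.-integrable setT (EFin \o (fun x => Im (f x))).
Proof.
move=> [m1 m2]; rewrite /finite_norm Lnorm1 => fin.
have mn := measurable_normc m1 m2.
have ni : mu.-integrable setT (EFin \o (fun x => Normc.normc (f x))).
  by apply/integrableP; split => //; exact/measurable_EFinP.
split; apply: (le_integrable measurableT _ _ ni).
- exact/measurable_EFinP.
- by move=> x _ /=; rewrite lee_fin (le_trans (normc_Re _))// ler_norm.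
- exact/measurable_EFinP.
- by move=> x _ /=; rewrite lee_fin (le_trans (normc_Im _))// ler_norm.
Qed.

Lemma cLfun1_real (p : R -> R) : measurable_fun setT p -> mu.-integrable setT (EFin \o p) ->
  cLfun 1%:E (fun x => (p x)%:C).
Proof.
move=> mp /integrableP[_ ip]; split => //; rewrite /finite_norm Lnorm1.
apply: le_lt_trans ip; rewrite le_eqVlt; apply/orP; left; apply/eqP.
by apply: eq_integral => x _ /=; rewrite expr0n/= addr0 sqrtr_sqr normr_id.
Qed.

(** A continuous function exceeding its essential supremum at a point would do
so on a ball, which has positive measure. *)
Lemma cLfun_oo_bounded (f : R -> R[i]) : cLfun +oo%E f -> continuous (f : R -> R[i]^o) ->
  exists B, cts_bounded (fun x => Re (f x)) B /\ cts_bounded (fun x => Im (f x)) B.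
Proof.
move=> [m1 m2]; rewrite /finite_norm unlock /=.
have muT : (0 < mu [set: measurableTypeR R])%E.
  apply: (@lt_le_trans _ _ (mu `[0%R, 1%R])); last by rewrite le_measure// inE.
  by rewrite lebesgue_measure_itv/= lte_fin ltr01 oppr0 adde0 lte_fin.
rewrite muT => fin cf; have [c1 c2] := continuous_ReIm cf.
have [B hB] : exists B : R, \forall x \ae mu, (`|(Normc.normc (f x))%:E| <= B%:E)%E.
  have h := @ess_sup_ge _ _ _ mu (abse \o (EFin \o (fun x => Normc.normc (f x)))).
  move: fin h; set E := ess_sup _ _ => fin h.
  case: E fin h => [r _ h|//|_ h]; first by exists r.
  exists 0; apply: filterS h => x; by rewrite leeNy_eq.
have [N [mN N0 hN]] := hB; exists B.
have ae_all (v : R -> R) : continuous v -> (forall y, `|v y| <= Normc.normc (f y)) ->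
    forall x, `|v x| <= B.
  move=> cv vf x; rewrite leNgt; apply/negP => Bx.
  have e0 : 0 < `|v x| - B by rewrite subr_gt0.
  have cn : `|v y| @[y --> x] --> `|v x| by apply: cvg_norm; exact: cv.
  move/cvgrPdist_lt : cn => /(_ _ e0) [d /= d0 hd].
  have sub : ball x d `<=` N.
    move=> y xy; apply: hN => /=; rewrite lee_fin => vy.
    have := hd y xy; move=> /(le_lt_trans (ler_norm _)).
    by have := le_trans (vf y) (le_trans (ler_norm _) vy); lra.
  have : (mu (ball x d) <= mu N)%E by rewrite le_measure// inE//; exact: measurable_ball.
  rewrite N0 lebesgue_measure_ball; last exact: ltW.
  by apply/negP; rewrite -ltNge lte_fin mulrn_wgt0.
by split; split => //; apply: ae_all => // y; [exact: normc_Re|exact: normc_Im].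
Qed.

Lemma prod_tp_factor (ds : seq R) (xi : R) :
  \prod_(d <- ds) (1 +i* (2 * pi * d * xi))^-1 = (tp_factor ds xi).1 +i* (tp_factor ds xi).2.
Proof.
elim: ds => [|d ds IH]; first by rewrite big_nil.
rewrite big_cons IH /=; set x := 2 * pi * d * xi.
set U := (tp_factor ds xi).1; set V := (tp_factor ds xi).2.
have x0 : 1 + x ^+ 2 != 0 by rewrite gt_eqF// onex2_gt0.
have nz : (1 +i* x : R[i]) != 0 by rewrite eq_complex /= oner_eq0.
apply: (mulfI nz); rewrite mulVKf//.
by apply/eqP; rewrite eq_complex /=; apply/andP; split; apply/eqP; field.
Qed.

Lemma continuous_sin_freq (w : R) : continuous (fun x : R => sin (w * x)).
Proof.
move=> x; apply: (continuous_comp (f := fun x : R => w * x)); last exact: continuous_sin.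
by apply: cvgMl_tmp; exact: cvg_id.
Qed.

Lemma integrable_trig (u : R -> R) (w : R) : mu.-integrable setT (EFin \o u) ->
  mu.-integrable setT (EFin \o (fun x => u x * cos (w * x))) /\
  mu.-integrable setT (EFin \o (fun x => u x * sin (w * x))).
Proof.
move=> iu; split; apply: (@integrable_bounded_mul _ _ _ mu setT u _ 1) => //.
- by apply: continuous_measurable_fun; exact: continuous_cos_freq.
- by move=> x _; rewrite ler_norml cos_geN1 cos_le1.
- by apply: continuous_measurable_fun; exact: continuous_sin_freq.
- by move=> x _; rewrite ler_norml sin_geN1 sin_le1.
Qed.

Lemma fourier_parts (g : R -> R[i]) (xi : R) : cLfun 1%:E g ->
  Re (fourier g xi) = \int[mu]_x (Re (g x) * cos (2 * pi * xi * x)) +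
     \int[mu]_x (Im (g x) * sin (2 * pi * xi * x)) /\
  Im (fourier g xi) = \int[mu]_x (Im (g x) * cos (2 * pi * xi * x)) -
     \int[mu]_x (Re (g x) * sin (2 * pi * xi * x)).
Proof.
move=> /cLfun1_integrable [i1 i2]; rewrite /fourier /cRintegral /=; split.
  rewrite -RintegralD//; [|exact: (integrable_trig _ i1).1|exact: (integrable_trig _ i2).2].
  apply: eq_Rintegral => x _; rewrite Re_mul /expi /= cosN sinN.
  have -> : 2 * pi * x * xi = 2 * pi * xi * x by ring.
  ring.
rewrite -RintegralB//; [|exact: (integrable_trig _ i2).1|exact: (integrable_trig _ i1).2].
apply: eq_Rintegral => x _; rewrite Im_mul /expi /= cosN sinN.
have -> : 2 * pi * x * xi = 2 * pi * xi * x by ring.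
ring.
Qed.

(** The values at [- xi] of the product and of the transform of a real function are
conjugate to those at [xi]. Separating the even and the odd part in [xi] yields
four real identities, by which the imaginary part of [g] has vanishing Fourier
transform. *)
Lemma fourier_tp (g : R -> R[i]) (ds : seq R) (C0 gam : R) : cLfun 1%:E g ->
  (forall xi : R, fourier g xi = (C0 * expR (- (gam * xi ^+ 2)))%:C *
      \prod_(d <- ds) (1 +i* (2 * pi * d * xi))^-1) ->
  forall xi, [/\ \int[mu]_x (Re (g x) * cos (2 * pi * xi * x)) = C0 * expR (- (gam * xi ^+ 2)) * (tp_factor ds xi).1,
    \int[mu]_x (Re (g x) * sin (2 * pi * xi * x)) = - (C0 * expR (- (gam * xi ^+ 2)) * (tp_factor ds xi).2),
    \int[mu]_x (Im (g x) * cos (2 * pi * xi * x)) = 0 &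
    \int[mu]_x (Im (g x) * sin (2 * pi * xi * x)) = 0].
Proof.
move=> ig hg xi.
have neg (u : R -> R) : \int[mu]_x (u x * cos (2 * pi * - xi * x)) = \int[mu]_x (u x * cos (2 * pi * xi * x)).
  by apply: eq_Rintegral => x _; rewrite mulrN mulNr cosN.
have negs (u : R -> R) : mu.-integrable setT (EFin \o u) ->
    \int[mu]_x (u x * sin (2 * pi * - xi * x)) = - \int[mu]_x (u x * sin (2 * pi * xi * x)).
  move=> iu; rewrite -[RHS]mulN1r -RintegralZl//; last exact: (integrable_trig _ iu).2.
  by apply: eq_Rintegral => x _; rewrite mulrN mulNr sinN; ring.
have [i1 i2] := cLfun1_integrable ig.
have [r1 r2] := fourier_parts xi ig; have [s1 s2] := fourier_parts (- xi) ig.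
rewrite !neg !negs// in s1 s2.
have hE w : Re (fourier g w) = (tp_factor ds w).1 * (C0 * expR (- (gam * w ^+ 2))) /\
    Im (fourier g w) = (tp_factor ds w).2 * (C0 * expR (- (gam * w ^+ 2))).
  by rewrite hg prod_tp_factor mulrC Re_scaler Im_scaler.
have [e1 e2] := hE xi; have [e3 e4] := hE (- xi).
have p1 : (tp_factor ds (- xi)).1 = (tp_factor ds xi).1 by rewrite tp_factor_parity.
have p2 : (tp_factor ds (- xi)).2 = - (tp_factor ds xi).2 by rewrite tp_factor_parity.
rewrite p1 sqrrN in e3; rewrite p2 sqrrN in e4.
move: r1 r2 s1 s2; rewrite e1 e2 e3 e4.
by move=> r1 r2 s1 s2; clear -r1 r2 s1 s2; split; lra.
Qed.

(** The heat kernel is itself a superposition of waves, so Fubini expresses the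
pairing by the Fourier transform of [u]. *)
Lemma heat_pairing (u : R -> R) (ds : seq R) (C0 gam eps : R) (y k : R) : 0 < eps -> 0 < gam ->
  continuous u -> mu.-integrable setT (EFin \o u) ->
  (forall xi, \int[mu]_x (u x * cos (2 * pi * xi * x)) = C0 * expR (- (gam * xi ^+ 2)) * (tp_factor ds xi).1) ->
  (forall xi, \int[mu]_x (u x * sin (2 * pi * xi * x)) = - (C0 * expR (- (gam * xi ^+ 2)) * (tp_factor ds xi).2)) ->
  \int[mu]_x (u (x - k) * heat eps (x - y)) = C0 * packet ds (gam + eps) (y - k).
Proof.
move=> e0 g0 cu iu hc hs.
have -> : \int[mu]_x (u (x - k) * heat eps (x - y)) =
    \int[mu]_x (u x * packet [::] eps (x - (y - k))).
  have cq : continuous (fun x => u x * heat eps (x - (y - k))).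
    move=> x; apply: cvgM; first exact: cu.
    exact: (cts_bounded_shift (y - k) (heat_cts_bounded e0)).1.
  rewrite (packetE _ e0) /= [RHS]/Rintegral (integral_affine (- k) (@ltr01 R) cq).
  congr fine; apply: eq_integral => x _; rewrite mulr1 mul1r; congr (_ * heat _ _)%:E; ring.
rewrite (@Fubini_kernel R u (fun xi => expR (- (eps * xi ^+ 2))) (fun x xi => wave [::] xi (x - (y - k))) 2)//; last 3 first.
- exact: (gauss_integral e0).1.
- have mz : measurable_fun [set: measurableTypeR R * measurableTypeR R]
      (fun z : measurableTypeR R * measurableTypeR R => 2 * pi * z.2 * (z.1 - (y - k))).
    apply: measurable_funM; first by apply: measurable_funM => //; exact: measurable_snd.
    by apply: measurable_funB => //; exact: measurable_fst.
  apply: measurable_funB; apply: measurable_funM => //.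
    by apply: (measurableT_comp _ mz); apply: continuous_measurable_fun; exact: continuous_cos.
  by apply: (measurableT_comp _ mz); apply: continuous_measurable_fun; exact: continuous_sin.
- by move=> x xi; exact: wave_bound.
have [ig _] := gauss_integral (addr_gt0 g0 e0).
rewrite /packet -RintegralZl//; last first.
  apply: (@integrable_bounded_mul _ _ _ mu setT _ _ 2 measurableT ig); last by move=> x _; exact: wave_bound.
  have [m1 m2] := tp_factor_measurable ds.
  apply: measurable_funB; apply: measurable_funM => //.
    have -> : (fun xi => cos (2 * pi * xi * (y - k))) = (fun xi => cos (2 * pi * (y - k) * xi)).
      by apply/funext => xi; rewrite mulrAC.
    by apply: continuous_measurable_fun; exact: continuous_cos_freq.
  have -> : (fun xi => sin (2 * pi * xi * (y - k))) = (fun xi => sin (2 * pi * (y - k) * xi)).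
    by apply/funext => xi; rewrite mulrAC.
  by apply: continuous_measurable_fun; exact: continuous_sin_freq.
apply: eq_Rintegral => xi _.
have -> : \int[mu]_x (u x * wave [::] xi (x - (y - k))) =
    cos (2 * pi * xi * (y - k)) * \int[mu]_x (u x * cos (2 * pi * xi * x)) +
    sin (2 * pi * xi * (y - k)) * \int[mu]_x (u x * sin (2 * pi * xi * x)).
  have [ic is'] := integrable_trig (2 * pi * xi) iu.
  rewrite -[X in _ = X + _]RintegralZl// -[X in _ = _ + X]RintegralZl// -RintegralD//.
  - apply: eq_Rintegral => x _; rewrite /wave /= mulr1 mulr0 subr0.
    by rewrite mulrBr cosB; ring.
  - exact: (integrableZl measurableT _ ic).
  - exact: (integrableZl measurableT _ is').
rewrite hc hs /wave; have -> : - ((gam + eps) * xi ^+ 2) = - (gam * xi ^+ 2) - (eps * xi ^+ 2) by ring.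
by rewrite expRD; ring.
Qed.
End complex_side.

Section weak_star.
Context {R : realType}.
Notation mu := (@lebesgue_measure R).
Local Open Scope complex_scope.
Local Notation Re := (@complex.Re R).
Local Notation Im := (@complex.Im R).

Definition window (n : nat) : {fset int} :=
  [fset k in [seq j%:Z | j <- iota 0 n] ++ [seq - 1 - j%:Z | j <- iota 0 n]]%fset.

Lemma window_uniq n : uniq ([seq j%:Z | j <- iota 0 n] ++ [seq - 1 - j%:Z | j <- iota 0 n]).
Proof.
rewrite cat_uniq !map_inj_uniq ?iota_uniq ?andbT; last 2 first.
- by move=> i j; lia.
- by move=> i j [].
by apply/hasPn => _ /mapP[j _ ->]; apply/mapP => -[i _]; lia.
Qed.

Lemma big_window (F : int -> R) n : \sum_(k <- window n) F k = window_sum F n.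
Proof.
rewrite (perm_big ([seq j%:Z | j <- iota 0 n] ++ [seq - 1 - j%:Z | j <- iota 0 n])); last first.
  apply: uniq_perm; [exact: fset_uniq|exact: window_uniq|].
  by move=> k; rewrite mem_cat /window !inE.
have io : iota 0 n = index_iota 0 n by rewrite /index_iota subn0.
by rewrite big_cat !big_map io !big_mkord /window_sum big_split.
Qed.

Lemma window_totally : window @ \oo --> totally.
Proof.
move=> P [A _ AP].
exists (\sum_(k <- A) (absz k).+1)%N => // n /= hn; apply: AP => /=.
apply/fsubsetP => k kA.
have kn : (absz k < n)%N.
  apply: leq_trans hn; rewrite (big_rem k) //=.
  by rewrite leq_addr.
rewrite !inE; apply/orP; case: k kn {kA} => k kn; [left|right].
  by apply/mapP; exists k => //; rewrite mem_iota.
by apply/mapP; exists k; rewrite ?mem_iota; lia.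
Qed.

(** The windows [- n <= k < n] are cofinal among the finite sets of indices. The
generator has no imaginary part against the test function [p], so real and
imaginary parts of the coefficients separate. *)
Lemma weak_star_ReIm (g f : R -> R[i]) (c : int -> R[i]) (p : R -> R) (W : int -> R) :
  weak_star_shift_sum g c f -> measurable_fun setT p -> mu.-integrable setT (EFin \o p) ->
  (forall k : int, [/\ mu.-integrable setT (EFin \o (fun x => Re (g (x - k%:~R)) * p x)),
     mu.-integrable setT (EFin \o (fun x => Im (g (x - k%:~R)) * p x)),
     \int[mu]_x (Re (g (x - k%:~R)) * p x) = W k &
     \int[mu]_x (Im (g (x - k%:~R)) * p x) = 0]) ->
  window_sum (fun k => Re (c k) * W k) @ \oo --> \int[mu]_x (Re (f x) * p x) /\
  window_sum (fun k => Im (c k) * W k) @ \oo --> \int[mu]_x (Im (f x) * p x).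
Proof.
move=> ws mp ip hW.
have hcr (u : R -> R[i]) : cRintegral (fun x => u x * (p x)%:C) =
    (\int[mu]_x (Re (u x) * p x)) +i* (\int[mu]_x (Im (u x) * p x)).
  by rewrite /cRintegral; congr (_ +i* _); apply: eq_Rintegral => x _; [exact: Re_scaler|exact: Im_scaler].
have key (s : seq int) :
  [/\ mu.-integrable setT (EFin \o (fun x => Re (\sum_(k <- s) c k * g (x - k%:~R)) * p x)),
      mu.-integrable setT (EFin \o (fun x => Im (\sum_(k <- s) c k * g (x - k%:~R)) * p x)),
     \int[mu]_x (Re (\sum_(k <- s) c k * g (x - k%:~R)) * p x) = \sum_(k <- s) Re (c k) * W k &
     \int[mu]_x (Im (\sum_(k <- s) c k * g (x - k%:~R)) * p x) = \sum_(k <- s) Im (c k) * W k].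
  elim: s => [|k s [i1 i2 e1 e2]].
    have z (x : R) : Re (\sum_(k <- [::]) c k * g (x - k%:~R)) * p x = 0 by rewrite big_nil mul0r.
    have z' (x : R) : Im (\sum_(k <- [::]) c k * g (x - k%:~R)) * p x = 0 by rewrite big_nil mul0r.
    have iz : mu.-integrable setT (EFin \o (fun=> 0 : R)) by exact: integrable0.
    have -> : (fun x => Re (\sum_(k <- [::]) c k * g (x - k%:~R)) * p x) = fun=> 0 by exact/funext.
    have -> : (fun x => Im (\sum_(k <- [::]) c k * g (x - k%:~R)) * p x) = fun=> 0 by exact/funext.
    by split => //; rewrite big_nil Rintegral_cst// mul0r.
  have [j1 j2 f1 f2] := hW k.
  have E1 : (fun x => Re (\sum_(k <- k :: s) c k * g (x - k%:~R)) * p x) =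
      (fun x => (Re (c k) * (Re (g (x - k%:~R)) * p x) + (- Im (c k)) * (Im (g (x - k%:~R)) * p x)) +
          Re (\sum_(k <- s) c k * g (x - k%:~R)) * p x).
    by apply/funext => x; rewrite big_cons Re_add Re_mul; ring.
  have E2 : (fun x => Im (\sum_(k <- k :: s) c k * g (x - k%:~R)) * p x) =
      (fun x => (Re (c k) * (Im (g (x - k%:~R)) * p x) + Im (c k) * (Re (g (x - k%:~R)) * p x)) +
          Im (\sum_(k <- s) c k * g (x - k%:~R)) * p x).
    by apply/funext => x; rewrite big_cons Im_add Im_mul; ring.
  have l1 := integrableZl measurableT (Re (c k)) j1.
  have l2 := integrableZl measurableT (- Im (c k)) j2.
  have l3 := integrableZl measurableT (Re (c k)) j2.
  have l4 := integrableZl measurableT (Im (c k)) j1.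
  have m1 := integrableD measurableT l1 l2.
  have m2 := integrableD measurableT l3 l4.
  rewrite E1 E2; split.
  - exact: (integrableD measurableT m1 i1).
  - exact: (integrableD measurableT m2 i2).
  - rewrite RintegralD// RintegralD// !RintegralZl// f1 f2 e1 mulr0 addr0.
    by rewrite big_cons.
  - rewrite RintegralD// RintegralD// !RintegralZl// f1 f2 e2 mulr0 add0r.
    by rewrite big_cons.
have h : (fun n => cRintegral (fun x => (\sum_(k <- window n) c k * g (x - k%:~R)) * (p x)%:C) : R[i]^o) @ \oo
    --> (cRintegral (fun x => f x * (p x)%:C) : R[i]^o).
  exact: (cvg_comp _ _ window_totally (ws _ (cLfun1_real mp ip))).
have [h1 h2] := cvg_ReIm h; rewrite hcr in h1 h2.
split.
  have -> : window_sum (fun k => Re (c k) * W k) = (fun n => Re (cRintegral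
      (fun x => (\sum_(k <- window n) c k * g (x - k%:~R)) * (p x)%:C))).
    by apply/funext => n; rewrite hcr -big_window; have [_ _ -> _] := key (window n).
  exact: h1.
have -> : window_sum (fun k => Im (c k) * W k) = (fun n => Im (cRintegral
    (fun x => (\sum_(k <- window n) c k * g (x - k%:~R)) * (p x)%:C))).
  by apply/funext => n; rewrite hcr -big_window; have [_ _ _ ->] := key (window n).
exact: h2.
Qed.

Lemma gauss_series_scale (c : int -> R) (B p x kap : R) : 0 < p -> (forall k, `|c k| <= B) ->
  gauss_series (fun k => kap * c k) p x = kap * gauss_series c p x.
Proof.
move=> p0 cB; apply: (cvg_lim (@Rhausdorff R)).
have -> : window_sum (gauss_term p (fun k => kap * c k) x) = (fun n => kap * window_sum (gauss_term p c x) n).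
  by apply/funext => n; rewrite -window_sumZ; apply: eq_bigr => j _; rewrite /gauss_term; ring.
by apply: cvgMl_tmp; exact: gauss_series_cvg p0 cB.
Qed.

(** The test functions are translated heat kernels, for which
[heat_pairing] computes every term of the weak* series. *)
Lemma Vinfty_representation (g f : R -> R[i]) : tp_gaussian_type g -> Vinfty g f ->
  exists (ds : seq R) (a : R) (c1 c2 : int -> R) (B : R),
    [/\ 0 < a, forall k, `|c1 k| <= B, forall k, `|c2 k| <= B,
      (forall y, Re (f y) = relaxs ds (gauss_series c1 a) y) &
      (forall y, Im (f y) = relaxs ds (gauss_series c2 a) y)].
Proof.
move=> [_ g1 cg [m [delta [C0 [gam [C00 gam0 hg]]]]]] [f1 cf [c [[M hM] ws]]].
pose ds := [seq delta nu | nu <- enum 'I_m].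
have hg' xi : fourier g xi = (C0 * expR (- (gam * xi ^+ 2)))%:C *
      \prod_(d <- ds) (1 +i* (2 * pi * d * xi))^-1.
  by rewrite hg big_map big_enum.
have ft := fourier_tp g1 hg'.
have [cRe cIm] := continuous_ReIm cg.
have [iRe iIm] := cLfun1_integrable g1.
have [Bf [bRe bIm]] := cLfun_oo_bounded f1 cf.
pose kap := C0 * Num.sqrt (pi / gam).
pose c1 k := kap * Re (c k); pose c2 k := kap * Im (c k).
have p0 : 0 < pi ^+ 2 / gam by rewrite divr_gt0// exprn_gt0// pi_gt0.
have main (eps y : R) : 0 < eps ->
    window_sum (fun k => Re (c k) * (C0 * packet ds (gam + eps) (y - k%:~R))) @ \oo -->
      \int[mu]_x (Re (f x) * heat eps (x - y)) /\
    window_sum (fun k => Im (c k) * (C0 * packet ds (gam + eps) (y - k%:~R))) @ \oo -->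
      \int[mu]_x (Im (f x) * heat eps (x - y)).
  move=> e0; have bh := cts_bounded_shift y (heat_cts_bounded e0).
  have ch : continuous (fun x => heat eps (x - y)) := bh.1.
  apply: (weak_star_ReIm ws).
  - exact: continuous_measurable_fun.
  - have := integrable_affine (- y) (@ltr01 R) (@heat_continuous R eps) (heat_integral e0).1.
    by congr (_.-integrable _ _); apply/funext => x /=; rewrite mul1r.
  - have sh (u : R -> R) (k : R) : continuous u -> mu.-integrable setT (EFin \o u) ->
        mu.-integrable setT (EFin \o (fun x => u (x - k) * heat eps (x - y))).
      move=> cu iu; apply: (@integrable_bounded_mul _ _ _ mu setT _ _ (Num.sqrt (pi / eps))) => //.
      - have := integrable_affine (- k) (@ltr01 R) cu iu.
        by congr (_.-integrable _ _); apply/funext => x /=; rewrite mul1r.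
      - exact: continuous_measurable_fun.
      - by move=> x _; exact: bh.2.
    move=> k; split.
    + exact: (sh _ k%:~R cRe iRe).
    + exact: (sh _ k%:~R cIm iIm).
    + by apply: (heat_pairing y k%:~R e0 gam0 cRe iRe) => xi; have [] := ft xi.
    + rewrite (@heat_pairing R (fun x => Im (g x)) ds 0 gam eps y k%:~R e0 gam0 cIm iIm) ?mul0r//.
        by move=> xi; have [_ _ -> _] := ft xi; rewrite !mul0r.
      by move=> xi; have [_ _ _ ->] := ft xi; rewrite !mul0r oppr0.
exists ds, (pi ^+ 2 / gam), c1, c2, (`|kap| * M); split.
- by rewrite divr_gt0// exprn_gt0// pi_gt0.
- by move=> k; rewrite normrM ler_wpM2l// (le_trans (normc_Re _)).
- by move=> k; rewrite normrM ler_wpM2l// (le_trans (normc_Im _)).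
- move=> y; rewrite (relaxs_of_heat_averages bRe (fun k => le_trans (normc_Re _) (hM k)) gam0 (fun eps y e0 => (main eps y e0).1)).
  by congr (relaxs ds _ y); apply/funext => x; rewrite (gauss_series_scale x kap p0 (fun k => le_trans (normc_Re (c k)) (hM k))).
- move=> y; rewrite (relaxs_of_heat_averages bIm (fun k => le_trans (normc_Im _) (hM k)) gam0 (fun eps y e0 => (main eps y e0).2)).
  by congr (relaxs ds _ y); apply/funext => x; rewrite (gauss_series_scale x kap p0 (fun k => le_trans (normc_Im (c k)) (hM k))).
Qed.
End weak_star.

(** * Counting zeros *)

Section counting.
Context {R : realType}.

(** Counting from [-1] instead of [0] lets the reflection [l |-> - 1 - l] send all
negative zeros into the range. *)
Definition half_line_count (v : R -> R) := forall eta : R, 0 < eta -> exists C : R,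
  forall (x : R) (A : seq R), 0 <= x -> uniq A ->
    (forall l, l \in A -> -1 <= l <= x /\ v l = 0) ->
    \sum_(l <- A) (x - l) <= (1 / 2 + eta) * x ^+ 2 + C.

Lemma sum_ge_size (A : seq R) (F : R -> R) (m : R) :
  (forall l, l \in A -> m <= F l) -> (size A)%:R * m <= \sum_(l <- A) F l.
Proof.
elim: A => [|a A IH] h; first by rewrite big_nil mul0r.
rewrite big_cons /= -natr1 mulrDl mul1r addrC lerD ?h ?mem_head//.
by apply: IH => l lA; apply: h; rewrite inE lA orbT.
Qed.

(** Used first with [x] replaced by [2 x + 2], the crude estimate shows that
the number of zeros in [[-1, x]] grows at most linearly; inserted into the crude
estimate at [x] with a small [eta], this makes the error quadratic with a small
constant. *)
Lemma gauss_series_half_line_count (c : int -> R) (B a : R) : 0 < a -> (forall k, `|c k| <= B) ->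
  (exists k, c k != 0) -> half_line_count (gauss_series c a).
Proof.
move=> a0 cB [k0 ck0] eta eta0.
have B0 : 0 < B by apply: lt_le_trans (cB k0); rewrite normr_gt0.
have Z l : gauss_series c a l = 0 -> window_sum (gauss_term a c l) @ \oo --> 0.
  by move=> <-; exact: gauss_series_cvg a0 cB.
(* At [2 x + 2] each zero of [[-1, x]] weighs at least [x + 2], so any slope well
   below 1 bounds their number linearly. *)
have e18 : (0 : R) < 1 / 8 by rewrite divr_gt0.
have [C1 h1] := gauss_zeros_crude a0 B0 cB ck0 e18.
pose C8 := `|C1|.
have lin (x : R) (A : seq R) : 0 <= x -> uniq A ->
    (forall l, l \in A -> -1 <= l <= x /\ gauss_series c a l = 0) ->
    (size A)%:R <= 3 * (1 + x) + 4 * C8.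
  move=> x0 uA hA; have x'0 : 0 <= 2 * x + 2 by lra.
  have hA' l : l \in A -> -1 <= l <= 2 * x + 2 /\ window_sum (gauss_term a c l) @ \oo --> 0.
    move=> /hA [/andP[l1 l2] l0]; split; last exact: Z.
    by apply/andP; split; lra.
  have := h1 _ _ x'0 uA hA'.
  have := @sum_ge_size A (fun l => 2 * x + 2 - l) (x + 2).
  move=> /(_ _) h2 h3; have {h2} : (size A)%:R * (x + 2) <= \sum_(l <- A) (2 * x + 2 - l).
    by apply: h2 => l /hA [/andP[_ lx] _]; lra.
  move=> /le_trans /(_ h3); set n : R := (size A)%:R; have n0 : 0 <= n by [].
  have C18 : C1 <= C8 by exact: ler_norm.
  have C80 : 0 <= C8 by exact: normr_ge0.
  move=> h; have {}h : n * (3 / 4 * (1 + x)) <= (2 * (1 + x) + 3 * C8) * (1 + x).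
    have : C1 * (2 * x + 3) <= C8 * (2 * x + 3) by rewrite ler_wpM2r//; lra.
    nra.
  have {}h : n * (3 / 4) <= 2 * (1 + x) + 3 * C8.
    by rewrite -(@ler_pM2r _ (1 + x)) ?ltr_pwDl// -mulrA.
  lra.
pose e8 := eta / 8; have e80 : 0 < e8 by rewrite divr_gt0.
have [C2 h2] := gauss_zeros_crude a0 B0 cB ck0 e80.
pose D := `|C2| + 4 * C8 * e8.
have D0 : 0 <= D by apply: addr_ge0 (normr_ge0 _) _; apply: mulr_ge0 (mulr_ge0 (ler0n _ 4) (normr_ge0 C1)) (ltW e80).
exists (6 * e8 + D + D ^+ 2 / eta) => x A x0 uA hA.
have hA' l : l \in A -> -1 <= l <= x /\ window_sum (gauss_term a c l) @ \oo --> 0.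
  by move=> /hA [h /Z].
apply: le_trans (h2 _ _ x0 uA hA') _.
have := lin _ _ x0 uA hA; set n : R := (size A)%:R => hn.
have s1 : C2 + e8 * n <= D + 3 * e8 * (1 + x).
  have : e8 * n <= e8 * (3 * (1 + x) + 4 * C8) by rewrite ler_pM2l.
  by have := ler_norm C2; rewrite /D; nra.
have s2 : (C2 + e8 * n) * (1 + x) <= (D + 3 * e8 * (1 + x)) * (1 + x).
  by rewrite ler_wpM2r//; lra.
have s3 : D * x <= eta / 4 * x ^+ 2 + D ^+ 2 / eta.
  rewrite -subr_ge0.
  have -> : eta / 4 * x ^+ 2 + D ^+ 2 / eta - D * x = (eta / 2 * x - D) ^+ 2 / eta.
    by field; rewrite gt_eqF.
  by rewrite divr_ge0 ?sqr_ge0// ltW.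
have s4 : (1 + x) * (1 + x) <= 2 + 2 * x ^+ 2 by have := sqr_ge0 (x - 1); nra.
have s5 : 3 * e8 * ((1 + x) * (1 + x)) <= 3 * e8 * (2 + 2 * x ^+ 2) by rewrite ler_wpM2l// mulr_ge0// ltW.
have s6 : (D + 3 * e8 * (1 + x)) * (1 + x) = D + D * x + 3 * e8 * ((1 + x) * (1 + x)) by ring.
have s7 : 3 * e8 * (2 + 2 * x ^+ 2) = 6 * e8 + 3 / 4 * eta * x ^+ 2 by rewrite /e8; field.
have s8 : (1 / 2 + eta) * x ^+ 2 = x ^+ 2 / 2 + eta / 4 * x ^+ 2 + 3 / 4 * eta * x ^+ 2 by field.
rewrite s8; rewrite s6 in s2; rewrite s7 in s5.
by clear -s2 s3 s5; lra.
Qed.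

(** Each gap between consecutive zeros of the relaxed function contains a zero of
[v]. It lies to the left of the right end of the gap, hence contributes more to
the sum. *)
Lemma rolle_list (v : R -> R) B del x : cts_bounded v B -> del != 0 ->
  forall (s : seq R) a, path <%R a s -> relax del v a = 0 ->
    (forall l, l \in s -> l <= x /\ relax del v l = 0) ->
  exists t : seq R, [/\ path <%R a t, (forall z, z \in t -> z <= x /\ v z = 0) &
     \sum_(l <- s) (x - l) <= \sum_(z <- t) (x - z)].
Proof.
move=> bv d0; elim=> [|b s IH] a; first by exists [::].
move=> /= /andP[ab pbs] va hs.
have [bx vb] := hs b (mem_head _ _).
have [|t [pt ht st]] := IH b pbs vb.
  by move=> l ls; apply: hs; rewrite inE ls orbT.
have [z /andP[az zb] vz] := relax_rolle bv d0 ab va vb.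
exists (z :: t); split.
- by rewrite /= az /=; case: (t) pt => //= w t' /andP[bw ->]; rewrite (le_lt_trans _ bw) ?ltW.
- move=> w; rewrite inE => /predU1P[->|/ht//]; split => //.
  exact: le_trans (ltW zb) bx.
- by rewrite !big_cons lerD// lerB// ltW.
Qed.

(** One zero is lost in passing to the gaps. Its contribution is at most
[x + 1], which is absorbed by the quadratic term. *)
Lemma relax_half_line_count (v : R -> R) B del : cts_bounded v B -> half_line_count v -> half_line_count (relax del v).
Proof.
move=> bv zv; have [->|d0] := eqVneq del 0; first by rewrite relax0.
move=> eta eta0; have e20 : 0 < eta / 2 by rewrite divr_gt0.
have [C hC] := zv _ e20.
exists (`|C| + 1 + 1 / (2 * eta)) => x A x0 uA hA.
(* The linear contribution of the zero that is lost. *)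
have xe : x <= eta / 2 * x ^+ 2 + 1 / (2 * eta).
  rewrite -subr_ge0; have -> : eta / 2 * x ^+ 2 + 1 / (2 * eta) - x = (eta * x - 1) ^+ 2 / (2 * eta).
    by field; rewrite gt_eqF.
  by rewrite divr_ge0 ?sqr_ge0// mulr_ge0// ltW.
have Cn := ler_norm C.
rewrite -(perm_big _ (permEl (perm_sort <=%R A))) /=.
have srt : sorted <%R (sort <=%R A) by rewrite sort_lt_sorted.
have mem l : l \in sort <=%R A -> -1 <= l <= x /\ relax del v l = 0.
  by rewrite mem_sort; exact: hA.
case: (sort <=%R A) srt mem => [_ _|a s /= ps mem].
  rewrite big_nil; have := sqr_ge0 x; have := normr_ge0 C.
  have : 0 <= 1 / (2 * eta) by rewrite divr_ge0// mulr_ge0// ltW.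
  by nra.
have [/andP[a1 ax] va] := mem a (mem_head _ _).
have [|t [pt ht st]] := rolle_list bv d0 ps va (x := x).
  by move=> l ls; have [|/andP[_ ?] ?] := mem l; rewrite ?inE ?ls ?orbT.
have ut : uniq t.
  by have := lt_sorted_uniq (pt : sorted <%R (a :: t)) => /andP[].
have := hC x t x0 ut; rewrite big_cons => /(_ _) h.
have {h} : \sum_(z <- t) (x - z) <= (1 / 2 + eta / 2) * x ^+ 2 + C.
  apply: h => z zt; have [zx vz] := ht z zt; split => //; rewrite zx andbT.
  have /allP /(_ z zt) /ltW := order_path_min lt_trans pt.
  exact: le_trans.
by nra.
Qed.

Lemma relaxs_half_line_count (v : R -> R) B ds : cts_bounded v B -> half_line_count v -> half_line_count (relaxs ds v).
Proof.
by move=> bv zv; elim: ds => [//|d ds IH]; apply: (relax_half_line_count _ (relaxs_cts_bounded ds bv)).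
Qed.

Definition mirror (v : R -> R) x := v (- 1 - x).

Lemma relaxs_mirror (v : R -> R) ds : mirror (relaxs ds v) = relaxs (map -%R ds) (mirror v).
Proof.
elim: ds => [//|d ds IH] /=; rewrite -IH; apply/funext => y.
by apply: eq_Rintegral => s _; rewrite /mirror; congr (_ * relaxs ds v _); ring.
Qed.

Lemma gauss_series_mirror (c : int -> R) a : mirror (gauss_series c a) = gauss_series (fun k => c (- 1 - k)) a.
Proof.
apply/funext => x; rewrite /mirror /gauss_series; congr (limn _).
apply/funext => n; rewrite /window_sum; apply: eq_bigr => j _; rewrite addrC /gauss_term.
have -> : -1 - (-1 - j%:Z) = j%:Z by lia.
by congr (_ * expR (- (a * _)) + _ * expR (- (a * _))); rewrite !intrB; ring.
Qed.

(** The sum is the integral over [0 <= t <= x] of the number of points of [A] in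
[[- t, t]]; one point per unit length corresponds to the leading term [x^2]. *)
Definition quadratic_count (Z : set R) := forall eta : R, 0 < eta -> exists C : R,
  forall (x : R) (A : seq R), 0 <= x -> uniq A ->
    (forall l, l \in A -> `|l| <= x /\ Z l) ->
    \sum_(l <- A) (x - `|l|) <= (1 + eta) * x ^+ 2 + C.

(** For a negative zero [l], the mirror image [- 1 - l] is within [[-1, x]] and its
distance to [x] exceeds that of [- l]. *)
Lemma half_line_count_sym (v : R -> R) : half_line_count v -> half_line_count (mirror v) -> quadratic_count [set l | v l = 0].
Proof.
move=> z1 z2 eta eta0; have e20 : 0 < eta / 2 by rewrite divr_gt0.
have [C1 h1] := z1 _ e20; have [C2 h2] := z2 _ e20.
exists (C1 + C2) => x A x0 uA hA.
rewrite (bigID (fun l => 0 <= l)) /= -!(big_filter A).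
have -> : (1 + eta) * x ^+ 2 + (C1 + C2) =
  ((1 / 2 + eta / 2) * x ^+ 2 + C1) + ((1 / 2 + eta / 2) * x ^+ 2 + C2) by field.
apply: lerD.
- have -> : \sum_(i <- [seq l <- A | 0 <= l]) (x - `|i|) = \sum_(i <- [seq l <- A | 0 <= l]) (x - i).
    by apply: eq_big_seq => l; rewrite mem_filter => /andP[l0 _]; rewrite ger0_norm.
  apply: h1 => //; first exact: filter_uniq.
  move=> l; rewrite mem_filter => /andP[l0 /hA[lx vl]]; split => //.
  by move: lx; rewrite ger0_norm// => ->; rewrite andbT (le_trans _ l0)// lerN10.
- apply: (@le_trans _ _ (\sum_(m <- [seq -1 - l | l <- A & ~~ (0 <= l)]) (x - m))).
    rewrite big_map big_seq [leRHS]big_seq; apply: ler_sum => l.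
    rewrite mem_filter -ltNge => /andP[l0 _]; rewrite ltr0_norm//; lra.
  apply: h2 => //.
    by rewrite map_inj_uniq ?filter_uniq// => l l' /addrI /oppr_inj.
  move=> m /mapP[l]; rewrite mem_filter -ltNge => /andP[l0 /hA[lx vl]] ->; split.
    by move: lx; rewrite ltr0_norm// => ?; apply/andP; split; lra.
  by rewrite /mirror opprB addrC subrK.
Qed.

Lemma relaxs_gauss_series_count (c : int -> R) (B a : R) ds : 0 < a -> (forall k, `|c k| <= B) ->
  (exists y, relaxs ds (gauss_series c a) y != 0) -> 
    quadratic_count [set l | relaxs ds (gauss_series c a) l = 0].
Proof.
move=> a0 cB [y uy].
have [T hT] := gauss_series_bound a0 cB; have bg : cts_bounded (gauss_series c a) T.
  by split => //; exact: gauss_series_continuous a0 cB.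
have cn0 : exists k, c k != 0.
  apply: contrapT => h; have c0 k : c k = 0.
    by apply/eqP; apply: contrapT => /negP ck; apply: h; exists k.
  have g0 x : gauss_series c a x = 0 * gauss_series c a x.
    rewrite mul0r; apply: (cvg_lim (@Rhausdorff R)).
    have -> : window_sum (gauss_term a c x) = fun=> 0.
      by apply/funext => n; rewrite /window_sum big1// => j _; rewrite /gauss_term !c0 !mul0r addr0.
    exact: cvg_cst.
  have E : gauss_series c a = (fun x => 0 * gauss_series c a x) by exact/funext.
  by move: uy; rewrite E (relaxs_scale ds 0 y bg) mul0r eqxx.
apply: half_line_count_sym.
  by apply: (relaxs_half_line_count _ bg); exact: gauss_series_half_line_count a0 cB cn0.
rewrite relaxs_mirror gauss_series_mirror.
have cB' k : `|c (-1 - k)| <= B by [].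
have [T' hT'] := gauss_series_bound a0 cB'.
apply: (@relaxs_half_line_count _ T').
  by split => //; exact: gauss_series_continuous a0 cB'.
apply: (gauss_series_half_line_count a0 cB'); have [k ck] := cn0.
by exists (-1 - k); rewrite opprB addrC subrK.
Qed.
End counting.

(** * From counting to circular density *)

Section density.
Context {R : realType}.
Notation mu := (@lebesgue_measure R).

Lemma integral_primitive (f F : R -> R) (a b : R) : a <= b -> continuous F ->
  (forall x, a <= x <= b -> {for x, continuous f}) ->
  (forall x, a < x < b -> is_derive x 1 F (f x)) ->
  (\int[mu]_(x in `[a, b]) (f x)%:E = (F b - F a)%:E)%E.
Proof.
rewrite le_eqVlt => /predU1P[->|ab] cF cf dF.
  by rewrite set_itv1 integral_set1 subrr.
rewrite (@continuous_FTC2 R f F a b ab) ?EFinB//.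
- by apply: continuous_in_subspaceT => x; rewrite inE/= in_itv/=; exact: cf.
- split.
  + by move=> x; rewrite in_itv/= => /dF[].
  + exact: cvg_at_right_filter (cF a).
  + exact: cvg_at_left_filter (cF b).
- by move=> x; rewrite in_itv/= => /dF d; rewrite derive1E; case: d.
Qed.

(** In a circle of radius [t], half the length of the chord at distance [y] from the
centre. *)
Definition halfchord (y t : R) := Num.sqrt (t ^+ 2 - y ^+ 2).

Lemma halfchord_continuous y : continuous (halfchord y).
Proof.
move=> t; apply: (@continuous_comp _ _ _ (fun t : R => t ^+ 2 - y ^+ 2) Num.sqrt); last exact: sqrt_continuous.
apply: cvgB; last exact: cvg_cst.
exact: (@exprn_continuous R 2 t).
Qed.

Lemma halfchord_eq0 y t : `|t| <= `|y| -> halfchord y t = 0.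
Proof.
move=> ty; apply: ler0_sqrtr; rewrite subr_le0 -(real_normK (num_real t)) -(real_normK (num_real y)).
by rewrite ler_pXn2r// nnegrE.
Qed.

Lemma measurable_halfchord (r l : R) :
  measurable_fun (`]0, r]%classic : set R) (fun t : R => halfchord l t / t).
Proof.
have m : measurable_fun (`]0, +oo[%classic : set R) (fun t : R => halfchord l t / t).
  apply: open_continuous_measurable_fun => //.
  move=> t; rewrite inE/= in_itv/= andbT => t0.
  by apply: cvgM; [exact: halfchord_continuous|apply: inv_continuous; rewrite gt_eqF].
apply: measurable_funS m; first exact: measurable_itv.
by move=> t; rewrite /= !in_itv/= andbT => /andP[].
Qed.

(** A primitive of [sqrt(t^2 - y^2) / t] is
[sqrt(t^2 - y^2) - y atan(sqrt(t^2 - y^2) / y)]. *)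
Lemma chord_integral (y r : R) : 0 < y -> y <= r ->
  (\int[mu]_(t in `[y, r]) (halfchord y t / t)%:E =
   (halfchord y r - y * atan (halfchord y r / y))%:E)%E.
Proof.
move=> y0 yr; pose h := halfchord y; pose F t : R := h t - y * atan (h t / y).
have ch : continuous h := @halfchord_continuous y.
have ca : continuous (fun t => atan (h t / y)).
  move=> t; apply: (@continuous_comp _ _ _ (fun t => h t / y) atan); last exact: continuous_atan.
  by apply: cvgM; [exact: ch|exact: cvg_cst].
transitivity ((F r - F y)%:E); [apply: integral_primitive => //|].
- move=> t; apply: cvgB; first exact: ch.
  by apply: cvgM; [exact: cvg_cst|exact: ca].
- move=> t /andP[yt _]; have t0 : t != 0 by rewrite gt_eqF// (lt_le_trans y0).
  by apply: cvgM; [exact: ch|exact: inv_continuous].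
- move=> t /andP[yt _].
  have t0 : 0 < t := lt_trans y0 yt.
  have d0 : 0 < t ^+ 2 - y ^+ 2 by rewrite subr_gt0 ltr_pXn2r// nnegrE ltW.
  have h0 : 0 < h t by rewrite sqrtr_gt0.
  have h2 : h t ^+ 2 = t ^+ 2 - y ^+ 2 by rewrite sqr_sqrtr// ltW.
  have dp : is_derive t 1 (fun t : R => t ^+ 2 - y ^+ 2) (2 * t).
    by apply: is_derive_eq; rewrite /GRing.scale/=; ring.
  have ds := @is_derive1_sqrt R (t ^+ 2 - y ^+ 2) d0.
  have dh : is_derive t 1 h (t / h t).
    have -> : t / h t = (2 * h t)^-1 * (2 * t).
      by field; rewrite gt_eqF.
    exact: (@is_derive1_comp _ Num.sqrt (fun t : R => t ^+ 2 - y ^+ 2) t _ _ ds dp).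
  have dq : is_derive t 1 (fun t => h t / y) (t / h t / y).
    have : is_derive t 1 (h * (cst y^-1)) (t / h t / y).
      apply: is_derive_eq; rewrite /GRing.scale/= /cst; ring.
    by [].
  have da := @is_derive1_comp _ atan (fun t => h t / y) t _ _ (@is_derive1_atan R (h t / y)) dq.
  have -> : halfchord y t / t = t / h t - y * ((1 + (h t / y) ^+ 2)^-1 * (t / h t / y)).
    rewrite -/(h t).
    have -> : 1 + (h t / y) ^+ 2 = t ^+ 2 / y ^+ 2.
      by rewrite expr_div_n h2; field; rewrite gt_eqF.
    have -> : h t / t = (h t ^+ 2) / (t * h t) by field; rewrite !gt_eqF.
    by rewrite h2; field; rewrite !gt_eqF.
  have : is_derive t 1 (h - cst y * (atan \o (fun t => h t / y)))
     (t / h t - y * ((1 + (h t / y) ^+ 2)^-1 * (t / h t / y))).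
    apply: is_derive_eq; rewrite /GRing.scale/= /cst; ring.
  by [].
- by rewrite /F /h (@halfchord_eq0 y y)// mul0r atan0 mulr0 !subr0.
Qed.

Definition overhang (r y w : R) := Num.max (r * cos w - y) 0.

Lemma overhang_continuous r y : continuous (overhang r y).
Proof.
move=> w; apply: (@continuous_max _ _ (fun w => r * cos w - y) (cst 0)); last exact: cvg_cst.
apply: cvgB; last exact: cvg_cst.
by apply: cvgM; [exact: cvg_cst|exact: continuous_cos].
Qed.

(** Restrict the integral to [[0, s]] and drop the truncation at 0 there. *)
Lemma sector_le (r y s : R) : 0 <= s <= pi / 2 ->
  ((r * sin s - y * s)%:E <= \int[mu]_(w in `[0%R, (pi / 2)%R]) (overhang r y w)%:E)%E.
Proof.
move=> /andP[s0 s2].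
have cl : continuous (fun w : R => r * cos w - y).
  move=> w; apply: cvgB; last exact: cvg_cst.
  by apply: cvgM; [exact: cvg_cst|exact: continuous_cos].
have -> : ((r * sin s - y * s)%:E = \int[mu]_(w in `[0%R, s]) (r * cos w - y)%:E)%E.
  pose F w : R := r * sin w - y * w; transitivity ((F s - F 0)%:E).
    by rewrite /F sin0 !mulr0 subrr subr0.
  apply/esym; apply: integral_primitive => //.
  - move=> w; apply: cvgB.
      by apply: cvgM; [exact: cvg_cst|exact: continuous_sin].
    by apply: cvgM; [exact: cvg_cst|exact: cvg_id].
  - by move=> w _; exact: cl.
  - move=> w _; apply: is_derive_eq; rewrite /GRing.scale/=; ring.
- apply: (@le_trans _ _ (\int[mu]_(w in `[0%R, s]) (overhang r y w)%:E)%E).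
    apply: le_integral => //.
    + by apply: continuous_compact_integrable; [exact: segment_compact|exact: continuous_subspaceT].
    + apply: continuous_compact_integrable; first exact: segment_compact.
      by apply: continuous_subspaceT; exact: overhang_continuous.
    + by move=> w _; rewrite lee_fin le_max lexx.
  apply: ge0_subset_integral => //.
  + apply/measurable_EFinP; apply: measurable_funTS; apply: continuous_measurable_fun.
    exact: overhang_continuous.
  + by move=> w _; rewrite lee_fin le_max lexx orbT.
  + by move=> w; rewrite /= !in_itv/= => /andP[-> ws]; rewrite (le_trans ws).
Qed.

(** With [s] the angle for which [r cos s = `|l|], the primitive of [chord_integral]
evaluates to [r sin s - `|l| s]. The inequality is in fact an equality. *)
Lemma chord_le_sector (r l : R) : 0 < r -> `|l| <= r ->
  (\int[mu]_(t in `]0%R, r]) (halfchord l t / t)%:E <=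
   \int[mu]_(w in `[0%R, (pi / 2)%R]) (overhang r `|l| w)%:E)%E.
Proof.
move=> r0; rewrite {1}(_ : halfchord l = halfchord `|l|); last first.
  by apply/funext => t; rewrite /halfchord real_normK ?num_real.
move: (normr_ge0 l); move: `|l| => y; rewrite le_eqVlt => /predU1P[<- _|y0 yr].
  apply: le_trans (sector_le r 0 (s := pi / 2) _); last first.
    by rewrite lexx andbT divr_ge0// pi_ge0.
  rewrite sin_pihalf mulr1 mul0r subr0.
  have -> : (\int[mu]_(t in `]0%R, r]) (halfchord 0 t / t)%:E = \int[mu]_(t in `]0%R, r]) (cst 1 t))%E.
    apply: eq_integral => t; rewrite inE/= in_itv/= => /andP[t0 _].
    by rewrite /halfchord expr0n subr0 sqrtr_sqr gtr0_norm// divff// gt_eqF.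
  by rewrite integral_cst//= lebesgue_measure_itv/= lte_fin r0 mul1e oppr0 adde0.
have -> : (\int[mu]_(t in `]0%R, r]) (halfchord y t / t)%:E =
           \int[mu]_(t in `[y, r]) (halfchord y t / t)%:E)%E.
  rewrite integral_mkcond [RHS]integral_mkcond; congr (integral _ _ _); apply/funext => t.
  rewrite !patchE !mem_setE !in_itv/=.
  have [yt|ty] := leP y t; first by rewrite (lt_le_trans y0 yt).
  rewrite /=; case: ifP => // /andP[t0 _]; rewrite halfchord_eq0 ?mul0r//.
  by rewrite !gtr0_norm// ltW.
rewrite chord_integral//.
set q := halfchord y r / y; have q0 : 0 <= q by rewrite divr_ge0 ?sqrtr_ge0// ltW.
apply: le_trans (sector_le r y (s := atan q) _); last first.
  rewrite (ltW (atan_ltpi2 q)) andbT -(@atan0 R).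
  move: q0; rewrite le_eqVlt => /predU1P[<-|]; first exact: lexx.
  by move=> q0; exact/ltW/lt_atan.
rewrite lee_fin lerB//.
have q2 : 1 + q ^+ 2 = (r / y) ^+ 2.
  rewrite /q expr_div_n sqr_sqrtr ?subr_ge0 ?ler_pXn2r// ?nnegrE ?ltW//.
  by field; rewrite gt_eqF.
have cq : cos (atan q) = y / r.
  by rewrite cos_atan q2 sqrtr_sqr ger0_norm ?invf_div// divr_ge0// ltW.
have := atanK q; rewrite /tan cq => sq.
have -> : sin (atan q) = q * (y / r).
  by apply: (canRL (mulfVK _) sq); rewrite mulf_neq0 ?invr_eq0// gt_eqF.
by rewrite le_eqVlt; apply/orP; left; apply/eqP; rewrite /q; field; rewrite !gt_eqF.
Qed.

Lemma integral_cos2 (r c d : R) :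
  (\int[mu]_(w in `[0%R, (pi / 2)%R]) (c * (r * cos w) ^+ 2 + d)%:E =
   (c * r ^+ 2 * (pi / 4) + d * (pi / 2))%:E)%E.
Proof.
pose F w : R := c * r ^+ 2 / 2 * (w + sin w * cos w) + d * w.
transitivity ((F (pi / 2) - F 0)%:E); last first.
  rewrite /F sin_pihalf cos_pihalf sin0; congr EFin.
  by move: (pi : R) => p; field.
apply: integral_primitive.
- by rewrite divr_ge0// pi_ge0.
- move=> w; apply: cvgD; apply: cvgM; try exact: cvg_cst; last exact: cvg_id.
  by apply: cvgD; [exact: cvg_id|apply: cvgM; [exact: continuous_sin|exact: continuous_cos]].
- move=> w _; apply: cvgD; last exact: cvg_cst.
  apply: cvgM; first exact: cvg_cst.
  apply: (@continuous_comp _ _ _ (fun w => r * cos w) (fun x => x ^+ 2)); last exact: exprn_continuous.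
  by apply: cvgM; [exact: cvg_cst|exact: continuous_cos].
- move=> w _; apply: is_derive_eq; rewrite /GRing.scale/=.
  have -> : sin w * - sin w + cos w * cos w = 2 * cos w ^+ 2 - 1 by have := cos2Dsin2 w; lra.
  by field.
Qed.

(** Counting at [r + 1] gives each point of [[- r, r]] weight at least 1. *)
Lemma quadratic_count_finite (Z : set R) : quadratic_count Z ->
  forall r : R, 0 <= r -> finite_set (Z `&` `[- r, r]).
Proof.
move=> qZ r r0; apply: contrapT => inf.
have [C hC] := qZ _ ltr01.
have r1 : 0 <= r + 1 by rewrite addr_ge0.
pose M := (1 + 1) * (r + 1) ^+ 2 + C.
have [B BZ sB] := infinite_set_fset (Num.truncn M).+1 inf.
have hB l : l \in enum_fset B -> `|l| <= r /\ Z l.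
  move=> lB; have [] := BZ l lB; rewrite /= in_itv/= => Zl lr; split => //.
  by rewrite ler_norml.
have := hC _ _ r1 (fset_uniq B).
move=> /(_ _) h; have {h} : \sum_(l <- B) (r + 1 - `|l|) <= M.
  by apply: h => l /hB[lr Zl]; split => //; lra.
have := @sum_ge_size _ (enum_fset B) (fun l => r + 1 - `|l|) 1.
move=> /(_ _) h; have {h} : (size B)%:R * 1 <= \sum_(l <- B) (r + 1 - `|l|).
  by apply: h => l /hB[lr _]; lra.
move=> /le_trans h /h; rewrite mulr1 leNgt => /negP; apply.
by apply: lt_le_trans (truncnS_gt M) _; rewrite ler_nat.
Qed.

Lemma quadratic_count_countable (Z : set R) : quadratic_count Z -> countable Z.
Proof.
move=> qZ; apply: (@sub_countable _ _ _ (\bigcup_n (Z `&` `[- n%:R, n%:R]))).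
  apply: subset_card_le => l Zl; exists (Num.truncn `|l|).+1 => //; split => //=.
  by rewrite in_itv/= -ler_norml ltW// truncnS_gt.
by apply: bigcup_countable => // n _; apply/finite_set_countable/quadratic_count_finite.
Qed.

(** The integral over the radii is replaced, zero by zero, by an integral over the
angle [w]. There the sum over the zeros is the counting sum at [x = r cos w]. *)
Lemma circ_integral_le (Z : set R) (eta C r : R) : 0 < r ->
  finite_set (Z `&` `[- r, r]) ->
  (forall (x : R) (A : seq R), 0 <= x -> uniq A ->
    (forall l, l \in A -> `|l| <= x /\ Z l) ->
    \sum_(l <- A) (x - `|l|) <= (1 + eta) * x ^+ 2 + C) ->
  (\int[mu]_(t in `]0%R, r])
     ((\esum_(l in Z `&` `[(- t)%R, t]) (Num.sqrt (t ^+ 2 - l ^+ 2))%:E) * (t^-1)%:E) <=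
   ((1 + eta) * r ^+ 2 * (pi / 4) + C * (pi / 2))%:E)%E.
Proof.
move=> r0 fin hC; set S := Z `&` _ in fin.
pose A := enum_fset (fset_set S).
have uA : uniq A := fset_uniq _.
have hA l : l \in A -> `|l| <= r /\ Z l.
  by rewrite in_fset_set// inE => -[Zl]; rewrite /= in_itv/= -ler_norml.
(* Half-chords vanish beyond the radius, so for all radii at once the sum may run
   over the same finite list. *)
have E t : `]0, r]%classic t ->
   ((\esum_(l in Z `&` `[(- t)%R, t]) (Num.sqrt (t ^+ 2 - l ^+ 2))%:E) * (t^-1)%:E =
   \sum_(l <- A) (halfchord l t / t)%:E)%E.
  rewrite /= in_itv/= => /andP[t0 tr].
  have -> : Z `&` `[- t, t] = S `&` `[- t, t].
    apply/seteqP; split => [l [Zl lt]|l [[Zl _] lt]]; split => //; split => //.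
    by move: lt; rewrite /= !in_itv/= => /andP[l1 l2]; apply/andP; split; lra.
  rewrite esum_mkcondr esum_fset//; last by move=> l _; case: ifP => // _; rewrite lee_fin sqrtr_ge0.
  rewrite fsbig_finite// sumEFin -mulr_suml EFinM; congr (_ * _)%E.
  rewrite -sumEFin; apply: eq_bigr => l _; case: ifPn => //.
  rewrite mem_setE in_itv/= -ler_norml -ltNge => tl.
  by rewrite halfchord_eq0// (gtr0_norm t0) ltW.
under eq_integral => t tr do rewrite (E t (set_mem tr)).
rewrite ge0_integral_sum//; last 2 first.
- by move=> l; apply/measurable_EFinP; exact: measurable_halfchord.
- move=> l t; rewrite /= in_itv/= => /andP[t0 _].
  by rewrite lee_fin divr_ge0 ?sqrtr_ge0 ?ltW.
apply: (@le_trans _ _ (\sum_(l <- A) \int[mu]_(w in `[0%R, (pi / 2)%R]) (overhang r `|l| w)%:E)%E).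
  by rewrite big_seq [leRHS]big_seq; apply: lee_sum => l /hA[lr _]; exact: chord_le_sector.
have mo (l : R) : measurable_fun `[0%R, (pi / 2)%R] (fun w => (overhang r `|l| w)%:E).
  apply/measurable_EFinP; apply: measurable_funTS; apply: continuous_measurable_fun.
  exact: overhang_continuous.
rewrite -ge0_integral_sum//; last by move=> l w _; rewrite lee_fin le_max lexx orbT.
rewrite -integral_cos2; apply: ge0_le_integral => //.
- by move=> w _; apply: sume_ge0 => l _; rewrite lee_fin le_max lexx orbT.
- by apply: emeasurable_sum => l _; exact: mo.
- apply/measurable_EFinP; apply: measurable_funTS; apply: continuous_measurable_fun.
  move=> w; apply: cvgD; last exact: cvg_cst.
  apply: cvgM; first exact: cvg_cst.
  apply: (@continuous_comp _ _ _ (fun w => r * cos w) (fun x => x ^+ 2)); last exact: exprn_continuous.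
  by apply: cvgM; [exact: cvg_cst|exact: continuous_cos].
- move=> w; rewrite /= in_itv/= => /andP[w0 w2].
  have x0 : 0 <= r * cos w.
    apply: mulr_ge0; [exact: ltW|apply: cos_ge0_pihalf].
    by rewrite w2 andbT (le_trans _ w0)// oppr_le0 divr_ge0// pi_ge0.
  rewrite sumEFin lee_fin; apply: le_trans (hC (r * cos w) [seq l <- A | `|l| <= r * cos w] x0 _ _).
  + rewrite big_filter [leRHS]big_mkcond/=; apply: ler_sum => l _.
    by rewrite /overhang; case: (leP `|l|) => h; [rewrite max_l ?subr_ge0|rewrite max_r// subr_le0 ltW].
  + exact: filter_uniq.
  + by move=> l; rewrite mem_filter => /andP[lx /hA[_ Zl]].
Qed.

Lemma quadratic_count_density (Z : set R) : quadratic_count Z ->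
  (upper_circ_density Z <= 1)%E.
Proof.
move=> qZ; rewrite /upper_circ_density asboolT; last exact: quadratic_count_countable.
apply/lee_addgt0Pr => e e0.
have e20 : 0 < e / 2 by rewrite divr_gt0.
have [C hC] := qZ _ e20.
(* Beyond this radius the term [2 C / r^2] is at most [e / 2]. *)
pose r0 := Num.sqrt (4 * `|C| / e) + 1.
apply: (@le_trans _ _ (ereal_sup [set ((4 / (pi * r ^+ 2))%:E *
       \int[mu]_(t in `]0%R, r])
         ((\esum_(l in Z `&` `[(- t)%R, t]) (Num.sqrt (t ^+ 2 - l ^+ 2))%:E)
          * (t^-1)%:E))%E | r in [set r | r0 < r]])).
  apply: ereal_inf_lbound; exists [set r | r0 < r] => //.
  by exists r0; split => //; exact: num_real.
apply: ub_ereal_sup => _ [r /= rr <-].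
have r1 : 0 < r by apply: lt_trans rr; rewrite ltr_wpDl// sqrtr_ge0.
have Cr : 4 * `|C| / e <= r ^+ 2.
  rewrite -[leLHS]sqr_sqrtr; last by rewrite divr_ge0 ?mulr_ge0// ltW.
  rewrite ler_pXn2r ?nnegrE ?sqrtr_ge0 ?ltW//.
  by apply: le_lt_trans rr; rewrite /r0 lerDl.
have p0 : 0 < pi :> R := pi_gt0 R.
apply: (@le_trans _ _ ((4 / (pi * r ^+ 2))%:E * ((1 + e / 2) * r ^+ 2 * (pi / 4) + C * (pi / 2))%:E)%E).
  apply: lee_wpmul2l; first by rewrite lee_fin divr_ge0// mulr_ge0 ?sqr_ge0// ltW.
  by apply: circ_integral_le => //; apply: quadratic_count_finite => //; exact: ltW.
rewrite -EFinM -EFinD lee_fin.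
have -> : 4 / (pi * r ^+ 2) * ((1 + e / 2) * r ^+ 2 * (pi / 4) + C * (pi / 2)) =
    1 + e / 2 + 2 * C / r ^+ 2.
  by move: (pi : R) p0 => p p0; field; rewrite !gt_eqF.
suff : 2 * C / r ^+ 2 <= e / 2 by lra.
rewrite ler_pdivrMr ?exprn_gt0//.
move: Cr; rewrite ler_pdivrMr//; have := ler_norm C; lra.
Qed.

End density.

Theorem theorem2 (R : realType) (g : R -> R[i]) (f : R -> R[i])
    (hg : tp_gaussian_type g) (hf : Vinfty g f)
    (hf0 : exists x : R, f x <> 0) :
  (upper_circ_density [set x : R | f x = 0%R] <= 1)%E.
Proof.
have [ds [a [c1 [c2 [B [a0 c1B c2B reE imE]]]]]] := Vinfty_representation hg hf.
have [x fx] := hf0.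
suff [u uc fu] : exists2 u : R -> R, quadratic_count [set l | u l = 0] &
    forall y, f y = 0 -> u y = 0.
  apply: quadratic_count_density => eta /uc[C hC]; exists C => r A r0 uA hA.
  by apply: hC => // l /hA[lr /= fl]; split => //; exact: fu.
have [re0|re0] := eqVneq (complex.Re (f x)) 0; last first.
  exists (relaxs ds (gauss_series c1 a)); last by move=> y fy; rewrite -reE fy.
  by apply: relaxs_gauss_series_count a0 c1B _; exists x; rewrite -reE.
exists (relaxs ds (gauss_series c2 a)); last by move=> y fy; rewrite -imE fy.
apply: relaxs_gauss_series_count a0 c2B _; exists x; rewrite -imE.
apply/eqP => im0; apply: fx; move: re0 im0; case: (f x) => p q /= -> ->.
by [].
Qed.
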